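(* Let $k$ be an algebraically closed field, let $X$ be a variety over $k$ with generic point $\eta$, and let $f: X\to X$ be a flat and finite endomorphism. Let $x\in X(k)$ be a point such that $\bigcup_{i\geq 0}f^{-i}(x)$ is Zariski dense in $X$. Then for every sequence of (finite, nonempty) intervals $I_n$, $n\geq 0$, in $\mathbb{Z}_{\geq 0}$ with $\lim_{n\to\infty}\# I_n=+\infty$, we have $$\lim_{n\to\infty}\frac{1}{\#I_n}\Big(\sum_{i\in I_n}d_f^{-i}(f^i)^*\delta_{x}\Big)=\delta_{\eta}$$ in $\mathcal{M}(|X|)$ with the weak-$\ast$ topology.
   Context: A variety is an irreducible, reduced, separated scheme of finite type over a field. $d_f:=[k(X):f^*k(X)]$ is the topological degree of $f$. For a flat finite endomorphism $g$ of $X$ and $x\in X$, the multiplicity of $g$ at $x$ is $m_g(x):=\dim_{\kappa(g(x))}(\mathcal{O}_{X,x}/\mathfrak{m}_{g(x)}\mathcal{O}_{X,x})\in\mathbb{Z}_{\ge1}$, where $\mathcal{O}_{X,x}$ is viewed as an $\mathcal{O}_{X,g(x)}$-module via $g$; one has $\sum_{y\in g^{-1}(x)}m_g(y)=d_g$ for all $x\in X$. $|X|$ denotes the underlying set of the scheme $X$ with the constructible topology (generated by the constructible subsets); it is compact Hausdorff. $\mathcal{M}(|X|)$ is the space of (positive) Radon measures on $|X|$ with the weak-$\ast$ topology, and $\delta_x$ is the Dirac measure at $x$. For continuous $\phi:|X|\to\mathbb{R}$, the function $g_*\phi(x):=\sum_{y\in g^{-1}(x)}m_g(y)\phi(y)$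 is continuous, and the pullback $g^*:\mathcal{M}(|X|)\to\mathcal{M}(|X|)$ is defined by $\int\phi\,d(g^*\mu)=\int(g_*\phi)\,d\mu$. In particular $g^*\delta_x=\sum_{y\in g^{-1}(x)}m_g(y)\delta_y$. *)

(* Defs.v *)
From HB Require Import structures.
From mathcomp Require Import all_boot all_order all_algebra.
From mathcomp Require Import all_classical all_reals all_analysis.

Set Implicit Arguments.
Unset Strict Implicit.
Unset Printing Implicit Defensive.

Import Order.TTheory GRing.Theory Num.Theory.
Import numFieldNormedType.Exports.
Local Open Scope classical_set_scope.
Local Open Scope ring_scope.

(* Rings of sections may be zero (over the empty set), hence [comPzRingType]. *)

Definition is_unit (A : comPzRingType) (a : A) := exists b, a * b = 1.

(* The maximal ideal, when [A] is local. *)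
Definition nonunits (A : comPzRingType) : set A := [set a | ~ is_unit a].

Definition ideal_gen (A : comPzRingType) (S : set A) : set A :=
  [set a | exists n (c s : 'I_n -> A),
    (forall i, S (s i)) /\ a = \sum_(i < n) c i * s i].

Definition prime_ideal (A : comPzRingType) (p : set A) : Prop :=
  [/\ p 0, ~ p 1, forall a b, p a -> p b -> p (a + b),
      forall a b, p b -> p (a * b) &
      forall a b, p (a * b) -> p a \/ p b].

(* [phi] exhibits [B] as the localization of [A] at the multiplicative set
   [S]. *)
Definition is_localization (A B : comPzRingType) (phi : A -> B) (S : set A) :=
  [/\ forall s, S s -> is_unit (phi s),
      forall b, exists a s, S s /\ b * phi s = phi a &
      forall a, phi a = 0 -> exists2 s, S s & s * a = 0].

Definition module_finite (A B : comPzRingType) (phi : A -> B) :=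
  exists n (e : 'I_n -> B), forall b, exists c : 'I_n -> A,
    b = \sum_(i < n) phi (c i) * e i.

Definition algebra_finite (A B : comPzRingType) (phi : A -> B) :=
  exists n (t : 'I_n -> B), forall S : set B,
    (forall a, S (phi a)) -> (forall i, S (t i)) ->
    (forall b c, S b -> S c -> S (b + c)) ->
    (forall b c, S b -> S c -> S (b * c)) ->
    forall b, S b.

Section Flatness.
Variables (A B : comPzRingType) (phi : {rmorphism A -> B}).

(* [B] is an [A]-module through [phi]. *)
Definition bilinear_along (N P : lmodType A) (beta : B -> N -> P) :=
  [/\ forall b b' v, beta (b + b') v = beta b v + beta b' v,
      forall b v v', beta b (v + v') = beta b v + beta b v',
      forall a b v, beta (phi a * b) v = a *: beta b v &
      forall a b v, beta b (a *: v) = a *: beta b v].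

(* The element sum_i b_i (x) v_i of B (x)_A N is zero: by the universal
   property, this says that every bilinear map kills it. *)
Definition tensor_eq0 (N : lmodType A) n (b : 'I_n -> B) (v : 'I_n -> N) :=
  forall (P : lmodType A) (beta : B -> N -> P),
    bilinear_along beta -> \sum_(i < n) beta (b i) (v i) = 0.

(* B (x)_A - preserves injections. *)
Definition flat_ring_morphism :=
  forall (N N' : lmodType A) (u : {linear N -> N'}), injective u ->
  forall n (b : 'I_n -> B) (v : 'I_n -> N),
    tensor_eq0 b (u \o v) -> tensor_eq0 b v.

End Flatness.

(* The classes of the [e i] form a basis of B/J over the field A/I, where
   phi(I) is contained in J. *)
Definition quotient_basis (A B : comPzRingType) (phi : A -> B)
    (I : set A) (J : set B) n (e : 'I_n -> B) :=
  (forall b, exists c : 'I_n -> A, J (b - \sum_(i < n) phi (c i) * e i)) /\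
  (forall c : 'I_n -> A, J (\sum_(i < n) phi (c i) * e i) -> forall i, I (c i)).

(* dim_(A/I) (B/J), with value 0 if that dimension is infinite. *)
Definition quotient_dim (A B : comPzRingType) (phi : A -> B)
    (I : set A) (J : set B) : nat :=
  xget 0%N [set n | exists e : 'I_n -> B, quotient_basis phi I J e].

(* [sec U] is meaningful only for open [U].  The stalk at [x] is part of the
    data; [germ_surj] and [germ_eq] say that it is the colimit of the [sec U]
    over the open neighbourhoods [U] of [x]. *)

Record lrspace := LRSpace {
  pt :> topologicalType;
  sec : set pt -> comPzRingType;
  res : forall U V : set pt, open U -> open V -> V `<=` U ->
    {rmorphism sec U -> sec V};
  stalk : pt -> comNzRingType;
  germ : forall (U : set pt) (x : pt), open U -> U x ->
    {rmorphism sec U -> stalk x};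
  res_id : forall U (oU oU' : open U) (UU : U `<=` U) (s : sec U),
    res oU oU' UU s = s;
  res_res : forall U V W (oU : open U) (oV : open V) (oW : open W)
    (VU : V `<=` U) (WV : W `<=` V) (WU : W `<=` U) (s : sec U),
    res oV oW WV (res oU oV VU s) = res oU oW WU s;
  sec_eq : forall U (oU : open U) (I : Type) (V : I -> set pt)
    (oV : forall i, open (V i)) (VU : forall i, V i `<=` U),
    U `<=` \bigcup_i V i ->
    forall s t : sec U,
    (forall i, res oU (oV i) (VU i) s = res oU (oV i) (VU i) t) -> s = t;
  sec_glue : forall U (oU : open U) (I : Type) (V : I -> set pt)
    (oV : forall i, open (V i)) (VU : forall i, V i `<=` U),
    U `<=` \bigcup_i V i ->
    forall s : forall i, sec (V i),
    (forall i j (oVV : open (V i `&` V j)),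
       res (oV i) oVV (@subIsetl _ _ _) (s i) =
       res (oV j) oVV (@subIsetr _ _ _) (s j)) ->
    exists t : sec U, forall i, res oU (oV i) (VU i) t = s i;
  germ_res : forall U V x (oU : open U) (oV : open V) (VU : V `<=` U)
    (Ux : U x) (Vx : V x) (s : sec U),
    germ oV Vx (res oU oV VU s) = germ oU Ux s;
  germ_surj : forall x (a : stalk x),
    exists U (oU : open U) (Ux : U x) (s : sec U), germ oU Ux s = a;
  germ_eq : forall U V x (oU : open U) (oV : open V) (Ux : U x) (Vx : V x)
    (s : sec U) (t : sec V), germ oU Ux s = germ oV Vx t ->
    exists W (oW : open W) (WU : W `<=` U) (WV : W `<=` V),
      W x /\ res oU oW WU s = res oV oW WV t;
  stalk_local : forall x (a b : stalk x),
    is_unit (a + b) -> is_unit a \/ is_unit b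
}.

Record lrmor (X Y : lrspace) := LRMor {
  fpt :> X -> Y;
  fcts : continuous fpt;
  fsec : forall U : set Y, open U ->
    {rmorphism sec U -> sec (fpt @^-1` U)};
  fstalk : forall x : X, {rmorphism stalk (fpt x) -> stalk x};
  fsec_res : forall (U V : set Y) (oU : open U) (oV : open V) (VU : V `<=` U)
    (oU' : open (fpt @^-1` U)) (oV' : open (fpt @^-1` V))
    (VU' : fpt @^-1` V `<=` fpt @^-1` U) (s : sec U),
    res oU' oV' VU' (fsec oU s) = fsec oV (res oU oV VU s);
  fstalk_germ : forall (U : set Y) (oU : open U) (x : X) (Ufx : U (fpt x))
    (oU' : open (fpt @^-1` U)) (s : sec U),
    fstalk x (germ oU Ufx s) = germ (x := x) oU' Ufx (fsec oU s);
  fstalk_local : forall x (a : stalk (fpt x)),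
    is_unit (fstalk x a) -> is_unit a
}.

Arguments fcts {X Y} f x : rename.
Arguments fsec {X Y} f {U} oU : rename.
Arguments fstalk {X Y} f x : rename.
Arguments fsec_res {X Y} f {U V} oU oV VU oU' oV' VU' s : rename.
Arguments fstalk_germ {X Y} f {U} oU {x} Ufx oU' s : rename.

(* Equality of morphisms.  The rings [sec (f @^-1` U)] and [sec (g @^-1` U)]
   are not syntactically equal, so sections are compared through their germs. *)
Definition eq_mor (X Y : lrspace) (f g : lrmor X Y) :=
  f =1 g /\
  forall (U : set Y) (oU : open U) (x : X) (Ufx : U (f x)) (Ugx : U (g x))
    (oF : open (f @^-1` U)) (oG : open (g @^-1` U)) (s : sec U),
    germ (x := x) oF Ufx (fsec f oU s) = germ (x := x) oG Ugx (fsec g oU s).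

Section IdComp.
Variables X Y Z : lrspace.

Program Definition id_lrmor : lrmor X X :=
  @LRMor X X id _ (fun U _ => idfun) (fun x => idfun) _ _ _.
Next Obligation. by move=> x A. Qed.
Next Obligation.
by move=> U V oU oV VU oU' oV' VU' s /=; congr (res _ _ _ s); exact: Prop_irrelevance.
Qed.
Next Obligation.
by move=> U oU x Ux oU' s /=; congr (germ _ _ s); exact: Prop_irrelevance.
Qed.
Next Obligation. by []. Qed.

Variables (g : lrmor Y Z) (f : lrmor X Y).

Let preim_open (U : set Z) (oU : open U) : open (g @^-1` U).
Proof. by move/continuousP: (fcts g); apply. Qed.

Program Definition comp_lrmor : lrmor X Z :=
  @LRMor X Z (g \o f) _
    (fun U oU => fsec f (preim_open oU) \o fsec g oU)
    (fun x => fstalk f x \o fstalk g (f x)) _ _ _.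
Next Obligation. by move=> x; apply: continuous_comp; exact: fcts. Qed.
Next Obligation.
move=> U V oU oV VU oU' oV' VU' s /=.
rewrite -(fsec_res g oU oV VU (preim_open oU) (preim_open oV) (fun y => VU (g y))).
exact: fsec_res.
Qed.
Next Obligation.
move=> U oU x Ux oU' s /=.
by rewrite (fstalk_germ g oU _ (preim_open oU)) (fstalk_germ f).
Qed.
Next Obligation. by move=> x a /fstalk_local /fstalk_local. Qed.

End IdComp.

(* [h] and [phi] are an isomorphism from the ringed space (U, O_U) to Spec A:
   [h] is a homeomorphism from U onto the set of prime ideals of A with its
   Zariski topology, with basis D(a) = {p | a \notin p}; the structure sheaf of
   Spec A is determined by its sections A_a over the D(a), so the isomorphism
   of sheaves amounts to a morphism [phi : A -> O(U)] which identifies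
   A_a with O(h^-1 D(a)) for every a. *)
Definition is_spec (X : lrspace) (U : set X) (oU : open U) (A : comPzRingType)
    (h : X -> set A) (phi : {rmorphism A -> sec U}) : Prop :=
  let D (a : A) : set X := [set x | U x /\ ~ h x a] in
  [/\ set_bij U [set p | prime_ideal p] h,
      forall W, W `<=` U ->
        (open W <-> forall x, W x -> exists a, D a x /\ D a `<=` W) &
      forall a (oD : open (D a)) (DU : D a `<=` U),
        is_localization (res oU oD DU \o phi) [set a ^+ n | n in setT]].

Definition affine_open (X : lrspace) (U : set X) (oU : open U) :=
  exists (A : comPzRingType) (h : X -> set A) (phi : {rmorphism A -> sec U}),
    is_spec oU h phi.

Definition is_scheme (X : lrspace) :=
  forall x : X, exists (U : set X) (oU : open U), U x /\ affine_open oU.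

(* A morphism X -> Spec k is the same thing as a ring morphism k -> O(X). *)
Record kscheme (k : fieldType) := KScheme {
  klr :> lrspace;
  scal : {rmorphism k -> sec [set: klr]};
  kscheme_is_scheme : is_scheme klr
}.

Record kmor (k : fieldType) (X Y : kscheme k) := KMor {
  kfun :> lrmor X Y;
  kfun_scal : forall (c : k) (oT : open [set: Y]),
    fsec kfun oT (scal Y c) = scal X c
}.

Section KCategory.
Variable k : fieldType.

Definition id_kmor (X : kscheme k) : kmor X X :=
  @KMor k X X (id_lrmor X) (fun _ _ => erefl).

Program Definition comp_kmor (X Y Z : kscheme k) (g : kmor Y Z) (f : kmor X Y) :
  kmor X Z := @KMor k X Z (comp_lrmor g f) _.
Next Obligation.
by move=> X Y Z g f c oT /=; rewrite (kfun_scal g c oT); exact: (kfun_scal f c).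
Qed.

Definition iter_kmor (X : kscheme k) (f : kmor X X) (n : nat) : kmor X X :=
  iter n (comp_kmor f) (id_kmor X).

(* [P] with [p1], [p2] is the fibre product of [X] and [Y] over Spec k. *)
Definition is_product (X Y P : kscheme k) (p1 : kmor P X) (p2 : kmor P Y) :=
  (forall (T : kscheme k) (a : kmor T X) (b : kmor T Y), exists h : kmor T P,
     eq_mor (comp_kmor p1 h) a /\ eq_mor (comp_kmor p2 h) b) /\
  (forall (T : kscheme k) (h h' : kmor T P),
     eq_mor (comp_kmor p1 h) (comp_kmor p1 h') ->
     eq_mor (comp_kmor p2 h) (comp_kmor p2 h') -> eq_mor h h').

Definition closed_immersion (X Y : lrspace) (i : lrmor X Y) :=
  [/\ closed (range i), injective i,
      forall U : set X, open U -> exists2 V : set Y, open V & i @^-1` V = U &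
      forall (x : X) (a : stalk x), exists b, fstalk i x b = a].

Definition separated (X : kscheme k) :=
  exists (P : kscheme k) (p1 p2 : kmor P X) (Delta : kmor X P),
    [/\ is_product p1 p2, eq_mor (comp_kmor p1 Delta) (id_kmor X),
        eq_mor (comp_kmor p2 Delta) (id_kmor X) & closed_immersion Delta].

Definition finite_type (X : kscheme k) :=
  exists n (U : 'I_n -> set X) (oU : forall i, open (U i)),
    \bigcup_i U i = setT /\
    forall i, affine_open (oU i) /\
      algebra_finite (res openT (oU i) (@subsetT _ (U i)) \o scal X).

Definition irreducible_space (T : topologicalType) :=
  [set: T] !=set0 /\
  forall F G : set T, closed F -> closed G -> F `|` G = setT ->
    F = setT \/ G = setT.

Definition reduced (X : lrspace) :=
  forall U : set X, open U -> forall (s : sec U) n, s ^+ n = 0 -> s = 0.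

Definition variety (X : kscheme k) :=
  [/\ irreducible_space X, reduced X, separated X & finite_type X].

(* The points of X(k) are the points whose residue field is k. *)
Definition rational_point (X : kscheme k) (x : X) :=
  forall a : stalk x, exists c : k,
    nonunits (a - germ openT (I : [set: X] x) (scal X c)).

End KCategory.

Definition generic_point (T : topologicalType) (eta : T) :=
  closure [set eta] = setT.

Definition flat_mor (X Y : lrspace) (f : lrmor X Y) :=
  forall x : X, flat_ring_morphism (fstalk f x).

Definition finite_mor (X Y : lrspace) (f : lrmor X Y) :=
  forall y : Y, exists (V : set Y) (oV : open V) (oV' : open (f @^-1` V)),
    [/\ V y, affine_open oV, affine_open oV' & module_finite (fsec f oV)].

(* [k(X) : f^* k(X)], where k(X) is the stalk at the generic point [eta],
   and f(eta) = eta as soon as [f] is dominant. *)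
Definition top_degree (X : lrspace) (eta : X) (f : lrmor X X) : nat :=
  quotient_dim (fstalk f eta) [set 0] [set 0].

Definition multiplicity (X : lrspace) (g : lrmor X X) (x : X) : nat :=
  quotient_dim (fstalk g x) (@nonunits (stalk (g x)))
    (ideal_gen (fstalk g x @` @nonunits (stalk (g x)))).

Definition constructible (T : topologicalType) (C : set T) :=
  exists n (U F : 'I_n -> set T),
    [/\ forall i, open (U i), forall i, closed (F i) &
        C = \bigcup_i (U i `&` F i)].

(* |X|: the set X with the topology generated by the constructible subsets.
   The base point is only there because measurable types are pointed. *)
Definition cspace (X : lrspace) (x0 : X) : Type := X.

HB.instance Definition _ (X : lrspace) (x0 : X) :=
  Choice.copy (cspace x0) (pt X).
HB.instance Definition _ (X : lrspace) (x0 : X) :=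
  isPointed.Build (cspace x0) x0.
HB.instance Definition _ (X : lrspace) (x0 : X) :=
  isSubBaseTopological.Build (cspace x0)
    (I := set X) [set C | @constructible X C] id.

Lemma open_constructible (X : lrspace) (x0 : X) (C : set X) :
  constructible C -> open (C : set (cspace x0)).
Proof.
move=> cC; exists [set C]; last by rewrite bigcup_set1.
by move=> _ ->; exact: (@finI_from1 (set X) X (@constructible X) id).
Qed.

Lemma constructible_open (T : topologicalType) (U : set T) :
  open U -> constructible U /\ constructible (~` U).
Proof.
move=> oU; split.
- exists 1%N, (fun=> U), (fun=> setT); split=> //.
  by apply/seteqP; split=> [x Ux|x [_ _ []//]]; exists ord0.
- exists 1%N, (fun=> setT), (fun=> ~` U); split=> //.
  + by move=> _; exact: openT.
  + by move=> _; exact: open_closedC.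
  + by apply/seteqP; split=> [x Ux|x [_ _ []//]]; exists ord0.
Qed.

Lemma scheme_kolmogorov (k : fieldType) (X : kscheme k) (x y : X) : x <> y ->
  exists2 U : set X, open U & (U x /\ ~ U y) \/ (U y /\ ~ U x).
Proof.
move=> xy; have [U [oU [Ux [A [h [phi]]]]]] := @kscheme_is_scheme _ X x.
move=> [[_ hinj _] basis _].
have [Uy|Uy] := pselect (U y); last by exists U => //; left.
have DU a : [set z | U z /\ ~ h z a] `<=` U by move=> z [].
have oD a : open [set z : X | U z /\ ~ h z a].
  have [_ basisD] := basis _ (DU a).
  by apply: basisD => z Dz; exists a; split.
apply: contrapT => nsep; apply: xy; apply: hinj; rewrite ?inE //.
apply/seteqP; split=> a ha; apply: contrapT => nha; apply: nsep;
  exists [set z : X | U z /\ ~ h z a] => //=.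
- by right; split=> // -[].
- by left; split=> // -[].
Qed.

Lemma cspace_hausdorff (k : fieldType) (X : kscheme k) (x0 : X) :
  hausdorff_space (cspace x0).
Proof.
rewrite open_hausdorff => x y /eqP /scheme_kolmogorov [U oU xyU].
have [/(open_constructible x0) cU /(open_constructible x0) cU'] :=
  constructible_open oU.
case: xyU => -[Ux Uy].
- by exists (U, ~` U); rewrite ?inE //=; split=> //; rewrite setICr.
- by exists (~` U, U); rewrite ?inE //=; split=> //; rewrite setICl.
Qed.

Arguments cspace_hausdorff {k X} x0 p q _.

Definition borel (T : ptopologicalType) := g_sigma_algebraType (@open T).

(* Radon measures on a compact Hausdorff space [T]; these are finite. *)
Record radon (T : ptopologicalType) (R : realType) := Radon {
  rmeas :> {finite_measure set (borel T) -> \bar R};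
  rmeas_regular : forall E : set (borel T), measurable E ->
    forall e : R, 0 < e -> exists K : set (borel T),
      [/\ @compact T K, measurable K, K `<=` E &
          (rmeas E <= rmeas K + e%:E)%E]
}.

HB.instance Definition _ T R := gen_eqMixin (radon T R).
HB.instance Definition _ T R := gen_choiceMixin (radon T R).

Definition radon_int (T : ptopologicalType) (R : realType) (mu : radon T R)
    (phi : T -> R) : R := Rintegral mu setT phi.

Definition radon_eval (T : ptopologicalType) (R : realType) (mu : radon T R) :
  {ptws continuousType T R -> R} := fun phi => radon_int mu phi.

(* The weak-* topology: pointwise convergence on continuous functions. *)
HB.instance Definition _ T R :=
  Topological.copy (radon T R) (initial_topology (@radon_eval T R)).

Section RadonOperations.
Variables (T : ptopologicalType) (R : realType).
Implicit Types mu nu : radon T R.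

Let mzero_fin : fin_num_fun (mzero : set (borel T) -> \bar R).
Proof. by []. Qed.
HB.instance Definition _ :=
  Measure_isFinite.Build _ (borel T) R mzero mzero_fin.

Program Definition radon0 : radon T R :=
  @Radon T R (@mzero _ (borel T) R) _.
Next Obligation.
move=> E _ e e0; exists set0; split=> //; first exact: compact0.
by rewrite /mzero add0e lee_fin ltW.
Qed.

Program Definition radon_dirac (hT : hausdorff_space T) (x : T) : radon T R :=
  @Radon T R (@dirac _ (borel T) x R) _.
Next Obligation.
move=> hT x E mE e e0; have [Ex|Ex] := pselect (E x); last first.
  exists set0; split=> //; first exact: compact0.
  by rewrite /= !diracE memNset //= in_set0 add0e lee_fin ltW.
have cx : compact [set x] by exact: compact_set1.
exists [set x]; split=> //.
- rewrite -[X in measurable X]setCK; apply: measurableC.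
  apply: sub_sigma_algebra; apply: closed_openC.
  exact: (compact_closed hT).
- by move=> _ ->.
- by rewrite /= !diracE !mem_set //= leeDl // lee_fin ltW.
Qed.

Section Add.
Variables mu nu : radon T R.

Let add_fin : fin_num_fun (measure_add mu nu).
Proof.
move=> A mA; rewrite measure_addE fin_numD.
by rewrite !(fin_num_measure (rmeas _)).
Qed.
HB.instance Definition _ :=
  isMeasure.Build _ (borel T) R (measure_add mu nu)
    (measure0 (measure_add mu nu)) (measure_ge0 (measure_add mu nu))
    (@measure_semi_sigma_additive _ _ _ (measure_add mu nu)).
HB.instance Definition _ :=
  Measure_isFinite.Build _ (borel T) R (measure_add mu nu) add_fin.

Program Definition radonD : radon T R :=
  @Radon T R (measure_add mu nu) _.
Next Obligation.
move=> E mE e e0; have e20 : 0 < e / 2 by rewrite divr_gt0.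
have [K [cK mK KE leK]] := rmeas_regular mu mE e20.
have [L [cL mL LE leL]] := rmeas_regular nu mE e20.
have mKL : measurable (K `|` L) by exact: measurableU.
exists (K `|` L); split=> //; first exact: compactU.
  by move=> x [/KE|/LE].
rewrite /= !measure_addE [e in e%:E]splitr EFinD addeACA leeD //.
- by apply: (le_trans leK); rewrite leeD2r // le_measure ?inE.
- by apply: (le_trans leL); rewrite leeD2r // le_measure ?inE.
Qed.

End Add.

Program Definition radonZ (r : {nonneg R}) mu : radon T R :=
  @Radon T R (mscale r mu) _.
Next Obligation.
move=> r mu E mE e e0.
have r1 : 0 < r%:num + 1 by rewrite ltr_wpDl.
have [K [cK mK KE leK]] := rmeas_regular mu mE (divr_gt0 e0 r1).
exists K; split=> //; rewrite /mscale /=.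
apply: (@le_trans _ _ (r%:num%:E * (mu K + (e / (r%:num + 1))%:E))%E).
  by rewrite lee_wpmul2l // lee_fin.
rewrite ge0_muleDr // ?lee_fin ?(ltW (divr_gt0 _ _)) //.
rewrite -EFinM leeD2l // lee_fin.
by rewrite mulrCA ger_pMr // ler_pdivrMr // mul1r lerDl.
Qed.

End RadonOperations.

Arguments radon0 {T R}.
Arguments radonD {T R} mu nu.
Arguments radonZ {T R} r mu.
Arguments radon_dirac {T} R hT x.

Section Pullback.
Variables (X : lrspace) (x0 : X) (R : realType).

(* g_* phi; the fibres of [g] are finite when [g] is a finite morphism. *)
Definition pushforward_fun (g : lrmor X X) (phi : cspace x0 -> R) :
    cspace x0 -> R :=
  fun x => \sum_(y \in g @^-1` [set x]) (multiplicity g y)%:R * phi y.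

(* g^* mu; it is characterized by this property when [g] is flat and finite
   and |X| is compact Hausdorff, and is junk when no such measure exists. *)
Definition pullback (g : lrmor X X) (mu : radon (cspace x0) R) :
    radon (cspace x0) R :=
  xget radon0 [set nu : radon (cspace x0) R |
    forall phi : cspace x0 -> R, continuous phi ->
      radon_int nu phi = radon_int mu (pushforward_fun g phi)].

End Pullback.

(* Main.v *)
(* Let Q be the set of rational points, which contains the backward orbit of x.
   At z in Q the finite flat morphism f is free: lifts of bases of the fibres
   O_y / m_z O_y, for y over z, are independent (equational criterion of
   flatness and Nakayama) and generate near z.  Comparing with the generic point
   gives sum_(f y = z) m_f(y) = d_f; multiplicities are multiplicative along
   flat local morphisms; and f is open on Q, since the matrix coefficients of a
   power of a section b over such a basis detect whether b vanishes on a fibre.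

   Hence d^-i (f^i)^* delta_x is the law of a backward random walk from x, and
   its averages mu_n are asymptotically f^*-invariant.  If mu_n(Z) does not tend
   to 0 for some proper closed Z, take Z minimal, X being noetherian.  The sets
   f^-i(Z) have asymptotically the same mass, so two of them meet in a
   non-negligible set, and minimality gives Z contained in f^-p(Z) for some
   p > 0.  The part of f^-p(Z) outside Z is negligible and has, f being open, an
   open image in Z, so by minimality again it has no rational point.  The union
   of the f^-j(Z), j < p, is then a proper closed totally invariant set that
   meets the backward orbit, hence contains it: a contradiction.  So mu_n(Z)
   tends to 0, and a function continuous for the constructible topology is
   bounded and nearly constant off a proper closed set.

   Every continuous function is integrable against the pullbacks through their
   explicit form as finite sums of Dirac masses; the function g_* phi is only
   integrated against delta_x, which does not require its continuity. *)

Require Import Defs.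
From HB Require Import structures.
From mathcomp Require Import all_boot all_order all_algebra.
From mathcomp Require Import ring_quotient generic_quotient.
From mathcomp Require Import all_classical all_reals all_analysis.
From mathcomp Require Import measurable_realfun.
From mathcomp Require Import zify ring lra.

Set Implicit Arguments.
Unset Strict Implicit.
Unset Printing Implicit Defensive.

Import Order.TTheory GRing.Theory Num.Theory.
Import numFieldNormedType.Exports.
Local Open Scope classical_set_scope.
Local Open Scope ring_scope.

(** * Flatness *)

(** Fibres are studied only over rational points. There the residue field is [k] itself, embedded by
    the scalars, so O_y / m_z O_y is a [k]-vector space and can be handled by linear algebra modulo
    an ideal, without forming the quotient ring. This loses nothing, since the averages charge only
    the backward orbit of [x]. Flatness is given through bilinear maps; its equational form, which
    concerns finitely many elements, is the one that can be composed and computed with in stalks.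
    One relation recurs, b^N (1 - b h) = 0 modulo an ideal, with h a polynomial in b. It yields the
    idempotents that separate the points of a fibre, the inverses of denominators, the rationality
    of preimages, and the nilpotency bound behind openness. The dynamics is run on functions:
    pairing with [delta_x] turns the pullbacks into iterates of a transfer operator evaluated at
    [x], so that indicators of arbitrary sets can be averaged before any integral appears. *)

Record submodule (A : pzRingType) (V : lmodType A) := Submodule {
  smset :> V -> Prop;
  sm0 : smset 0;
  smB : forall u v, smset u -> smset v -> smset (u - v);
  smZ : forall a v, smset v -> smset (a *: v)
}.

Section QuotientModule.
Local Open Scope quotient_scope.
Variables (A : pzRingType) (V : lmodType A) (K : submodule V).

Definition smpred : {pred V} := fun v => `[< K v >].

Let smpred_closed : zmod_closed smpred.
Proof.
split; first exact/asboolP/sm0.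
by move=> u v /asboolP Ku /asboolP Kv; apply/asboolP/smB.
Qed.
HB.instance Definition _ := GRing.isZmodClosed.Build V smpred smpred_closed.

Definition qmod : Type := Quotient.quot smpred.
HB.instance Definition _ := GRing.Zmodule.on qmod.

Definition qpi : V -> qmod := \pi_(Quotient.quot smpred).

Lemma qpi_eq u v : qpi u = qpi v <-> K (u - v).
Proof.
split=> [/eqP|Kuv]; first by rewrite -Quotient.idealrBE => /asboolP.
by apply/eqP; rewrite -Quotient.idealrBE; apply/asboolP.
Qed.

Definition qrepr (q : qmod) : V := repr (q : Quotient.quot smpred).

Lemma qreprK q : qpi (qrepr q) = q. Proof. exact: reprK. Qed.

Lemma qreprP u : K (qrepr (qpi u) - u).
Proof. by apply/qpi_eq; rewrite qreprK. Qed.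

Lemma qpiD u v : qpi (u + v) = qpi u + qpi v.
Proof. exact: (raddfD (\pi_(Quotient.quot smpred))). Qed.

Definition qscale (a : A) (q : qmod) : qmod := qpi (a *: qrepr q).

Let qscale_pi a u : qscale a (qpi u) = qpi (a *: u).
Proof. by apply/qpi_eq; rewrite -scalerBr; apply: smZ; exact: qreprP. Qed.

Let qscaleA a b v : qscale a (qscale b v) = qscale (a * b) v.
Proof. by rewrite -(qreprK v) !qscale_pi scalerA. Qed.
Let qscale1 : left_id 1 qscale.
Proof. by move=> v; rewrite -(qreprK v) !qscale_pi scale1r. Qed.
Let qscaleDr : right_distributive qscale +%R.
Proof.
by move=> a u v; rewrite -(qreprK u) -(qreprK v) -qpiD !qscale_pi scalerDr qpiD.
Qed.
Let qscaleDl v : {morph qscale^~ v : a b / a + b}.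
Proof. by move=> a b; rewrite -(qreprK v) !qscale_pi scalerDl qpiD. Qed.
HB.instance Definition _ := GRing.Zmodule_isLmodule.Build A qmod
  qscaleA qscale1 qscaleDr qscaleDl.

Lemma qpiZ a u : qpi (a *: u) = a *: qpi u.
Proof. by rewrite -qscale_pi. Qed.

End QuotientModule.

Section RestrictionOfScalars.
Variables (A B : comPzRingType) (phi : {rmorphism A -> B}).

(** The morphism is a phantom argument: it gives the module structure a type of its own to be
    attached to. *)
Definition restr_scalars of {rmorphism A -> B} : Type := B.
HB.instance Definition _ := GRing.Zmodule.on (restr_scalars phi).

Definition rscale (a : A) (b : restr_scalars phi) : restr_scalars phi :=
  phi a * (b : B).

Let rscaleA a b v : rscale a (rscale b v) = rscale (a * b) v.
Proof. by rewrite /rscale rmorphM mulrA. Qed.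
Let rscale1 : left_id 1 rscale.
Proof. by move=> v; rewrite /rscale rmorph1 mul1r. Qed.
Let rscaleDr : right_distributive rscale +%R.
Proof. by move=> a u v; rewrite /rscale mulrDr. Qed.
Let rscaleDl v : {morph rscale^~ v : a b / a + b}.
Proof. by move=> a b; rewrite /rscale rmorphD mulrDl. Qed.
HB.instance Definition _ := GRing.Zmodule_isLmodule.Build A (restr_scalars phi)
  rscaleA rscale1 rscaleDr rscaleDl.

End RestrictionOfScalars.

(** The equational criterion: a relation in [B] with coefficients from [A] is a combination of
    relations in [A]. *)
Definition equational_flat (A B : comPzRingType) (phi : A -> B) :=
  forall n (a : 'I_n -> A) (b : 'I_n -> B), \sum_i phi (a i) * b i = 0 ->
  exists m (c : 'I_n -> 'I_m -> A) (b' : 'I_m -> B),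
    (forall i, b i = \sum_j phi (c i j) * b' j) /\
    forall j, \sum_i a i * c i j = 0.

(* Flatness for the inclusion of the ideal [(a_1, .., a_n)] in [A] is tested
   on the bilinear map [B * (A^n / Rel) -> B^n / (B Rel)], where [Rel] is the
   module of relations between the [a_i] and [A^n / Rel] is that ideal. *)
Lemma flat_equational (A B : comPzRingType) (phi : {rmorphism A -> B}) :
  flat_ring_morphism phi -> equational_flat phi.
Proof.
move=> fl n a b ab0.
pose V : lmodType A := {ffun 'I_n -> A^o}.
pose W : lmodType A := {ffun 'I_n -> restr_scalars phi}.
pose rel : set V := [set c | \sum_i a i * c i = 0].
have rel0 : rel 0 by rewrite /rel /= big1// => i _; rewrite ffunE mulr0.
have relB u v : rel u -> rel v -> rel (u - v).
  rewrite /rel /= => u0 v0.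
  transitivity (\sum_i a i * u i - \sum_i a i * v i); last first.
    by rewrite u0 v0 subr0.
  rewrite -sumrB.
  by apply: eq_bigr => i _; rewrite !ffunE mulrBr.
have relZ c v : rel v -> rel (c *: v).
  rewrite /rel /= => v0; transitivity (c * \sum_i a i * v i); last first.
    by rewrite v0 mulr0.
  rewrite mulr_sumr.
  by apply: eq_bigr => i _; rewrite ffunE /GRing.scale /= mulrCA.
pose Rel := Submodule rel0 relB relZ.
(* This is the [B]-span of the relations inside B^n; the conclusion sought is exactly that the
   family [b] lies in it. *)
pose brel : set W := [set w | exists m (c : 'I_n -> 'I_m -> A) (b' : 'I_m -> B),
    (forall i, (w i : B) = \sum_j phi (c i j) * b' j) /\
    forall j, \sum_i a i * c i j = 0].
have brel0 : brel 0.
  exists 0%N, (fun _ _ => 0), (fun _ => 0); split=> [i|[]//].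
  by rewrite big_ord0 ffunE.
have brelB u v : brel u -> brel v -> brel (u - v).
  move=> [m [c [d [cd ac]]]] [m' [c' [d' [cd' ac']]]].
  exists (m + m')%N.
  exists (fun i (j : 'I_(m + m')) => match fintype.split j with inl j => c i j | inr j => c' i j end).
  exists (fun j : 'I_(m + m') => match fintype.split j with inl j => d j | inr j => - d' j end).
  split=> [i|j]; last by case: (fintype.split j).
  rewrite big_split_ord /= !ffunE.
  transitivity ((u i : B) - (v i : B)); first by [].
  rewrite cd cd' -sumrN.
  congr (_ + _); apply: eq_bigr => j _.
    by rewrite (unsplitK (inl j)).
  by rewrite (unsplitK (inr j)) mulrN.
have brelZ c v : brel v -> brel (c *: v).
  move=> [m [e [d [cd ac]]]]; exists m, e, (fun j => phi c * d j).
  split=> // i; rewrite ffunE; transitivity (phi c * (v i : B)); first by [].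
  rewrite cd mulr_sumr.
  by apply: eq_bigr => j _; rewrite mulrCA.
pose BRel := Submodule brel0 brelB brelZ.
pose N : lmodType A := qmod Rel; pose P : lmodType A := qmod BRel.
pose u0 (q : N) : A^o := \sum_i a i * qrepr q i.
have u0pi (v : V) : u0 (qpi Rel v) = \sum_i a i * v i.
  apply/eqP; rewrite -subr_eq0 -sumrB; apply/eqP.
  rewrite -[RHS](qreprP Rel v); apply: eq_bigr => i _.
  by rewrite !ffunE mulrBr.
have u0_lin : linear u0.
  move=> c q q'; rewrite -(qreprK q) -(qreprK q') -qpiZ -qpiD !u0pi.
  rewrite scaler_sumr -big_split /=; apply: eq_bigr => i _.
  by rewrite !ffunE mulrDr /GRing.scale /= mulrCA.
pose u : {linear N -> A^o} := HB.pack u0 (GRing.isLinear.Build _ _ _ _ u0 u0_lin).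
have u_inj : injective u.
  move=> q q'; rewrite -(qreprK q) -(qreprK q') /= !u0pi => e.
  apply/qpi_eq; rewrite /= /rel /=; apply/eqP; rewrite -[X in _ == X](subrr (\sum_i a i * qrepr q i)).
  by rewrite {2}e -sumrB; apply/eqP/eq_bigr => i _; rewrite !ffunE mulrBr.
pose delta i : V := [ffun j => (i == j)%:R].
pose v i : N := qpi Rel (delta i).
have uv i : u (v i) = a i.
  rewrite /= u0pi (bigD1 i) //= ffunE eqxx mulr1 big1 ?addr0 // => j ji.
  by rewrite ffunE eq_sym (negbTE ji) mulr0.
(* b_i (x) a_i = phi(a_i) b_i (x) 1, and these sum to zero by hypothesis. *)
have : tensor_eq0 phi b (u \o v).
  move=> Q beta [Dl Dr Zl Zr].
  have b0 w : beta 0 w = 0.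
    by have := Zl 0 0 w; rewrite rmorph0 mul0r scale0r.
  have := b0 1; rewrite -{1}ab0.
  rewrite (big_morph (beta^~ 1) (fun x y => Dl x y 1) (b0 1)).
  apply: etrans; apply: eq_bigr => i _; rewrite [(u \o v) i]uv Zl -Zr; congr (beta _ _).
  by rewrite /GRing.scale /= mulr1.
move=> /(fl _ _ _ u_inj) tens.
pose mv (c : B) (w : V) : W := [ffun i => c * phi (w i)].
have mvrel c w : rel w -> brel (mv c w).
  move=> rw; exists 1%N, (fun i _ => w i), (fun _ => c); split=> //.
  by move=> i; rewrite big_ord1 ffunE mulrC.
pose beta (c : B) (q : N) : P := qpi BRel (mv c (qrepr q)).
have betapi c w : beta c (qpi Rel w) = qpi BRel (mv c w).
  apply/qpi_eq; have -> : mv c (qrepr (qpi Rel w)) - mv c w =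
    mv c (qrepr (qpi Rel w) - w).
    by apply/ffunP => i; rewrite !ffunE rmorphB mulrBr.
  by apply: mvrel; exact: (qreprP Rel w).
have bilin : bilinear_along phi beta.
  split=> [c c' q|c q q'|c d q|c d q]; rewrite -(qreprK q) ?betapi.
  - by rewrite -qpiD; congr qpi; apply/ffunP => i; rewrite !ffunE mulrDl.
  - rewrite -(qreprK q') -qpiD !betapi -qpiD; congr qpi; apply/ffunP => i.
    by rewrite !ffunE rmorphD mulrDr.
  - rewrite -qpiZ; congr qpi; apply/ffunP => i; rewrite !ffunE.
    exact: (esym (mulrA (phi c) d _)).
  - rewrite -(qpiZ BRel) (qreprK q); congr qpi; apply/ffunP => i; rewrite !ffunE.
    transitivity (d * (phi c * phi (qrepr q i))); last exact: mulrCA.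
    by congr (d * _); exact: rmorphM.
have := tens P beta bilin; rewrite (eq_bigr _ (fun i _ => betapi _ _)).
have -> : \sum_i qpi BRel (mv (b i) (delta i)) = qpi BRel (\sum_i mv (b i) (delta i)).
  apply/esym/big_morph => [? ?|]; first exact: qpiD.
  by have := qpiZ BRel 0 0; rewrite !scale0r.
have <- : qpi BRel 0 = 0 by have := qpiZ BRel 0 0; rewrite !scale0r.
move=> /qpi_eq; rewrite subr0 => -[m [c [b' [bb' ac]]]].
exists m, c, b'; split=> // i; rewrite -bb' sum_ffunE.
rewrite (bigD1 i) //= !ffunE eqxx rmorph1 mulr1.
rewrite [X in _ + X]big1 ?addr0 // => j ji.
by rewrite !ffunE (negbTE ji) rmorph0 mulr0.
Qed.

(** * Linear algebra modulo an ideal *)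

Definition is_ideal (B : comPzRingType) (J : set B) :=
  [/\ J 0, forall a b, J a -> J b -> J (a + b) & forall a b, J b -> J (a * b)].

Section Ideals.
Variables (B : comPzRingType) (J : set B) (iJ : is_ideal J).

Lemma idealN a : J a -> J (- a).
Proof. by case: iJ => _ _ JM; rewrite -mulN1r; exact: JM. Qed.

Lemma idealB a b : J a -> J b -> J (a - b).
Proof. by case: (iJ) => _ JD _ ? ?; apply: JD => //; exact: idealN. Qed.

Lemma idealMr a b : J b -> J (b * a).
Proof. by case: iJ => _ _ JM; rewrite mulrC; exact: JM. Qed.

Lemma ideal_sum (I : Type) (r : seq I) (P : pred I) (F : I -> B) :
  (forall i, P i -> J (F i)) -> J (\sum_(i <- r | P i) F i).
Proof.
by case: iJ => J0 JD _ JF; elim/big_ind: _.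
Qed.

Lemma ideal_trans a b : J (a - b) -> J b -> J a.
Proof. by case: iJ => _ JD _ ? ?; rewrite -(subrK b a); exact: JD. Qed.

End Ideals.

Lemma ideal0 (B : comPzRingType) : is_ideal [set (0 : B)].
Proof.
by split=> //= [a b -> ->|a b ->]; [rewrite addr0|rewrite mulr0].
Qed.

Lemma ideal_genP (A : comPzRingType) (S : set A) : is_ideal (ideal_gen S).
Proof.
split.
- exists 0%N, (fun=> 0), (fun=> 0); split=> [[]//|].
  by rewrite big_ord0.
- move=> _ _ [n [c [s [Ss ->]]]] [m [c' [s' [Ss' ->]]]].
  exists (n + m)%N.
  exists (fun i : 'I_(n + m) =>
            match fintype.split i with inl j => c j | inr j => c' j end).
  exists (fun i : 'I_(n + m) =>
            match fintype.split i with inl j => s j | inr j => s' j end).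
  split; first by move=> i; case: (fintype.split i).
  rewrite big_split_ord /=; congr (_ + _); apply: eq_bigr => j _.
    by rewrite (unsplitK (inl j)).
  by rewrite (unsplitK (inr j)).
- move=> a _ [n [c [s [Ss ->]]]]; exists n, (fun i => a * c i), s; split=> //.
  by rewrite mulr_sumr; apply: eq_bigr => i _; rewrite mulrA.
Qed.

Lemma sub_ideal_gen (A : comPzRingType) (S : set A) : S `<=` ideal_gen S.
Proof.
move=> a Sa; exists 1%N, (fun=> 1), (fun=> a); split=> //.
by rewrite big_ord1 mul1r.
Qed.

Lemma ideal_gen_min (A : comPzRingType) (S J : set A) :
  is_ideal J -> S `<=` J -> ideal_gen S `<=` J.
Proof.
move=> iJ SJ _ [n [c [s [Ss ->]]]]; apply: ideal_sum => // i _.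
by case: iJ => _ _; apply; exact: SJ.
Qed.

Section LinearAlgebraModuloIdeal.
Variables (K : fieldType) (B : comPzRingType) (iota : {rmorphism K -> B}).
Variables (J : set B) (iJ : is_ideal J).

Definition indep (T : finType) (e : T -> B) :=
  forall c : T -> K, J (\sum_t iota (c t) * e t) -> forall t, c t = 0.

Definition spanned (T : finType) (e : T -> B) (b : B) :=
  exists c : T -> K, J (b - \sum_t iota (c t) * e t).

Lemma spanned_sum (T S : finType) (e : T -> B) (s : S -> B) (c : S -> K) :
  (forall i, spanned e (s i)) -> spanned e (\sum_i iota (c i) * s i).
Proof.
move=> /choice [d Jd]; exists (fun t => \sum_i c i * d i t).
rewrite (_ : _ - _ = \sum_i iota (c i) * (s i - \sum_t iota (d i t) * e t)).
  by apply: ideal_sum => // i _; case: iJ => _ _; apply.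
under [RHS]eq_bigr do rewrite mulrBr; rewrite sumrB; congr (_ - _).
under [RHS]eq_bigr do rewrite mulr_sumr; rewrite exchange_big.
apply: eq_bigr => t _; rewrite rmorph_sum mulr_suml.
by apply: eq_bigr => i _; rewrite rmorphM mulrA.
Qed.

Lemma spanned_trans (T S : finType) (e : T -> B) (s : S -> B) b :
  (forall i, spanned e (s i)) -> spanned s b -> spanned e b.
Proof.
move=> es [c Jc]; have [d Jd] := spanned_sum c es; exists d.
by rewrite -(subrKA (\sum_t iota (c t) * s t)); case: iJ => _ JD _; exact: JD.
Qed.

(** With more vectors than generators, the matrix of coordinates has a nonzero vector in its left
    kernel, which is a relation among the [s i] modulo [J]. *)
Lemma exchange (T S : finType) (e : T -> B) (s : S -> B) :
  indep s -> (forall i, spanned e (s i)) -> (#|S| <= #|T|)%N.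
Proof.
move=> inds /choice [c Jc]; rewrite leqNgt; apply/negP => TS.
pose M : 'M[K]_(#|S|, #|T|) := \matrix_(i, j) c (enum_val i) (enum_val j).
have : kermx M != 0.
  rewrite -mxrank_eq0 mxrank_ker subn_eq0 -ltnNge.
  exact: leq_ltn_trans (rank_leq_col M) TS.
case/rowV0Pn => v /sub_kermxP vM /negP; apply; apply/eqP/rowP => i.
rewrite mxE -(enum_valK i).
apply: (inds (fun t => v 0 (enum_rank t))).
rewrite (_ : \sum_t _ = \sum_t iota (v 0 (enum_rank t)) *
    (s t - \sum_j iota (c t j) * e j)).
  by apply: ideal_sum => // t _; case: iJ => _ _; apply.
under [RHS]eq_bigr do rewrite mulrBr; rewrite sumrB -[LHS]subr0; congr (_ - _).
under eq_bigr do rewrite mulr_sumr; rewrite exchange_big big1 //= => j _.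
under eq_bigr do rewrite mulrA -rmorphM; rewrite -mulr_suml -rmorph_sum.
have /rowP /(_ (enum_rank j)) := vM; rewrite !mxE => vMj.
rewrite (_ : \sum_i0 _ = 0) ?rmorph0 ?mul0r // -[RHS]vMj.
rewrite (reindex (@enum_val S S)) /=; last first.
  exact: (onW_bij _ (enum_val_bij S)).
by apply: eq_bigr => l _; rewrite mxE enum_valK !enum_rankK.
Qed.

Lemma exists_basis (T : finType) (e : T -> B) :
  exists n (f : 'I_n -> T), indep (e \o f) /\ forall t, spanned (e \o f) (e t).
Proof.
pose P n := `[< exists f : 'I_n -> T, indep (e \o f) >].
have ubP n : P n -> (n <= #|T|)%N.
  move=> /asboolP [f indf]; rewrite -[n]card_ord; apply: (exchange (e := e) indf) => i.
  exists (fun t => (t == f i)%:R).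
  rewrite /=; have -> : \sum_t iota (t == f i)%:R * e t = e (f i).
    rewrite (bigD1 (f i)) //= eqxx rmorph1 mul1r big1 ?addr0 // => t /negbTE ->.
    by rewrite rmorph0 mul0r.
  by rewrite subrr; case: iJ.
have exP : exists n, P n.
  have f0 (i : 'I_0) : T by case: i.
  by exists 0%N; apply/asboolP; exists f0 => c _ [].
case: (ex_maxnP exP ubP) => n /asboolP [f indf] nmax.
exists n, f; split=> // t; apply: contrapT => nt.
suff /nmax : P n.+1 by rewrite ltnn.
apply/asboolP; exists (fun i => oapp f t (unlift ord0 i)) => c.
rewrite big_ord_recl /= unlift_none /=.
under eq_bigr do rewrite liftK /=.
move=> Jc; have [c0|c0] := eqVneq (c ord0) 0.
  move: Jc; rewrite c0 rmorph0 mul0r add0r => /indf c0' i.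
  by case: (unliftP ord0 i) => [j|] -> //; exact: c0'.
exfalso; apply: nt; exists (fun i => - (c ord0)^-1 * c (lift ord0 i)).
have := (let: And3 _ _ JM := iJ in JM) (iota (c ord0)^-1) _ Jc.
rewrite mulrDr mulrA -rmorphM mulVf // rmorph1 mul1r -sumrN mulr_sumr.
congr (J (_ + _)); apply: eq_bigr => i _.
by rewrite rmorphM rmorphN !mulNr opprK mulrA.
Qed.

(** There is a relation modulo [J] among #|T|+1 successive partial products. [N] is the least index
    with a nonzero coefficient; dividing by that coefficient and factoring out the first [N] terms
    gives the formula. Constant sequences lead to the Fitting decomposition, sequences of nonunits
    to nilpotence of the maximal ideal. *)
Lemma spanned_chain (T : finType) (e : T -> B) (b : nat -> B) :
  (forall j, spanned e (\prod_(0 <= i < j) b i)) ->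
  exists2 N, (N <= #|T|)%N & exists c : nat -> K,
    J (\prod_(0 <= i < N) b i *
       (1 - \sum_(N.+1 <= j < #|T|.+1) iota (c j) * \prod_(N <= i < j) b i)).
Proof.
move=> spb; set n := #|T|.
have : ~ indep (fun j : 'I_n.+1 => \prod_(0 <= i < j) b i).
  by move=> /exchange /(_ (fun j => spb _)); rewrite card_ord ltnn.
move=> /existsNP [c /not_implyP [Jc /existsNP [i0 ci0]]].
have {}ci0 : c i0 != 0 by apply/eqP.
case: (@arg_minnP _ i0 (fun i => c i != 0) (fun i => i : nat) ci0) => N cN Nmin.
exists N; first by rewrite -ltnS.
exists (fun j => - (c N)^-1 * c (inord j)).
have := (let: And3 _ _ JM := iJ in JM) (iota (c N)^-1) _ Jc.
congr J; rewrite (eq_bigr (fun j : 'I_n.+1 => iota (c (inord j)) * \prod_(0 <= i < j) b i)); last first.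
  by move=> j _; rewrite inord_val.
rewrite -(big_mkord xpredT (fun j => iota (c (inord j)) * \prod_(0 <= i < j) b i)).
rewrite (big_cat_nat (leq0n N) (ltnW (ltn_ord N))) //= big_nat big1 ?add0r; last first.
  move=> j /= jN; have jn : (j < n.+1)%N by exact: ltn_trans jN _.
  case: (eqVneq (c (inord j)) 0) => [->|/Nmin]; first by rewrite rmorph0 mul0r.
  by rewrite inordK // leqNgt jN.
rewrite big_ltn // inord_val mulrDr mulrA -rmorphM mulVf // rmorph1 mul1r.
rewrite mulrBr mulr1 mulr_sumr mulr_sumr -sumrN; congr (_ + _).
apply: eq_big_nat => j /andP [Nj _].
rewrite (big_cat_nat (leq0n N) (ltnW Nj)) /= rmorphM rmorphN.
rewrite !mulNr mulrN opprK mulrCA !mulrA; congr (_ * _).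
by rewrite [RHS]mulrC [X in _ = _ * X]mulrC mulrA.
Qed.

(* A Fitting decomposition: [b] is nilpotent on one part of [B/J] and
   invertible, with inverse a polynomial in [b], on the other. *)
Lemma spanned_fitting (T : finType) (e : T -> B) (b : B) :
  (forall j, spanned e (b ^+ j)) ->
  exists2 N, (N <= #|T|)%N & exists m (c : nat -> K),
    J (b ^+ N * (1 - b * \sum_(0 <= i < m) iota (c i) * b ^+ i)).
Proof.
move=> spb; have [|N NT [c]] := @spanned_chain T e (fun=> b).
  by move=> j; rewrite prodr_const_nat subn0; exact: spb.
rewrite prodr_const_nat subn0 => Jc; exists N => //.
exists (#|T| - N)%N, (fun i => c (i + N.+1)%N); move: Jc; congr (J (_ * (1 - _))).
rewrite -{1}[N.+1]add0n big_addn subSS mulr_sumr; apply: eq_bigr => i _.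
by rewrite prodr_const_nat addnS subSn ?leq_addl // addnK exprS mulrCA.
Qed.

End LinearAlgebraModuloIdeal.

(** * Prime ideals and noetherian rings *)

Lemma ideal_gen_mono (A : comPzRingType) (S S' : set A) :
  S `<=` S' -> ideal_gen S `<=` ideal_gen S'.
Proof.
move=> SS'; apply: ideal_gen_min; first exact: ideal_genP.
by apply: subset_trans SS' _; exact: sub_ideal_gen.
Qed.

(** An ideal maximal among those that contain [J] and no power of [b] is prime. Zorn's lemma runs
    over arbitrary subsets [S], through the ideal generated by [S] and [J], so that the union of the
    empty chain is admissible. *)
Lemma prime_avoidance (B : comPzRingType) (J : set B) (b : B) : is_ideal J ->
  (forall n, ~ J (b ^+ n)) ->
  exists p : set B, [/\ prime_ideal p, J `<=` p & ~ p b].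
Proof.
move=> iJ Jb.
pose P (S : set B) := forall n, ~ ideal_gen (J `|` S) (b ^+ n).
have [|p [Pp pmax]] := @Zorn_bigcup B P.
  move=> F FP totF n; set G := ideal_gen _.
  pose H : set B := [set c | J c \/ exists2 X, F X & ideal_gen (J `|` X) c].
  suff /(_ (b ^+ n)) GH : G `<=` H.
    by move=> /GH [/Jb//|[X FX]]; exact: FP.
  have JX X : J `<=` ideal_gen (J `|` X).
    by move=> c Jc; apply: sub_ideal_gen; left.
  apply: ideal_gen_min; last first.
    move=> c [Jc|[X FX Xc]]; [by left|right; exists X => //].
    by apply: sub_ideal_gen; right.
  split; first by left; case: iJ.
    move=> c d [Jc|[X FX Xc]] [Jd|[Y FY Yd]].
    - by left; case: iJ => _ JD _; exact: JD.
    - right; exists Y => //; have [_ GD _] := ideal_genP (J `|` Y).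
      by apply: GD => //; exact: JX.
    - right; exists X => //; have [_ GD _] := ideal_genP (J `|` X).
      by apply: GD => //; exact: JX.
    - have [XY|YX] := totF _ _ FX FY.
        right; exists Y => //; have [_ GD _] := ideal_genP (J `|` Y).
        by apply: GD => //; move: Xc; apply: ideal_gen_mono; exact: setUS.
      right; exists X => //; have [_ GD _] := ideal_genP (J `|` X).
      by apply: GD => //; move: Yd; apply: ideal_gen_mono; exact: setUS.
  move=> c d [Jd|[X FX Xd]].
    by left; case: iJ => _ _; apply.
  by right; exists X => //; have [_ _] := ideal_genP (J `|` X); apply.
pose q := ideal_gen (J `|` p).
have iq : is_ideal q by exact: ideal_genP.
have Jq : J `<=` q by move=> c Jc; apply: sub_ideal_gen; left.
have pq : p `<=` q by move=> c pc; apply: sub_ideal_gen; right.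
have Pq : P q.
  move=> n; suff /(_ (b ^+ n)) : ideal_gen (J `|` q) `<=` q.
    by move=> h /h; exact: Pp.
  by apply: ideal_gen_min => // c [/Jq|].
have maxq (S : set B) : q `<=` S -> P S -> S `<=` q.
  move=> qS PS; have pS := subset_trans pq qS.
  apply: contrapT => Sq; apply: (pmax S) => //; split=> // Sp.
  by apply: Sq; exact: subset_trans Sp pq.
have [q0 qD qM] := iq.
exists q; split=> //; last by move: (Pq 1%N); rewrite expr1 => h qb; apply: h;
  apply: sub_ideal_gen; right.
split=> //.
  by move: (Pp 0%N); rewrite expr0.
move=> x y qxy; apply: contrapT => /not_orP [qx qy].
have adjoin (z : B) : ~ q z -> exists n c, q (b ^+ n - c * z).
  move=> qz; apply: contrapT => nz; apply: qz.
  apply: (maxq (q `|` [set z])); [by move=> ? ?; left| |by right].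
  move=> n Hn; apply: nz; exists n.
  suff /(_ _ Hn) : ideal_gen (J `|` (q `|` [set z])) `<=`
      [set w | exists c, q (w - c * z)] by [].
  apply: ideal_gen_min.
    split; first by exists 0; rewrite mul0r subr0.
      move=> w w' [c qc] [c' qc']; exists (c + c').
      by rewrite mulrDl opprD addrACA; exact: qD.
    by move=> w w' [c qc]; exists (w * c); rewrite -mulrA -mulrBr; exact: qM.
  move=> w [/Jq qw|[qw|->]]; first by exists 0; rewrite mul0r subr0.
    by exists 0; rewrite mul0r subr0.
  by exists 1; rewrite mul1r subrr.
have [n [c qc]] := adjoin _ qx; have [m [d qd]] := adjoin _ qy.
apply: (Pp (n + m)%N); rewrite -/q exprD.
apply: (ideal_trans iq (b := c * x * (b ^+ m))).
  by rewrite -mulrBl; exact: idealMr.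
apply: (ideal_trans iq (b := c * x * (d * y))).
  by rewrite -mulrBr; exact: qM.
by rewrite mulrACA; exact: qM.
Qed.

(** The ascending chain condition in the form used below: no sequence of elements keeps leaving the
    ideal generated by its predecessors. *)
Definition noetherian (A : comPzRingType) :=
  forall a : nat -> A, exists n (c : nat -> A), a n = \sum_(i < n) c i * a i.

(* Hilbert's basis theorem: from a sequence of polynomials, extract greedily
   polynomials of minimal size outside the ideal of the previous ones. *)
Lemma noetherian_poly (A : comNzRingType) : noetherian A -> noetherian {poly A}.
Proof.
move=> nA a; apply: contrapT => na.
have {}na n (c : nat -> {poly A}) : a n <> \sum_(i < n) c i * a i.
  by move=> e; apply: na; exists n, c.
pose I : set {poly A} := ideal_gen (range a).
have [I0 ID IM] : is_ideal I by exact: ideal_genP.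
pose span (s : seq {poly A}) : set {poly A} := ideal_gen [set` s].
have small (s : seq {poly A}) : (forall p, p \in s -> I p) ->
    exists p, [/\ I p, ~ span s p &
      forall q, I q -> ~ span s q -> (size p <= size q)%N].
  move=> sI.
  have [p Ip sp] : exists2 p, I p & ~ span s p.
    apply: contrapT => /forall2NP ns.
    have Is p : I p -> span s p by case: (ns p) => [//|/contrapT].
    have [n sn] : exists n, forall p, p \in s -> ideal_gen (a @` [set i | (i < n)%N]) p.
      elim: s {ns Is} sI => [|p s IH] sI; first by exists 0%N.
      have [q qs|n Hn] := IH; first by apply: sI; rewrite inE qs orbT.
      have [m [c [t [rt pE]]]] := sI p (mem_head _ _).
      have /choice [u ut] : forall i, exists j, a j = t i.
        by move=> i; have [j _] := rt i; exists j.
      pose N := maxn n (\max_i u i).+1.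
      exists N => q; rewrite inE => /predU1P [->|/Hn]; last first.
        apply: ideal_gen_mono => _ [i /= ni <-]; exists i => //=.
        by rewrite leq_max ni.
      exists m, c, t; split=> // i; rewrite -ut; exists (u i) => //=.
      by rewrite leq_max ltnS leq_bigmax orbT.
    have : ideal_gen (a @` [set i | (i < n)%N]) (a n).
      have /Is : I (a n) by apply: sub_ideal_gen; exists n.
      by apply: ideal_gen_min => //; exact: ideal_genP.
    suff : ideal_gen (a @` [set i | (i < n)%N]) `<=`
        [set p | exists c : nat -> {poly A}, p = \sum_(i < n) c i * a i].
      by move=> /[apply] -[c]; exact: na.
    apply: ideal_gen_min.
      split; first by exists (fun=> 0); rewrite big1 // => i _; rewrite mul0r.
        move=> _ _ [c ->] [d ->]; exists (fun i => c i + d i).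
        by rewrite -big_split; apply: eq_bigr => i _; rewrite mulrDl.
      move=> p' _ [c ->]; exists (fun i => p' * c i).
      by rewrite mulr_sumr; apply: eq_bigr => i _; rewrite mulrA.
    move=> _ [i /= ni <-]; exists (fun j => (j == i)%:R).
    rewrite (bigD1 (Ordinal ni)) //= eqxx mul1r big1 ?addr0 // => j.
    by rewrite -val_eqE /= => /negbTE ->; rewrite mul0r.
  pose Q n := `[< exists q, [/\ I q, ~ span s q & size q = n] >].
  have exQ : exists n, Q n by exists (size p); apply/asboolP; exists p.
  case: (ex_minnP exQ) => n /asboolP [q [Iq sq <-]] qmin; exists q; split=> // r Ir sr.
  by apply: qmin; apply/asboolP; exists r.
have [next nextP] : exists next : seq {poly A} -> {poly A}, forall s,
    (forall p, p \in s -> I p) -> [/\ I (next s), ~ span s (next s) &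
      forall q, I q -> ~ span s q -> (size (next s) <= size q)%N].
  pose minout s p := (forall q, q \in s -> I q) -> [/\ I p, ~ span s p &
      forall q, I q -> ~ span s q -> (size p <= size q)%N].
  suff : forall s, exists p, minout s p by move=> /choice [h Hh]; exists h.
  move=> s.
  have [/small [p Hp]|ns] := pselect (forall p, p \in s -> I p).
    by exists p => _.
  by exists 0 => /ns.
pose S := fix S n := if n is n'.+1 then rcons (S n') (next (S n')) else [::].
have SI n p : p \in S n -> I p.
  elim: n p => [//|n IH] p /=; rewrite mem_rcons inE => /predU1P [->|/IH//].
  by case: (nextP (S n) IH).
pose F n := next (S n).
have memS i n : (i < n)%N -> F i \in S n.
  elim: n => // n IH; rewrite ltnS leq_eqVlt /= mem_rcons inE.
  by case/predU1P => [->|/IH ->]; rewrite ?eqxx ?orbT.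
have subS i n : (i <= n)%N -> {subset S i <= S n}.
  move=> /subnK <-; elim: (n - i)%N => // m IH p /IH.
  by rewrite addSn /= mem_rcons inE => ->; rewrite orbT.
have sizeF i n : (i <= n)%N -> (size (F i) <= size (F n))%N.
  move=> /subS iN; have [_ _ Fmin] := nextP _ (SI i).
  have [IF sF _] := nextP _ (SI n); apply: Fmin => // si; apply: sF; move: si.
  by apply: ideal_gen_mono => p /iN.
have [n [c lc]] := nA (fun n => lead_coef (F n)).
have [IFn sFn Fmin] := nextP _ (SI n).
have [sp0 spD spM] : is_ideal (span (S n)) by exact: ideal_genP.
(* [g] has the same leading term as [F n], so [F n - g] is smaller; it is in [I] and outside the
   span of the previous choices, against the minimality of [F n]. *)
pose g := \sum_(i < n) (c i *: 'X^(size (F n) - size (F i))) * F i.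
have sg : span (S n) g.
  apply: ideal_sum; first exact: ideal_genP.
  by move=> i _; apply: spM; apply: sub_ideal_gen; apply: memS.
have Fn0 : F n != 0 by apply/eqP => F0; apply: sFn; rewrite -/(F n) F0.
have szF : (0 < size (F n))%N by rewrite size_poly_gt0.
have : (size (F n - g)%R < size (F n))%N.
  rewrite -(prednK szF) ltnS; apply/leq_sizeP => j jn.
  have szg : (size g <= size (F n))%N.
    apply: (leq_trans (size_sum _ _ _)); apply/bigmax_leqP => i _.
    apply: (leq_trans (size_polyMleq _ _)); rewrite -subn1 leq_subLR.
    apply: (@leq_trans ((size (F n) - size (F i)).+1 + size (F i))).
      by rewrite leq_add2r (leq_trans (size_scale_leq _ _)) // size_polyXn.
    by rewrite addSn add1n subnK // sizeF // ltnW.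
  move: jn; rewrite leq_eqVlt => /predU1P [<-|jn]; last first.
    rewrite prednK // in jn.
    by rewrite coefB !nth_default ?subr0 // (leq_trans szg).
  rewrite coefB -/(lead_coef (F n)) lc coef_sum -sumrB big1 // => i _.
  rewrite -scalerAl coefZ coefXnM ltnNge.
  have Fi0 : F i != 0.
    have [_ sFi _] := nextP _ (SI i).
    apply/eqP => F0; apply: sFi; rewrite -/(F i) F0.
    by have [] := ideal_genP [set` S i].
  have szi : (0 < size (F i))%N by rewrite size_poly_gt0.
  have le : (size (F i) <= size (F n))%N by apply: sizeF; exact: ltnW.
  have -> : ((size (F n) - size (F i)) <= (size (F n)).-1)%N by lia.
  have -> : ((size (F n)).-1 - (size (F n) - size (F i)))%N = (size (F i)).-1 by lia.
  by rewrite subrr.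
have IFg : I (F n - g).
  apply: idealB => //; apply: ideal_sum => // i _; apply: IM; exact: (SI n _ (memS i n (ltn_ord i))).
rewrite ltnNge Fmin // => sFg; apply: sFn.
by rewrite -/(F n) -(subrK g (F n)); exact: spD.
Qed.

Lemma noetherian_field (k : fieldType) : noetherian k.
Proof.
move=> a; have [a0|a0] := eqVneq (a 0%N) 0.
  by exists 0%N, (fun=> 0); rewrite a0 big_ord0.
by exists 1%N, (fun=> a 1%N / a 0%N); rewrite big_ord1 /= divfK.
Qed.

Lemma noetherian_surj (A B : comPzRingType) (phi : {rmorphism A -> B}) :
  (forall b, exists a, phi a = b) -> noetherian A -> noetherian B.
Proof.
move=> /choice [r rK] nA b; have [n [c e]] := nA (r \o b).
exists n, (phi \o c); rewrite -{1}(rK (b n)); move: e => /= ->; rewrite rmorph_sum.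
by apply: eq_bigr => i _; rewrite rmorphM /= rK.
Qed.

Fixpoint iterated_poly (A : comNzRingType) n : comNzRingType :=
  if n is m.+1 then {poly (iterated_poly A m)} else A.

Lemma noetherian_iterated_poly (k : fieldType) n :
  noetherian (iterated_poly k n).
Proof.
by elim: n => [|n IH]; [exact: noetherian_field|exact: noetherian_poly].
Qed.

Lemma iterated_poly_eval (A B : comNzRingType) (phi : {rmorphism A -> B}) n
    (t : 'I_n -> B) : exists ev : {rmorphism iterated_poly A n -> B},
  (forall a, exists p, ev p = phi a) /\ (forall i, exists p, ev p = t i).
Proof.
elim: n t => [|n IH] t; first by exists phi; split=> [a|[]//]; exists a.
have [ev [evA evt]] := IH (t \o lift ord0).
have cev : commr_rmorph ev (t ord0) by move=> p; exact: mulrC.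
exists (horner_morph cev); split=> [a|i].
  by have [p <-] := evA a; exists p%:P; exact: (horner_morphC cev p).
have [j ->|->] := unliftP ord0 i; last first.
  by exists 'X; exact: (horner_morphX cev).
have [p pt] := evt j; exists p%:P; rewrite -[RHS]pt.
exact: (horner_morphC cev p).
Qed.

Lemma algebra_finite_noetherian (k : fieldType) (B : comPzRingType)
    (phi : {rmorphism k -> B}) : algebra_finite phi -> noetherian B.
Proof.
move=> [n [t gen]]; have [B0|B1] := eqVneq (1 : B) 0.
  move=> b; exists 0%N, (fun=> 0).
  by rewrite big_ord0 -(mul1r (b _)) B0 mul0r.
pose B' : comNzRingType := HB.pack (GRing.ComPzRing.sort B) (GRing.PzSemiRing_isNonZero.Build B B1).
have [ev [evA evt]] := @iterated_poly_eval k B' phi n t.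
apply: (noetherian_surj (phi := ev)); last exact: noetherian_iterated_poly.
apply: gen => // _ _ [p <-] [q <-]; [exists (p + q)|exists (p * q)].
  exact: rmorphD.
exact: rmorphM.
Qed.

(** * Local rings *)

Lemma is_unitM (B : comPzRingType) (a b : B) :
  is_unit (a * b) <-> is_unit a /\ is_unit b.
Proof.
split=> [[c abc]|[[c ac] [d bd]]].
  by split; [exists (b * c); rewrite mulrA|exists (a * c); rewrite mulrCA mulrA].
by exists (c * d); rewrite mulrACA ac bd mulr1.
Qed.

Lemma is_unit1 (B : comPzRingType) : is_unit (1 : B).
Proof. by exists 1; rewrite mulr1. Qed.

Lemma is_unitX (B : comPzRingType) (a : B) n : is_unit a -> is_unit (a ^+ n).
Proof.
move=> ua; elim: n => [|n IH]; first by rewrite expr0; exact: is_unit1.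
by rewrite exprS; apply/is_unitM.
Qed.

Lemma is_unit_rmorph (B C : comPzRingType) (phi : {rmorphism B -> C}) a :
  is_unit a -> is_unit (phi a).
Proof. by move=> [b ab]; exists (phi b); rewrite -rmorphM ab rmorph1. Qed.

Lemma unit_mulr_eq0 (A : comPzRingType) (u a : A) :
  is_unit u -> a * u = 0 -> a = 0.
Proof. by move=> [v uv] au; rewrite -(mulr1 a) -uv mulrA au mul0r. Qed.

Section LocalRing.
Variables (A : comNzRingType).
Hypothesis A_local : forall a b : A, is_unit (a + b) -> is_unit a \/ is_unit b.

Lemma not_is_unit0 : ~ is_unit (0 : A).
Proof. by move=> [b]; rewrite mul0r => /eqP; rewrite eq_sym oner_eq0. Qed.

Lemma nonunits_ideal : is_ideal (@nonunits A).
Proof.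
split; first exact: not_is_unit0.
  by move=> a b na nb /A_local [/na|/nb].
by move=> a b nb /is_unitM [].
Qed.

Lemma unit_addl_nonunit (a b : A) : is_unit a -> nonunits b -> is_unit (a + b).
Proof.
move=> ua nb; apply: contrapT => nab; have := idealB nonunits_ideal nab nb.
by rewrite addrK.
Qed.

End LocalRing.

(* [rho] identifies [k], embedded by [iota], with the residue field of the
   local ring [A]. *)
Definition residue (k : fieldType) (A : comPzRingType) (iota : k -> A)
    (rho : A -> k) :=
  (forall a, is_unit a <-> rho a != 0) /\ forall c, rho (iota c) = c.

Lemma residue_nonunits (k : fieldType) (A : comPzRingType) (iota : k -> A) (rho : A -> k) :
  residue iota rho -> forall a, nonunits a <-> rho a = 0.
Proof.
move=> [rho_unit _] a; split=> [na|ra].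
  by apply/eqP; apply/negP => /negP /rho_unit.
by move=> /rho_unit; rewrite ra eqxx.
Qed.

Lemma exists_residue (k : fieldType) (A : comNzRingType)
    (iota : {rmorphism k -> A}) :
  (forall a b : A, is_unit (a + b) -> is_unit a \/ is_unit b) ->
  (forall a, exists c, nonunits (a - iota c)) ->
  exists rho : {rmorphism A -> k}, residue iota rho.
Proof.
move=> A_local /choice [rho rhoP].
have iN := nonunits_ideal A_local; have [_ ND NM] := iN.
have uniq a c : nonunits (a - iota c) -> rho a = c.
  move=> nac; apply/eqP; rewrite -subr_eq0; apply: contrapT => /negP rc.
  have : nonunits (iota (rho a - c)).
    rewrite rmorphB -(subrKA a) addrC; apply: ND => //.
    by rewrite -opprB; exact: idealN.
  by apply; exists (iota (rho a - c)^-1); rewrite -rmorphM mulfV // rmorph1.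
have rho_zmod : zmod_morphism rho.
  move=> a b; apply: uniq; rewrite rmorphB.
  rewrite (_ : _ - _ = (a - iota (rho a)) - (b - iota (rho b))); last by ring.
  exact: idealB.
have rho_monoid : monoid_morphism rho.
  split; first by apply: uniq; rewrite rmorph1 subrr; case: iN.
  move=> a b; apply: uniq; rewrite rmorphM.
  rewrite (_ : _ - _ = b * (a - iota (rho a)) + iota (rho a) * (b - iota (rho b))); last by ring.
  by apply: ND; apply: NM.
pose rho' : {rmorphism A -> k} := HB.pack rho
  (GRing.isZmodMorphism.Build _ _ rho rho_zmod)
  (GRing.isMonoidMorphism.Build _ _ rho rho_monoid).
exists rho'; split=> [a|c] /=; last first.
  by apply: uniq; rewrite subrr; case: iN.
split=> [ua|ra].
  apply/eqP => ra; have := rhoP a; rewrite ra rmorph0 subr0; exact.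
apply: contrapT => na; move/eqP: ra; apply; apply: uniq.
by rewrite rmorph0 subr0.
Qed.

(** The determinant trick: by the adjugate identity det(1 - M) kills every [a i], and it is a unit
    because its residue is 1. *)
Lemma nakayama (k : fieldType) (A : comPzRingType) (iota : k -> A)
    (rho : {rmorphism A -> k}) n (a : 'I_n -> A) (M : 'I_n -> 'I_n -> A) :
  residue iota rho -> (forall i j, rho (M i j) = 0) ->
  (forall i, a i = \sum_j M i j * a j) -> forall i, a i = 0.
Proof.
move=> res M0 aM i.
pose D := 1%:M - \matrix_(i, j) M i j; pose v := \col_i a i.
have Dv : D *m v = 0.
  apply/matrixP => j l; rewrite mulmxBl mul1mx !mxE aM.
  under [X in _ - X]eq_bigr do rewrite !mxE.
  by rewrite subrr.
have : \det D *: v = 0.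
  by rewrite -mul_scalar_mx -mul_adj_mx -mulmxA Dv mulmx0.
move=> /matrixP /(_ i 0); rewrite !mxE => detDa.
have [u detDu] : is_unit (\det D).
  apply/(proj1 res); rewrite -det_map_mx (_ : map_mx rho D = 1%:M) ?det1 ?oner_eq0 //.
  apply/matrixP => j l; rewrite !mxE rmorphB M0 subr0.
  by rewrite rmorph_nat.
by rewrite -(mul1r (a i)) -detDu mulrAC detDa mul0r.
Qed.

(** The global form of Nakayama's lemma: the determinant of the trick, of residue 1, takes the place
    of a unit, so that [e] generates once [s] is inverted, that is, near the point. *)
Lemma nakayama_spanning (k : fieldType) (A B : comPzRingType)
    (phi : {rmorphism A -> B}) (rho : {rmorphism A -> k}) n (e : 'I_n -> B) :
  module_finite phi ->
  (forall b, exists c : 'I_n -> A,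
    ideal_gen (phi @` [set a | rho a = 0]) (b - \sum_i phi (c i) * e i)) ->
  exists s, rho s = 1 /\
    forall b, exists c : 'I_n -> A, phi s * b = \sum_i phi (c i) * e i.
Proof.
move=> [m [g gen]] span.
have mg b : ideal_gen (phi @` [set a | rho a = 0]) b ->
    exists d : 'I_m -> A, (forall i, rho (d i) = 0) /\ b = \sum_i phi (d i) * g i.
  suff /(_ b) : ideal_gen (phi @` [set a | rho a = 0]) `<=`
    [set b | exists d : 'I_m -> A,
       (forall i, rho (d i) = 0) /\ b = \sum_i phi (d i) * g i] by [].
  have closedM (a : A) (x : B) : rho a = 0 -> exists d : 'I_m -> A,
       (forall i, rho (d i) = 0) /\ phi a * x = \sum_i phi (d i) * g i.
    move=> ra; have [d ->] := gen x; exists (fun i => a * d i).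
    split=> [i|]; first by rewrite rmorphM ra mul0r.
    by rewrite mulr_sumr; apply: eq_bigr => i _; rewrite rmorphM mulrA.
  move=> _ [l [c [s [Ss ->]]]].
  have /choice [a sa] : forall i, exists a, rho a = 0 /\ phi a = s i.
    by move=> i; have [a ra <-] := Ss i; exists a.
  have /choice [d dP] := fun i => closedM (a i) (c i) (proj1 (sa i)).
  exists (fun i => \sum_j d j i); split=> [i|].
    by rewrite rmorph_sum big1 // => j _; case: (dP j).
  under [RHS]eq_bigr do rewrite rmorph_sum mulr_suml.
  rewrite exchange_big; apply: eq_bigr => j _.
  by rewrite -(proj2 (sa j)) mulrC (proj2 (dP j)).
have /choice [c cP] := fun i => span (g i).
have /choice [d dP] := fun i => mg _ (cP i).
pose M := \matrix_(i, j) d i j; pose D : 'M[A]_m := 1%:M - M.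
have rM : map_mx rho M = 0.
  by apply/matrixP => i j; rewrite !mxE; case: (dP i).
exists (\det D); split.
  rewrite -det_map_mx (_ : map_mx rho D = 1%:M) ?det1 //.
  by rewrite /D map_mxB map_mx1 rM subr0.
pose gv := \col_i g i; pose ev := \col_i e i; pose C := \matrix_(i, j) c i j.
have Dg : map_mx phi D *m gv = map_mx phi C *m ev.
  rewrite /D map_mxB map_mx1 mulmxBl mul1mx; apply/matrixP => i l.
  rewrite !mxE; under eq_bigr do rewrite !mxE.
  under [RHS]eq_bigr do rewrite !mxE.
  by rewrite -(proj2 (dP i)) opprB addrC subrK.
have {}Dg : map_mx phi (\det D)%:M *m gv = map_mx phi (\adj D *m C) *m ev.
  by rewrite -mul_adj_mx !map_mxM -!mulmxA Dg.
move=> b; have [w ->] := gen b.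
exists (fun j => \sum_i w i * (\adj D *m C) i j).
transitivity (\sum_i phi (w i) * \sum_j phi ((\adj D *m C) i j) * e j).
  rewrite mulr_sumr; apply: eq_bigr => i _.
  have /matrixP /(_ i 0) := Dg; rewrite map_scalar_mx mul_scalar_mx !mxE.
  rewrite mulrCA => ->; congr (_ * _); apply: eq_bigr => j _.
  by rewrite !mxE.
under eq_bigr do rewrite mulr_sumr; rewrite exchange_big.
apply: eq_bigr => j _; rewrite rmorph_sum mulr_suml.
by apply: eq_bigr => i _; rewrite rmorphM mulrA.
Qed.

Section FlatLocal.
Variables (k : fieldType) (A B : comPzRingType) (phi : {rmorphism A -> B}).
Variables (iota : {rmorphism k -> A}) (rho : {rmorphism A -> k}).
Hypotheses (res : residue iota rho) (fl : equational_flat phi).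

Let mB := ideal_gen (phi @` @nonunits A).

(* The equational criterion writes the [e j] through a matrix over [A]; since
   the [e j] are independent modulo [mB], it has a right inverse. *)
Lemma flat_independent m (e : 'I_m -> B) (b : 'I_m -> A) (I : set A) :
  indep (phi \o iota) mB e -> is_ideal I ->
  ideal_gen (phi @` I) (\sum_j phi (b j) * e j) -> forall j, I (b j).
Proof.
move=> ind iI [n [c [s [Is be]]]].
have /choice [d dP] : forall l, exists d, I d /\ phi d = s l.
  by move=> l; have [d Id <-] := Is l; exists d.
pose a (i : 'I_(m + n)) :=
  match fintype.split i with inl j => b j | inr l => - d l end.
pose x (i : 'I_(m + n)) :=
  match fintype.split i with inl j => e j | inr l => c l end.
have a_l j : a (lshift n j) = b j by rewrite /a (unsplitK (inl j)).
have a_r j : a (rshift m j) = - d j by rewrite /a (unsplitK (inr j)).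
have x_l j : x (lshift n j) = e j by rewrite /x (unsplitK (inl j)).
have x_r j : x (rshift m j) = c j by rewrite /x (unsplitK (inr j)).
have [|p [be' [g [xg ab]]]] := @fl (m + n)%N a x.
  rewrite big_split_ord /=; under eq_bigr do rewrite a_l x_l.
  rewrite be -big_split big1 // => l _ /=; rewrite a_r x_r rmorphN mulNr.
  by rewrite (proj2 (dP l)) mulrC subrr.
pose beta := \matrix_(j, t) be' (lshift n j) t.
have [gam betaK] : exists gam, map_mx rho beta *m gam = 1%:M.
  apply/row_freeP; rewrite -kermx_eq0; apply/rowV0P => v /sub_kermxP vb.
  apply/rowP => j; rewrite mxE; apply: (ind (fun j => v 0 j)).
  rewrite (_ : \sum__ _ = \sum_t g t * phi (\sum_j iota (v 0 j) * beta j t)).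
    have imB : is_ideal mB by apply: (ideal_genP (phi @` @nonunits A)).
    apply: (ideal_sum imB) => t _.
    have [_ _ GM] := ideal_genP (phi @` @nonunits A); apply: GM.
    apply: sub_ideal_gen; apply: imageP; apply/(residue_nonunits res).
    have /matrixP /(_ 0 t) := vb; rewrite !mxE => vbt.
    rewrite -[RHS]vbt rmorph_sum; apply: eq_bigr => i _.
    by rewrite rmorphM (proj2 res) /= !mxE.
  under [RHS]eq_bigr do rewrite rmorph_sum mulr_sumr.
  rewrite exchange_big; apply: eq_bigr => i _ /=.
  rewrite -x_l xg mulr_sumr; apply: eq_bigr => t _.
  by rewrite rmorphM mxE mulrA mulrC.
(* The right inverse of [beta] modulo nonunits, lifted by [iota], makes [D] congruent to the
   identity, hence invertible; so [b] is recovered from the product [bv *m beta], whose entries are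
   in [I]. *)
pose D := beta *m map_mx iota gam.
have rD : map_mx rho D = 1%:M.
  rewrite map_mxM -[RHS]betaK; congr (_ *m _).
  by apply/matrixP => i j; rewrite !mxE (proj2 res).
have [u Du] : is_unit (\det D).
  by apply/(proj1 res); rewrite -det_map_mx rD det1 oner_eq0.
have [I0 ID IM] := iI.
pose bv := \row_j b j.
have Ib t : I ((bv *m beta) 0 t).
  have := ab t; rewrite big_split_ord /= => /eqP; rewrite addr_eq0 => /eqP e1.
  rewrite mxE (_ : \sum__ _ = - \sum_(i < n) a (rshift m i) * be' (rshift m i) t).
    rewrite -sumrN; apply: ideal_sum => // l _; rewrite a_r mulNr opprK.
    by apply: idealMr => //; case: (dP l).
  by rewrite -e1; apply: eq_bigr => j _; rewrite a_l !mxE.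
have IbX q (X : 'M[A]_(p, q)) t : I ((bv *m beta *m X) 0 t).
  by rewrite mxE; apply: ideal_sum => // i _; exact: idealMr.
move=> j; have : I ((bv *m beta *m (map_mx iota gam *m \adj D)) 0 j) by [].
rewrite -!mulmxA (mulmxA beta) -/D mul_mx_adj mul_mx_scalar !mxE => Idb.
by rewrite -(mul1r (b j)) -Du mulrAC mulrC; exact: IM.
Qed.

End FlatLocal.

(** * Bases modulo the maximal ideal *)

Definition basis_mod (k : fieldType) (B : comPzRingType) (iota : {rmorphism k -> B})
    (J : set B) (T : finType) (e : T -> B) :=
  indep iota J e /\ forall b, spanned iota J e b.

Lemma basis_mod_ext (k : fieldType) (B : comPzRingType)
    (iota iota' : {rmorphism k -> B}) (J : set B) (T : finType) (e : T -> B) :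
  iota =1 iota' -> basis_mod iota J e -> basis_mod iota' J e.
Proof.
move=> e1 [ind span]; split.
  move=> c Hc; apply: ind; move: Hc; congr (J _).
  by apply: eq_bigr => t _; rewrite e1.
move=> b; have [c Hc] := span b; exists c; move: Hc; congr (J (_ - _)).
by apply: eq_bigr => t _; rewrite e1.
Qed.

Lemma basis_mod_card (k : fieldType) (B : comPzRingType)
    (iota : {rmorphism k -> B}) (J : set B) (T S : finType)
    (e : T -> B) (s : S -> B) : is_ideal J ->
  basis_mod iota J e -> basis_mod iota J s -> #|T| = #|S|.
Proof.
move=> iJ [ie se] [iis ss]; apply/eqP; rewrite eqn_leq.
by rewrite (exchange iJ ie (fun t => ss (e t))) (exchange iJ iis (fun t => se (s t))).
Qed.

Lemma indep_enum (k : fieldType) (B : comPzRingType)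
    (iota : {rmorphism k -> B}) (J : set B) (T : finType) (e : T -> B) :
  indep iota J e -> indep iota J (fun i : 'I_#|T| => e (enum_val i)).
Proof.
move=> ind c; rewrite (reindex (@enum_rank T)) /=; last first.
  exact: (onW_bij _ (enum_rank_bij T)).
under eq_bigr do rewrite enum_rankK.
by move=> /ind c0 i; rewrite -(enum_valK i).
Qed.

Lemma spanned_enum (k : fieldType) (B : comPzRingType)
    (iota : {rmorphism k -> B}) (J : set B) (T : finType) (e : T -> B) b :
  spanned iota J e b -> spanned iota J (fun i : 'I_#|T| => e (enum_val i)) b.
Proof.
move=> [c Jc]; exists (c \o enum_val); move: Jc; congr (J (_ - _)).
by rewrite (reindex (@enum_val T T)) //=; exact: (onW_bij _ (enum_val_bij T)).
Qed.

Section QuotientDim.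
Variables (k : fieldType) (A B : comPzRingType) (phi : {rmorphism A -> B}).
Variables (iota : {rmorphism k -> A}) (rho : {rmorphism A -> k}).
Hypothesis res : residue iota rho.
Variable J : set B.
Hypotheses (iJ : is_ideal J) (JN : phi @` @nonunits A `<=` J).

Lemma residue_split (a : A) (x : B) : J (phi a * x - (phi \o iota) (rho a) * x).
Proof.
rewrite -mulrBl -rmorphB; apply: (idealMr iJ); apply: JN; apply: imageP.
by apply/(residue_nonunits res); rewrite rmorphB (proj2 res) subrr.
Qed.

Lemma residue_sum n (c : 'I_n -> A) (e : 'I_n -> B) :
  J (\sum_i phi (c i) * e i - \sum_i (phi \o iota) (rho (c i)) * e i).
Proof.
by rewrite -sumrB; apply: (ideal_sum iJ) => i _; exact: residue_split.
Qed.

(** Coefficients are in [A] modulo nonunits on one side and in [k] on the other; [residue_sum]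
    replaces each by its residue. *)
Lemma quotient_basisE n (e : 'I_n -> B) :
  quotient_basis phi (@nonunits A) J e <-> basis_mod (phi \o iota) J e.
Proof.
split=> -[H1 H2]; split.
- move=> c Jc t; have /(residue_nonunits res) := H2 (iota \o c) Jc t.
  by rewrite (proj2 res).
- move=> b; have [c Jc] := H1 b; exists (rho \o c).
  by rewrite -(subrKA (\sum_i phi (c i) * e i)); case: (iJ) => _ JD _; apply: JD => //;
    exact: residue_sum.
- by move=> b; have [c Jc] := H2 b; exists (iota \o c).
- move=> c Jc i; apply/(residue_nonunits res); apply: (H1 (rho \o c)).
  apply: (ideal_trans iJ) Jc; rewrite -opprB; apply: (idealN iJ).
  exact: residue_sum.
Qed.

(** [xget] picks the cardinal of some basis, and [basis_mod_card] shows that all bases have the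
    same. *)
Lemma quotient_dim_basis (T : finType) (e : T -> B) :
  basis_mod (phi \o iota) J e -> quotient_dim phi (@nonunits A) J = #|T|.
Proof.
move=> [ie se]; rewrite /quotient_dim; set P := [set _ | _].
have be : basis_mod (phi \o iota) J (fun i : 'I_#|T| => e (enum_val i)).
  by split; [exact: indep_enum|move=> b; exact: spanned_enum].
have [f] : P (xget 0%N P).
  by apply: xgetPex; exists #|T|, (fun i => e (enum_val i)); apply/quotient_basisE.
move=> /quotient_basisE bf.
by have := basis_mod_card iJ bf be; rewrite !card_ord.
Qed.

End QuotientDim.

(** Turns a stalk whose nonzero elements are units into a [fieldType], over which the linear algebra
    above applies. *)
Lemma units_field (A : comNzRingType) : (forall a : A, a <> 0 -> is_unit a) ->
  exists (K : fieldType) (i : {rmorphism K -> A}) (j : A -> K),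
    cancel i j /\ cancel j i.
Proof.
move=> Afield.
have /choice [inv invP] : forall a : A,
    exists b, if a == 0 then b = 0 else b * a = 1.
  move=> a; case: eqP => [_|/Afield [b ab]]; first by exists 0.
  by exists b; rewrite mulrC.
have mulVf (a : A) : a != 0 -> inv a * a = 1.
  by move=> a0; have := invP a; rewrite (negbTE a0).
have inv0 : inv 0 = 0 by have := invP 0; rewrite eqxx.
pose K : fieldType := HB.pack (GRing.ComNzRing.sort A)
  (GRing.ComNzRing_isField.Build A mulVf inv0).
pose i : {rmorphism K -> A} := idfun : A -> A.
by exists K, i, id.
Qed.

Lemma quotient_dim_field (A : comNzRingType) (B : comPzRingType)
    (phi : {rmorphism A -> B}) n (e : 'I_n -> B) :
  (forall a : A, a <> 0 -> is_unit a) ->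
  (forall b, exists c : 'I_n -> A, b = \sum_i phi (c i) * e i) ->
  (forall c : 'I_n -> A, \sum_i phi (c i) * e i = 0 -> forall i, c i = 0) ->
  quotient_dim phi [set 0] [set 0] = n.
Proof.
move=> /units_field [K [i [j [iK jK]]]] span free.
have basisK m (g : 'I_m -> B) : quotient_basis phi [set 0] [set 0] g ->
    basis_mod (phi \o i) [set 0] g.
  move=> [sg fg]; split=> [c Hc t|b].
    by apply: (can_inj iK); rewrite rmorph0; exact: fg Hc t.
  have [c Hc] := sg b; exists (j \o c); move: Hc; congr ([set 0] (_ - _)).
  by apply: eq_bigr => t _; rewrite /= jK.
have be : quotient_basis phi [set 0] [set 0] e.
  by split=> // b; have [c ->] := span b; exists c; exact: subrr.
rewrite /quotient_dim; set P := [set _ | _].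
have [f bf] : P (xget 0%N P) by apply: xgetPex; exists n, e.
by have := basis_mod_card (ideal0 B) (basisK _ _ bf) (basisK _ _ be);
  rewrite !card_ord.
Qed.

(** * Bases along a composition of ring morphisms *)

Section Multiplicativity.
Variables (k : fieldType) (A B C : comPzRingType).
Variables (phi : {rmorphism A -> B}) (psi : {rmorphism B -> C}).
Variables (iota : {rmorphism k -> A}) (rhoB : {rmorphism B -> k}).
Hypothesis resB : residue (phi \o iota) rhoB.

Let mAB := ideal_gen (phi @` @nonunits A).
Let mBC := ideal_gen (psi @` @nonunits B).
Let mAC := ideal_gen ((psi \o phi) @` @nonunits A).

(** In [spanned_chain] the second factor is 1 minus a nonunit, hence a unit, so the product of the
    first [N] terms is already in [mAB]. *)
Lemma nonunits_nilpotent (T : finType) (e : T -> B) :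
  (forall b, spanned (phi \o iota) mAB e b) ->
  forall b : nat -> B, (forall i, nonunits (b i)) ->
  mAB (\prod_(0 <= i < #|T|) b i).
Proof.
move=> se b nb; have imAB : is_ideal mAB by apply: ideal_genP.
have [N NT [c]] := spanned_chain imAB (fun j => se (\prod_(0 <= i < j) b i)).
set u := 1 - _ => Jp.
have [v uv] : is_unit u.
  apply/(proj1 resB); rewrite rmorphB rmorph1 rmorph_sum big_nat big1 ?subr0 ?oner_eq0 //.
  move=> j /andP [Nj _]; rewrite rmorphM big_ltn // rmorphM.
  by rewrite ((residue_nonunits resB _).1 (nb N)) mul0r mulr0.
rewrite (big_cat_nat (leq0n N) NT) /=; apply: (idealMr imAB).
by have := idealMr imAB v Jp; rewrite -mulrA uv mulr1.
Qed.

(** Independence follows from [flat_independent] for [psi] with the ideal [mAB], then from that of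
    [e]. For generation, elements of [C] are approximated by combinations of [f] over [B] modulo
    growing powers of the nonunits of [B]; after #|T| steps [nonunits_nilpotent] puts the error in
    [mAC]. *)
Lemma basis_mod_comp (T S : finType) (e : T -> B) (f : S -> C) :
  equational_flat psi ->
  basis_mod (phi \o iota) mAB e -> basis_mod (psi \o (phi \o iota)) mBC f ->
  basis_mod (psi \o phi \o iota) mAC (fun ts : T * S => psi (e ts.1) * f ts.2).
Proof.
move=> fl [ie se] [iff sf].
have imAB : is_ideal mAB by apply: ideal_genP.
have imAC : is_ideal mAC by apply: ideal_genP.
have [_ mACD mACM] := imAC.
have psi_mAB b : mAB b -> mAC (psi b).
  suff : mAB `<=` [set b | mAC (psi b)] by apply.
  apply: ideal_gen_min.
    split; first by rewrite /= rmorph0; case: imAC.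
      by move=> x y /=; rewrite rmorphD; exact: mACD.
    by move=> x y /=; rewrite rmorphM; exact: mACM.
  by move=> _ [a na <-]; apply: sub_ideal_gen; exists a.
have gen_psi : mAC `<=` ideal_gen (psi @` mAB).
  apply: ideal_gen_min; first exact: ideal_genP.
  move=> _ [a na <-]; apply: sub_ideal_gen; exists (phi a) => //.
  by apply: sub_ideal_gen; exists a.
have sumE (c : T * S -> k) : \sum_ts (psi \o phi \o iota) (c ts) * (psi (e ts.1) * f ts.2) =
    \sum_s psi (\sum_t (phi \o iota) (c (t, s)) * e t) * f s.
  transitivity (\sum_t \sum_s (psi \o phi \o iota) (c (t, s)) * (psi (e t) * f s)).
    by rewrite pair_bigA; apply: eq_bigr => -[].
  rewrite exchange_big; apply: eq_bigr => s _; rewrite rmorph_sum mulr_suml.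
  by apply: eq_bigr => t _; rewrite rmorphM mulrA.
split.
  move=> c; rewrite sumE => /gen_psi mc [t s].
  apply: (ie (fun t => c (t, s))).
  have := flat_independent resB fl (indep_enum iff) imAB.
  move=> /(_ (fun i => \sum_t (phi \o iota) (c (t, enum_val i)) * e t)).
  move=> /(_ _ (enum_rank s)); rewrite enum_rankK; apply.
  move: mc; congr (ideal_gen _ _).
  by rewrite (reindex (@enum_val S S)) //=; exact: (onW_bij _ (enum_val_bij S)).
pose prods N : set B :=
  [set x | exists2 b : nat -> B, forall i, nonunits (b i) & x = \prod_(0 <= i < N) b i].
pose JN N := ideal_gen (psi @` prods N).
have span N c : exists b : S -> B, JN N (c - \sum_s psi (b s) * f s).
  elim: N c => [|N IH] c.
    exists (fun=> 0); rewrite big1 => [|s _]; last by rewrite rmorph0 mul0r.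
    rewrite -[X in JN _ X]mulr1; have [_ _ GM] := ideal_genP (psi @` prods 0%N).
    apply: GM; apply: sub_ideal_gen; exists 1; last by rewrite rmorph1.
    exists (fun=> 0); last by rewrite big_geq.
    by move=> i; apply/(residue_nonunits resB); rewrite rmorph0.
  have [G0 GD GM] := ideal_genP (psi @` prods N.+1).
  pose H : set C := [set x | exists b : S -> B, JN N.+1 (x - \sum_s psi (b s) * f s)].
  have H0 : H 0.
    exists (fun=> 0); rewrite big1 ?subr0 // => s _; by rewrite rmorph0 mul0r.
  have HD x y : H x -> H y -> H (x + y).
    move=> [b Jb] [b' Jb']; exists (fun s => b s + b' s).
    have := GD _ _ Jb Jb'; congr (JN _ _).
    rewrite addrACA -opprD -big_split; congr (_ - _).
    by apply: eq_bigr => s _; rewrite rmorphD mulrDl.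
  have HN m x : nonunits m -> H (x * psi m).
    move=> nm; have [b Jb] := IH x; exists (fun s => b s * m).
    rewrite (_ : _ - _ = psi m * (x - \sum_s psi (b s) * f s)); last first.
      rewrite mulrBr mulrC; congr (_ - _); rewrite mulr_sumr.
      by apply: eq_bigr => s _; rewrite rmorphM mulrAC mulrC.
    suff : JN N `<=` [set y | JN N.+1 (psi m * y)] by apply.
    apply: ideal_gen_min.
      split; first by rewrite /= mulr0.
        by move=> y z /=; rewrite mulrDr; exact: GD.
      by move=> y z /=; rewrite mulrCA; exact: GM.
    move=> _ [_ [d nd ->] <-] /=; rewrite -rmorphM; apply: sub_ideal_gen.
    apply: imageP; exists (fun i => if i is j.+1 then d j else m).
      by case.
    by rewrite big_nat_recl.
  have [c0 Jc0] := sf c.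
  suff : mBC `<=` H.
    move=> /(_ _ Jc0) [b Jb]; exists (fun s => (phi \o iota) (c0 s) + b s).
    move: Jb; congr (JN _ _); rewrite -addrA -opprD -big_split; congr (_ - _).
    by apply: eq_bigr => s _; rewrite rmorphD mulrDl.
  move=> _ [n [d [x [nx ->]]]]; elim/big_ind: _ => // i _.
  by have [m nm <-] := nx i; exact: HN.
move=> c; have [b Jb] := span #|T| c.
have /choice [d dP] : forall s, exists d : T -> k,
    mAB (b s - \sum_t (phi \o iota) (d t) * e t) by move=> s; exact: se.
exists (fun ts => d ts.2 ts.1); rewrite sumE /=.
rewrite -(subrKA (\sum_s psi (b s) * f s)); apply: mACD.
  move: Jb; apply: ideal_gen_min => // _ [_ [x nx ->] <-].
  exact/psi_mAB/nonunits_nilpotent.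
rewrite -sumrB; apply: (ideal_sum imAC) => s _.
by rewrite -mulrBl -rmorphB; apply: (idealMr imAC); exact: psi_mAB.
Qed.

End Multiplicativity.

(** The criterion for [psi] produces relations over [B], one for each [j]; the criterion for [phi]
    resolves each with its own number [p j] of terms, hence an index set of dependent pairs. *)
Lemma equational_flat_comp (A B C : comPzRingType) (phi : {rmorphism A -> B})
    (psi : {rmorphism B -> C}) :
  equational_flat phi -> equational_flat psi -> equational_flat (psi \o phi).
Proof.
move=> fphi fpsi n a c ac.
have [m [b [c' [cb ab]]]] := fpsi n (phi \o a) c ac.
have /choice [p pP] := fun j => fphi n a (b^~ j) (ab j).
pose x j := projT1 (cid (pP j)); have xP j := projT2 (cid (pP j)).
pose b' j := projT1 (cid (xP j)); have bP j := projT2 (cid (xP j)).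
exists #|{: {j : 'I_m & 'I_(p j)}}|.
pose en (i : 'I_#|{: {j : 'I_m & 'I_(p j)}}|) := enum_val i.
exists (fun i t => x (tag (en t)) i (tagged (en t))).
exists (fun t => psi (b' (tag (en t)) (tagged (en t))) * c' (tag (en t))).
split=> [i|t]; last by case: (bP (tag (en t))) => _; exact.
pose G (u : {j : 'I_m & 'I_(p j)}) :=
  psi (phi (x (tag u) i (tagged u))) * (psi (b' (tag u) (tagged u)) * c' (tag u)).
rewrite cb; transitivity (\sum_u G u); last first.
  by rewrite (reindex en) //=;
    exact: (onW_bij _ (enum_val_bij _)).
transitivity (\sum_j \sum_(t < p j) G (Tagged (fun j => 'I_(p j)) t)).
  apply: eq_bigr => j _; rewrite (proj1 (bP j)) rmorph_sum mulr_suml.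
  by apply: eq_bigr => t _; rewrite rmorphM /G /= mulrA.
rewrite sig_big_dep; by apply: eq_bigr => -[].
Qed.

(** * Affine open sets *)

Section Germs.
Variable X : lrspace.

Lemma germ_irr (U : set X) (x : X) (oU oU' : open U) (Ux Ux' : U x) :
  germ oU Ux = germ oU' Ux' :> (sec U -> stalk x).
Proof. by rewrite (Prop_irrelevance oU oU') (Prop_irrelevance Ux Ux'). Qed.

Lemma openI_pt (U V : set X) (x : X) : open U -> open V -> U x -> V x ->
  exists W : set X, [/\ open W, W x, W `<=` U & W `<=` V].
Proof.
move=> oU oV Ux Vx; exists (U `&` V).
by split; [exact: openI|split|exact: subIsetl|exact: subIsetr].
Qed.

Lemma germ_eq_nbhd (U : set X) (x : X) (oU : open U) (Ux : U x) (s t : sec U) :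
  germ oU Ux s = germ oU Ux t ->
  exists W (oW : open W) (WU : W `<=` U), W x /\ res oU oW WU s = res oU oW WU t.
Proof.
move=> st; have [W [oW [WU [WU' [Wx e]]]]] := germ_eq st; exists W, oW, WU; split=> //.
by rewrite e (Prop_irrelevance WU' WU).
Qed.

Lemma germ_unit_nbhd (U : set X) (x : X) (oU : open U) (Ux : U x) (s : sec U) :
  is_unit (germ oU Ux s) ->
  exists W (oW : open W) (WU : W `<=` U), W x /\ is_unit (res oU oW WU s).
Proof.
move=> [b]; have [V [oV [Vx [t <-]]]] := germ_surj b.
have [W [oW Wx WU WV]] := openI_pt oU oV Ux Vx.
rewrite -(germ_res oU oW WU Ux Wx) -(germ_res oV oW WV Vx Wx) -rmorphM.
rewrite -(rmorph1 (germ oW Wx)) => e.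
have [W' [oW' [W'W [W'x]]]] := germ_eq_nbhd e; move: e => _.
rewrite rmorphM rmorph1 (res_res _ _ _ _ _ (subset_trans W'W WU)) => e.
exists W', oW', (subset_trans W'W WU); split=> //.
by eexists; exact: e.
Qed.

Lemma nbhs_open_sub (T : topologicalType) (A : set T) :
  (forall x, A x -> exists W, [/\ open W, W x & W `<=` A]) -> open A.
Proof.
move=> H; rewrite openE => x /H [W [oW Wx WA]].
by rewrite /interior /= nbhsE; exists W.
Qed.

Definition nonvanishing (U : set X) (oU : open U) (s : sec U) : set X :=
  [set y | exists Uy : U y, is_unit (germ oU Uy s)].

Lemma nonvanishing_open (U : set X) (oU : open U) (s : sec U) :
  open (nonvanishing oU s).
Proof.
apply: nbhs_open_sub => x [Ux uU]; have [W [oW [WU [Wx us]]]] := germ_unit_nbhd uU.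
exists W; split=> // y Wy; exists (WU y Wy).
by rewrite -(germ_res oU oW WU (WU y Wy) Wy); exact: is_unit_rmorph.
Qed.

Lemma sec_eq_germ (U : set X) (oU : open U) (s t : sec U) :
  (forall x (Ux : U x), germ oU Ux s = germ oU Ux t) -> s = t.
Proof.
move=> st.
have /choice [W WP] : forall i : {x | U x}, exists W : set X,
    exists (oW : open W) (WU : W `<=` U),
      W (sval i) /\ res oU oW WU s = res oU oW WU t.
  by move=> [x Ux]; have [W [oW [WU []]]] := germ_eq_nbhd (st x Ux); exists W, oW, WU.
pose oW i := projT1 (cid (WP i)).
pose WU i := projT1 (cid (projT2 (cid (WP i)))).
have WE i := projT2 (cid (projT2 (cid (WP i)))).
apply: (@sec_eq X U oU _ W oW WU) => [x Ux|i]; last by case: (WE i).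
by exists (exist _ x Ux) => //; case: (WE (exist _ x Ux)).
Qed.

End Germs.

(* What is used of an affine open set, in terms of its ring of sections: the
   [nonvanishing s] form a basis, stalks are localizations, and points are
   prime ideals. *)
Record affine_sections (X : lrspace) (U : set X) (oU : open U) : Prop := {
  affine_basis : forall x (Ux : U x) (W : set X), open W -> W x ->
    exists a, is_unit (germ oU Ux a) /\ nonvanishing oU a `<=` W;
  affine_frac : forall x (Ux : U x) (c : stalk x),
    exists a s, is_unit (germ oU Ux s) /\ c * germ oU Ux s = germ oU Ux a;
  affine_ker : forall x (Ux : U x) (a : sec U), germ oU Ux a = 0 ->
    exists s, is_unit (germ oU Ux s) /\ s * a = 0;
  affine_prime : forall p : set (sec U), prime_ideal p ->
    exists x (Ux : U x), forall a, p a <-> nonunits (germ oU Ux a)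
}.

Lemma affine_openP (X : lrspace) (U : set X) (oU : open U) :
  affine_open oU -> affine_sections oU.
Proof.
move=> [A [h [phi [[hU hinj hsurj] basis loc]]]].
pose D a := [set x | U x /\ ~ h x a].
have DU a : D a `<=` U by move=> x [].
have oD a : open (D a).
  by apply/(basis _ (@DU a)) => x Dx; exists a; split.
have Dbasis x W : U x -> open W -> W x -> exists a, D a x /\ D a `<=` W.
  move=> Ux oW Wx; have oUW : open (U `&` W) by exact: openI.
  have [a [Dx DUW]] := (basis _ (@subIsetl _ U W)).1 oUW x (conj Ux Wx).
  by exists a; split=> // y /DUW [].
have prime_h x : U x -> prime_ideal (h x) by move=> Ux; apply: hU.
have primeX x a n : U x -> h x (a ^+ n) -> h x a.
  move=> Ux; have [h0 h1 hD hM hP] := prime_h x Ux.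
  elim: n => [/h1//|n IH]; rewrite exprS => /hP [//|]; exact: IH.
have loca a : is_localization (res oU (oD a) (@DU a) \o phi) [set a ^+ n | n in setT].
  exact: loc.
have DE a x : D a x <-> U x /\ ~ h x a by [].
clearbody D.
(* After this, [h] can be forgotten: the prime of [x] consists of the elements whose germ is not a
   unit. For the converse, an inverse near [x] is restricted to some D(b), where it is a fraction c
   / b^n, so [a] divides a power of [b]. *)
have h_unit x (Ux : U x) a : ~ h x a <-> is_unit (germ oU Ux (phi a)).
  split=> [ha|].
    have Dx : D a x by apply/DE.
    rewrite -(germ_res oU (oD a) (DU a) Ux Dx); apply: is_unit_rmorph.
    by have [/(_ a) + _ _] := loca a; apply; exists 1%N => //; rewrite expr1.
  move=> uU ha; have [W [oW [WU [Wx [t e]]]]] := germ_unit_nbhd uU.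
  have [b [Dx DW]] := Dbasis x W Ux oW Wx.
  have := congr1 (res oW (oD b) DW) e.
  rewrite rmorphM rmorph1 (res_res _ _ _ _ _ (DU b)) => {}e.
  have [_ frac ker] := loca b.
  have [c [_ [[n _ <-] ce]]] := frac (res oW (oD b) DW t).
  have [] := ker (a * c - b ^+ n).
    move: ce => /= ce; rewrite /= !rmorphB !rmorphM /= -ce mulrA e mul1r.
    exact: subrr.
  move=> _ [m _ <-] e0; have [h0 h1 hD hM hP] := prime_h x Ux.
  case/DE: (Dx) => _; apply; apply: (primeX x b (m + n)%N Ux).
  rewrite exprD; move/eqP: e0; rewrite mulrBr subr_eq0 => /eqP <-.
  by apply: (hM); rewrite mulrC; exact: hM.
have phi_surj s : exists a, phi a = s.
  have [_ h1U] : D 1 `<=` U /\ U `<=` D 1.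
    by split=> // x Ux; apply/DE; split=> // h1; have [_ /(_ h1)] := prime_h x Ux.
  have [_ frac _] := loca 1.
  have [a [_ [[n _ <-]]]] := frac (res oU (oD 1) (DU 1) s).
  rewrite expr1n rmorph1 mulr1 => /= e; exists a.
  apply: (@sec_eq X U oU unit (fun=> D 1) (fun=> oD 1) (fun=> DU 1)); last by move=> _; rewrite e.
  by move=> x /h1U; exists tt.
split.
- move=> x Ux W oW Wx; have [a [Dx DW]] := Dbasis x W Ux oW Wx.
  exists (phi a); split; first by apply/h_unit; case/DE: Dx.
  by move=> y [Uy /h_unit hy]; apply: DW; apply/DE.
- move=> x Ux c; have [W [oW [Wx [t <-]]]] := germ_surj c.
  have [b [Dx DW]] := Dbasis x W Ux oW Wx.
  have [_ frac _] := loca b.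
  have [a [_ [[n _ <-] e]]] := frac (res oW (oD b) DW t).
  exists (phi a), (phi (b ^+ n)); split.
    by rewrite !rmorphXn; apply: is_unitX; apply/h_unit; case/DE: Dx.
  rewrite -(germ_res oW (oD b) DW Wx Dx) -!(germ_res oU (oD b) (DU b) Ux Dx).
  by rewrite -rmorphM e.
- move=> x Ux s; have [a <-] := phi_surj s.
  rewrite -(rmorph0 (germ oU Ux)) => e0.
  have [W [oW [WU [Wx e]]]] := germ_eq_nbhd e0.
  have [b [Dx DW]] := Dbasis x W Ux oW Wx.
  have [_ _ ker] := loca b.
  have [] := ker a.
    have := congr1 (res oW (oD b) DW) e.
    by rewrite !(res_res _ _ _ _ _ (DU b)) rmorph0.
  move=> _ [n _ <-] ba; exists (phi (b ^+ n)); split.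
    by rewrite !rmorphXn; apply: is_unitX; apply/h_unit; case/DE: Dx.
  by rewrite -rmorphM ba rmorph0.
- move=> p [p0 p1 pD pM pP].
  have : prime_ideal (phi @^-1` p).
    split=> /=; rewrite ?rmorph0 ?rmorph1 // => a b; rewrite ?rmorphD ?rmorphM.
    - exact: pD. - exact: pM. - exact: pP.
  move=> /hsurj [x Ux hx]; exists x, Ux => s; have [a <-] := phi_surj s.
  split=> [pa|na]; first by move=> /h_unit; apply; rewrite hx.
  by apply: contrapT => pa; apply: na; apply/h_unit; rewrite hx.
Qed.

(** * Generic points and noetherian spaces *)

Lemma irreducible_meet (T : topologicalType) (U V : set T) :
  irreducible_space T -> open U -> open V -> U !=set0 -> V !=set0 ->
  exists x, U x /\ V x.
Proof.
move=> [_ irr] oU oV [x Ux] [y Vy]; apply: contrapT => UV.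
have [] := irr (~` U) (~` V) (open_closedC oU) (open_closedC oV).
- apply/seteqP; split=> // z _; apply: contrapT => /not_orP [].
  by move=> /contrapT Uz /contrapT Vz; apply: UV; exists z.
- by move=> /seteqP [_ /(_ x I)].
- by move=> /seteqP [_ /(_ y I)].
Qed.

Lemma generic_point_open (T : topologicalType) (w : T) (U : set T) :
  generic_point w -> open U -> U !=set0 -> U w.
Proof.
move=> gw oU [y Uy]; have : closure [set w] y by rewrite gw.
by move=> /(_ U (open_nbhs_nbhs (conj oU Uy))) [z [-> ]].
Qed.

(** Such a section lies in every prime ideal, hence is nilpotent. *)
Lemma nowhere_unit_eq0 (X : lrspace) (U : set X) (oU : open U) :
  affine_sections oU -> reduced X -> forall s : sec U,
  (forall x (Ux : U x), nonunits (germ oU Ux s)) -> s = 0.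
Proof.
move=> aU red s ns.
have [n sn] : exists n, s ^+ n = 0.
  apply: contrapT => nz.
  have [|p [pp _ ps]] := prime_avoidance (b := s) (ideal0 (sec U)).
    by move=> n /= sn; apply: nz; exists n.
  have [x [Ux px]] := affine_prime aU pp.
  by apply: ps; apply/px.
exact: red sn.
Qed.

Section Integral.
Variables (X : lrspace) (irr : irreducible_space X) (red : reduced X).
Variables (U : set X) (oU : open U) (aU : affine_sections oU).

Lemma section_neq0 (s : sec U) : s <> 0 -> nonvanishing oU s !=set0.
Proof.
move=> s0; apply: contrapT => ns; apply: s0; apply: nowhere_unit_eq0 => //.
by move=> x Ux us; apply: ns; exists x, Ux.
Qed.

Lemma section_mul_eq0 (s t : sec U) : s * t = 0 -> s = 0 \/ t = 0.
Proof.
move=> st; apply: contrapT => /not_orP [/section_neq0 s0 /section_neq0 t0].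
have [x [[Ux us] [Ux' ut]]] := irreducible_meet irr
  (nonvanishing_open oU s) (nonvanishing_open oU t) s0 t0.
have /(@not_is_unit0 (stalk x)) [] : is_unit (0 : stalk x).
rewrite -(rmorph0 (germ oU Ux)) -st rmorphM; apply/is_unitM; split=> //.
by rewrite (germ_irr oU oU Ux Ux').
Qed.

Lemma unit_germ_neq0 x (Ux : U x) (s : sec U) : is_unit (germ oU Ux s) -> s <> 0.
Proof. by move=> us s0; move: us; rewrite s0 rmorph0; exact: not_is_unit0. Qed.

Lemma germ_inj x (Ux : U x) (s t : sec U) : germ oU Ux s = germ oU Ux t -> s = t.
Proof.
move=> /eqP; rewrite -subr_eq0 -rmorphB => /eqP /(affine_ker aU) [r [ur]].
move=> /section_mul_eq0 [/(unit_germ_neq0 ur)//|/eqP].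
by rewrite subr_eq0 => /eqP.
Qed.

Lemma stalk_mul_eq0 x (Ux : U x) (a b : stalk x) : a * b = 0 -> a = 0 \/ b = 0.
Proof.
have [s [r [ur ar]]] := affine_frac aU Ux a.
have [t [q [uq bq]]] := affine_frac aU Ux b.
move=> ab; have : s * t = 0.
  apply: (germ_inj (Ux := Ux)).
  by rewrite rmorphM -ar -bq rmorph0 mulrACA ab mul0r.
move=> /section_mul_eq0 [s0|t0]; [left|right].
  by apply: (unit_mulr_eq0 ur); rewrite ar s0 rmorph0.
by apply: (unit_mulr_eq0 uq); rewrite bq t0 rmorph0.
Qed.

Lemma generic_stalk_field w : generic_point w -> U w ->
  forall c : stalk w, c <> 0 -> is_unit c.
Proof.
move=> gw Uw c c0; have [s [r [ur cr]]] := affine_frac aU Uw c.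
have s0 : s <> 0.
  by move=> s0; apply: c0; apply: (unit_mulr_eq0 ur); rewrite cr s0 rmorph0.
have [Uw' us] := generic_point_open gw (nonvanishing_open oU s) (section_neq0 s0).
have /is_unitM [] : is_unit (c * germ oU Uw r).
  by rewrite cr (germ_irr oU oU Uw Uw').
by [].
Qed.

End Integral.

(** Flatness over a domain makes [fstalk f eta] injective: the relation a * 1 = 0 is resolved
    through elements killed by [a], which are zero, and then 1 = 0. A local injection into a field
    has a field as its source, and a point whose stalk is a field is generic here, since nonzero
    sections are units at it. *)
Lemma flat_generic (X Y : lrspace) (f : lrmor X Y) (eta : X) (V : set Y)
    (oV : open V) (W : set X) (oW : open W) :
  reduced X -> irreducible_space Y -> reduced Y ->
  affine_sections oV -> V (f eta) -> affine_sections oW -> W eta ->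
  generic_point eta -> equational_flat (fstalk f eta) ->
  generic_point (f eta).
Proof.
move=> redX irrY redY aV Vf aW Weta geta fl.
have inj (a : stalk (f eta)) : fstalk f eta a = 0 -> a = 0.
  move=> fa; apply: contrapT => a0.
  have [|m [c [b [b1 ac]]]] := fl 1%N (fun=> a) (fun=> 1).
    by rewrite big_ord1 fa mul0r.
  have c0 j : c ord0 j = 0.
    have := ac j; rewrite big_ord1.
    by move=> /(stalk_mul_eq0 irrY redY aV Vf) [].
  have := b1 ord0; rewrite big1 => [|j _]; last by rewrite c0 rmorph0 mul0r.
  by move/eqP; rewrite oner_eq0.
have field (a : stalk (f eta)) : a <> 0 -> is_unit a.
  move=> a0; apply: (@fstalk_local _ _ f eta).
  by apply: (generic_stalk_field redX aW geta Weta) => /inj.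
apply/seteqP; split=> // y _ B; rewrite nbhsE => -[W' [oW' W'y] W'B].
exists (f eta); split=> //; apply: W'B.
have [z [Vz W'z]] := irreducible_meet irrY oV oW' (ex_intro _ _ Vf) (ex_intro _ _ W'y).
have [a [ua aW']] := affine_basis aV Vz oW' W'z.
apply: aW'; exists Vf; apply: field => a0.
apply: (unit_germ_neq0 ua); apply: (germ_inj irrY redY aV (Ux := Vf)).
by rewrite a0 rmorph0.
Qed.

Definition noetherian_space (T : topologicalType) :=
  forall P : set (set T), P `<=` closed -> P !=set0 ->
  exists Z, P Z /\ forall W, P W -> W `<=` Z -> W = Z.

(** Otherwise there are decreasing [Z n] in [P] and points [x n] of [U] in [Z n] but not in
    [Z n.+1]. Choose [a n] a unit at [x n] and a nonunit along [Z n.+1]: all earlier [a i] are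
    nonunits at [x n], hence so is every combination of them, and [a n] is never one. *)
Lemma noetherian_trace (X : lrspace) (U : set X) (oU : open U) :
  affine_sections oU -> noetherian (sec U) ->
  forall P : set (set X), P `<=` closed -> P !=set0 ->
  exists Z, P Z /\ forall W, P W -> W `<=` Z -> Z `&` U `<=` W.
Proof.
move=> aU nU P Pc [Z0 PZ0]; apply: contrapT => nmin.
have step (Z : {Z | P Z}) : exists Wx : {Z | P Z} * X,
    [/\ sval Wx.1 `<=` sval Z, sval Z Wx.2, U Wx.2 & ~ sval Wx.1 Wx.2].
  case: Z => Z PZ /=; apply: contrapT => nstep; apply: nmin; exists Z; split=> //.
  move=> W PW WZ x [Zx Ux]; apply: contrapT => Wx; apply: nstep.
  by exists (exist _ W PW, x).
have [nx nxP] := choice step.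
pose Z n := iter n (fun Z => (nx Z).1) (exist _ Z0 PZ0).
pose x n := (nx (Z n)).2.
have Zdecr m n : (m <= n)%N -> sval (Z n) `<=` sval (Z m).
  move=> /subnK <-; elim: (n - m)%N => [|l IH]; first by rewrite add0n.
  by rewrite addSn /= => y Hy; apply: IH; case: (nxP (Z (l + m)%N)) => + _ _ _; apply.
have Ux n : U (x n) by case: (nxP (Z n)).
have /choice [a aP] : forall n, exists a, is_unit (germ oU (Ux n) a) /\
    nonvanishing oU a `<=` ~` sval (Z n.+1).
  move=> n; apply: affine_basis => //; last by case: (nxP (Z n)).
  by apply: closed_openC; apply: Pc; exact: (svalP (Z n.+1)).
have [n [c an]] := nU a.
have [ua _] := aP n.
suff : nonunits (germ oU (Ux n) (a n)) by apply.
have iN := @nonunits_ideal (stalk (x n)) (@stalk_local X (x n)).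
have [_ _ NM] := iN.
rewrite an rmorph_sum; apply: (ideal_sum iN) => i _; rewrite rmorphM; apply: NM.
move=> ui; have [_ /(_ (x n))] := aP i; apply; first by exists (Ux n).
have [_ + _ _] := nxP (Z n); rewrite -/(x n); apply: Zdecr.
exact: ltn_ord.
Qed.

(** Minimality is achieved on one chart after another, each time among the members contained in the
    previous choice. *)
Lemma finite_type_noetherian (k : fieldType) (X : kscheme k) :
  finite_type X -> noetherian_space X.
Proof.
move=> [n [U [oU [cover affU]]]] P Pc P0.
have trace i (Q : set (set X)) : Q `<=` closed -> Q !=set0 ->
    exists Z, Q Z /\ forall W, Q W -> W `<=` Z -> Z `&` U i `<=` W.
  have [aU fU] := affU i.
  apply: (noetherian_trace (oU := oU i)); first exact: affine_openP.
  exact: (algebra_finite_noetherian (phi := res openT (oU i) (@subsetT _ (U i)) \o scal X)).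
have [Z [PZ Zmin]] : exists Z, P Z /\ forall W, P W -> W `<=` Z ->
    forall i, i \in enum 'I_n -> Z `&` U i `<=` W.
  elim: (enum 'I_n) => [|i s [Z [PZ Zmin]]].
    by case: P0 => Z PZ; exists Z; split.
  have [|| Z' [[PZ' Z'Z] Z'min]] := trace i [set W | P W /\ W `<=` Z].
  - by move=> W [/Pc].
  - by exists Z; split.
  exists Z'; split=> // W PW WZ' j; rewrite inE => /predU1P [->|js].
    by apply: Z'min => //; split=> //; exact: subset_trans WZ' Z'Z.
  move=> x [Z'x Ujx]; apply: (Zmin W PW _ j js); last by split=> //; exact: Z'Z.
  exact: subset_trans WZ' Z'Z.
exists Z; split=> // W PW WZ; apply/seteqP; split=> // x Zx.
have : (\bigcup_i U i) x by rewrite cover.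
by move=> [i _ Uix]; apply: (Zmin W PW WZ i); rewrite ?mem_enum.
Qed.

(** Irreducibility makes the sections that are units nowhere on [Z] a prime ideal; its point is the
    generic point of [Z]. *)
Lemma scheme_sober (X : lrspace) (Z : set X) : is_scheme X -> closed Z ->
  Z !=set0 ->
  (forall F G, closed F -> closed G -> Z `<=` F `|` G -> Z `<=` F \/ Z `<=` G) ->
  exists2 z, Z z & forall W, open W -> (exists x, Z x /\ W x) -> W z.
Proof.
move=> sX cZ [x Zx] irr.
have [U [oU [Ux /affine_openP aU]]] := sX x.
pose I := [set a : sec U | forall y, Z y -> ~ nonvanishing oU a y].
have oZ : open (~` Z) by exact: closed_openC.
have irr_open V W : open V -> open W -> (exists y, Z y /\ V y) ->
    (exists y, Z y /\ W y) -> exists y, [/\ Z y, V y & W y].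
  move=> oV oW [v [Zv Vv]] [w [Zw Ww]]; apply: contrapT => VW.
  have [] := irr _ _ (open_closedC oV) (open_closedC oW).
  - move=> y Zy; apply: contrapT => /not_orP [/contrapT Vy /contrapT Wy].
    by apply: VW; exists y.
  - by move=> /(_ v Zv).
  - by move=> /(_ w Zw).
have pI : prime_ideal I.
  split.
  - move=> y Zy [Uy]; rewrite rmorph0; exact: not_is_unit0.
  - move=> /(_ x Zx); apply; exists Ux; rewrite rmorph1; exact: is_unit1.
  - move=> a b Ia Ib y Zy [Uy]; rewrite rmorphD => /stalk_local [ua|ub].
      by apply: (Ia y Zy); exists Uy.
    by apply: (Ib y Zy); exists Uy.
  - move=> a b Ib y Zy [Uy]; rewrite rmorphM => /is_unitM [_ ub].
    by apply: (Ib y Zy); exists Uy.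
  - move=> a b Iab; apply: contrapT => /not_orP [].
    move=> /existsNP [y /not_implyP [Zy /contrapT ya]].
    move=> /existsNP [z /not_implyP [Zz /contrapT zb]].
    have [||w [Zw [Uw ua] [Uw' ub]]] := irr_open _ _ (nonvanishing_open oU a) (nonvanishing_open oU b).
      by exists y. by exists z.
    apply: (Iab w Zw); exists Uw; rewrite rmorphM; apply/is_unitM; split=> //.
    by rewrite (germ_irr oU oU Uw Uw').
have [z [Uz Iz]] := affine_prime aU pI.
have gen W : open W -> (exists y, Z y /\ W y) -> W z.
  move=> oW ZW.
  have [|y [Zy Uy Wy]] := irr_open U W oU oW _ ZW; first by exists x.
  have [a [ua aW]] := affine_basis aU Uy oW Wy.
  apply: aW; exists Uz; apply: contrapT => /Iz /(_ y Zy); apply.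
  by exists Uy.
exists z => //; apply: contrapT => nZz.
have [a [ua aZ]] := affine_basis aU Uz oZ nZz.
have : nonunits (germ oU Uz a) by apply/Iz => y Zy /aZ.
by apply.
Qed.

(** * The fibre over a rational point *)

Section Scalars.
Variables (k : fieldType) (X : kscheme k).

Definition kstalk (x : X) : {rmorphism k -> stalk x} :=
  germ openT (I : [set: X] x) \o scal X.

Definition ksec (U : set X) (oU : open U) : {rmorphism k -> sec U} :=
  res openT oU (@subsetT _ U) \o scal X.

Lemma germ_ksec (U : set X) (oU : open U) (x : X) (Ux : U x) c :
  germ oU Ux (ksec oU c) = kstalk x c.
Proof. exact: germ_res. Qed.

Lemma rational_residue (x : X) : rational_point x ->
  exists rho : {rmorphism stalk x -> k}, residue (kstalk x) rho.
Proof. by move=> rx; apply: exists_residue => //; exact: stalk_local. Qed.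

End Scalars.

Section ScalarsMorphism.
Variables (k : fieldType) (X Y : kscheme k) (f : kmor X Y).

Lemma fstalk_kstalk (x : X) c : fstalk f x (kstalk (f x) c) = kstalk x c.
Proof.
rewrite /kstalk /= (fstalk_germ f openT (x := x) I openT).
by rewrite (kfun_scal f c openT).
Qed.

Lemma fstalk_germ_preim (V : set Y) (oV : open V) (oV' : open (f @^-1` V)) (y : X)
    (Vfy : V (f y)) (a : sec V) :
  germ (x := y) oV' Vfy (fsec f oV a) = fstalk f y (germ oV Vfy a).
Proof. by rewrite (fstalk_germ f oV Vfy oV'). Qed.

Lemma fsec_ksec (V : set Y) (oV : open V) (oV' : open (f @^-1` V)) c :
  fsec f oV (ksec oV c) = ksec oV' c.
Proof.
apply: (sec_eq_germ (oU := oV')) => x Vfx.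
by rewrite fstalk_germ_preim !germ_ksec fstalk_kstalk.
Qed.

Definition fibre_ideal (y : X) : set (stalk y) :=
  ideal_gen (fstalk f y @` @nonunits (stalk (f y))).

Lemma fibre_ideal_nonunits (y : X) : @fibre_ideal y `<=` @nonunits (stalk y).
Proof.
apply: ideal_gen_min; first exact/nonunits_ideal/stalk_local.
by move=> _ [a na <-] /fstalk_local.
Qed.

End ScalarsMorphism.
Arguments fibre_ideal {k X Y} f y.

(** Algebraic closedness enters here: [p] splits into linear factors, and a product of units b - c
    would be a unit. *)
Lemma closed_field_residue (k : closedFieldType) (O : comNzRingType)
    (iota : {rmorphism k -> O}) (b : O) (p : {poly k}) :
  (forall a b : O, is_unit (a + b) -> is_unit a \/ is_unit b) ->
  p != 0 -> nonunits (map_poly iota p).[b] -> exists c, nonunits (b - iota c).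
Proof.
move=> locO p0; have [r ->] := closed_field_poly_normal p.
rewrite map_polyZ /= hornerZ rmorph_prod horner_prod.
have : is_unit (iota (lead_coef p)).
  by exists (iota (lead_coef p)^-1); rewrite -rmorphM mulfV ?rmorph1 // lead_coef_eq0.
move=> ul nl; apply: contrapT => nc; apply: nl; apply/is_unitM; split=> //.
elim/big_ind: _ => [|x y ux uy|c _]; first exact: is_unit1.
  exact/is_unitM.
rewrite /= map_polyXsubC hornerXsubC; apply: contrapT => nbc.
by apply: nc; exists c.
Qed.

Lemma horner_fitting (k : fieldType) (O : comNzRingType)
    (iota : {rmorphism k -> O}) (b : O) N m (c : nat -> k) :
  (map_poly iota ('X^N * (1 - 'X * \sum_(0 <= i < m) (c i)%:P * 'X^i))).[b] =
  b ^+ N * (1 - b * \sum_(0 <= i < m) iota (c i) * b ^+ i).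
Proof.
rewrite !(rmorphM, rmorphB, rmorph1, rmorph_sum, rmorphXn) /= map_polyX.
rewrite hornerM hornerXn hornerD hornerN hornerC hornerM hornerX horner_sum.
congr (_ * (1 - _ * _)); apply: eq_bigr => i _.
by rewrite rmorphM rmorphXn /= map_polyX map_polyC hornerM hornerC hornerXn.
Qed.

Lemma sum_tagged (W : nmodType) (I : finType) (n : I -> nat)
    (F : {i : I & 'I_(n i)} -> W) :
  \sum_t F t = \sum_i \sum_(j < n i) F (Tagged (fun i => 'I_(n i)) j).
Proof. by rewrite sig_big_dep; apply: eq_bigr => -[]. Qed.

Section Fibre.
Variables (k : closedFieldType) (X : kscheme k) (f : kmor X X).
Hypotheses (irrX : irreducible_space X) (redX : reduced X).
Hypothesis f_flat : forall x : X, equational_flat (fstalk f x).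
Variables (z : X) (rz : rational_point z).
Variables (V : set X) (oV : open V) (oV' : open (f @^-1` V)) (Vz : V z).
Hypotheses (aV : affine_sections oV) (aV' : affine_sections oV').
Hypothesis f_fin : module_finite (fsec f oV).

Let A := sec V.
Let B := sec (f @^-1` V).
Let phi : {rmorphism A -> B} := fsec f oV.
Let iota : {rmorphism k -> B} := ksec oV'.

(** The prime of [z] in [A]; [fibre_secs] is its extension m_z B, so that B / m_z B is the
    coordinate ring of the scheme-theoretic fibre. *)
Definition vanishing_at : set A := [set a | nonunits (germ oV Vz a)].
Definition fibre_secs : set B := ideal_gen (phi @` vanishing_at).

Let mB_ideal : is_ideal fibre_secs. Proof. exact: ideal_genP. Qed.
Let J_ideal y : is_ideal (fibre_ideal f y). Proof. exact: ideal_genP. Qed.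

Lemma fibre_mem y : f y = z -> V (f y). Proof. by move=> ->. Qed.

Lemma vanishing_at_fibre y (fy : f y = z) (a : A) :
  vanishing_at a <-> nonunits (germ oV (fibre_mem fy) a).
Proof.
rewrite /vanishing_at /=; move: (fibre_mem fy); rewrite fy => Vz'.
by rewrite (germ_irr oV oV Vz Vz').
Qed.

Let gm y (fy : f y = z) : {rmorphism B -> stalk y} :=
  germ (x := y) oV' (fibre_mem fy).

Lemma gm_iota y (fy : f y = z) c : gm fy (iota c) = kstalk y c.
Proof. exact: germ_ksec. Qed.

Lemma fibre_secs_germ y (fy : f y = z) b : fibre_secs b -> fibre_ideal f y (gm fy b).
Proof.
have [J0 JD JM] := J_ideal y.
suff : fibre_secs `<=` [set b | fibre_ideal f y (gm fy b)] by apply.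
apply: ideal_gen_min.
  split; first by rewrite /= rmorph0.
    by move=> x x' /=; rewrite rmorphD; exact: JD.
  by move=> x x' /=; rewrite rmorphM; exact: JM.
move=> _ [a ma <-] /=; rewrite /gm fstalk_germ_preim; apply: sub_ideal_gen.
by apply: imageP; apply/vanishing_at_fibre.
Qed.

Lemma exists_residue_sec : exists rho : {rmorphism A -> k},
  (forall a, vanishing_at a <-> rho a = 0) /\ forall c, rho (ksec oV c) = c.
Proof.
have [rho res] := rational_residue rz.
exists (rho \o germ oV Vz); split=> [a|c] /=.
  exact: (residue_nonunits res).
by rewrite germ_ksec (proj2 res).
Qed.

Lemma fibre_spanned n (g : 'I_n -> B) :
  (forall b, exists c : 'I_n -> A, b = \sum_i phi (c i) * g i) ->
  forall b, spanned iota fibre_secs g b.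
Proof.
move=> gen b; have [c ->] := gen b.
have [rho [rhoV rhoK]] := exists_residue_sec.
exists (rho \o c); rewrite -sumrB; apply: (ideal_sum mB_ideal) => i _.
rewrite -mulrBl /iota -(fsec_ksec (f := f) oV oV') -/phi -rmorphB.
apply: (idealMr mB_ideal); apply: sub_ideal_gen; apply: imageP; apply/rhoV.
by rewrite rmorphB rhoK subrr.
Qed.

Lemma fibre_fitting (b : B) : exists N m (c : nat -> k),
  fibre_secs (b ^+ N * (1 - b * \sum_(0 <= i < m) iota (c i) * b ^+ i)).
Proof.
have [n [g gen]] := f_fin.
have [|N _ [m [c H]]] := spanned_fitting mB_ideal (e := g) (b := b) (iota := iota).
  by move=> j; exact: fibre_spanned.
by exists N, m, c.
Qed.

(** The Fitting relation is an equation p(b) = 0 on the fibre, and [p] is nonzero because its second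
    factor takes the value 1 at 0. *)
Lemma fibre_rational_sec y (fy : f y = z) (b : B) :
  exists c, nonunits (gm fy b - kstalk y c).
Proof.
have [N [m [c Hb]]] := fibre_fitting b.
pose p : {poly k} := 'X^N * (1 - 'X * \sum_(0 <= i < m) (c i)%:P * 'X^i).
apply: (closed_field_residue (p := p) (@stalk_local X y)).
  apply: mulf_neq0; first by rewrite monic_neq0 // monicXn.
  apply/eqP => /(congr1 (fun q => q.[0])).
  by rewrite /= !hornerE ?mul0r ?subr0 => /eqP; rewrite oner_eq0.
rewrite horner_fitting; have := fibre_ideal_nonunits (fibre_secs_germ fy Hb).
rewrite rmorphM rmorphXn rmorphB rmorph1 rmorphM rmorph_sum.
congr (nonunits (_ * (1 - _ * _))); apply: eq_bigr => i _.
by rewrite rmorphM rmorphXn gm_iota.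
Qed.

Lemma fibre_rational y (fy : f y = z) : rational_point y.
Proof.
move=> c; have [a [s [us cs]]] := affine_frac aV' (fibre_mem fy : (f @^-1` V) y) c.
have [ca nca] := fibre_rational_sec fy a; have [cs' ncs] := fibre_rational_sec fy s.
have iN := @nonunits_ideal (stalk y) (@stalk_local X y); have [_ _ NM] := iN.
have cs0 : cs' != 0.
  by apply/eqP => cs0; move: ncs; rewrite cs0 rmorph0 subr0; exact.
exists (ca / cs'); rewrite -/(kstalk y (ca / cs')) => uc.
have : nonunits ((c - kstalk y (ca / cs')) * gm fy s).
  rewrite mulrBl [X in X - _]cs (_ : _ - _ = (gm fy a - kstalk y ca)
    - kstalk y (ca / cs') * (gm fy s - kstalk y cs')).
    by apply: (idealB iN) => //; exact: NM.
  by rewrite mulrBr -rmorphM divfK // opprB addrA subrK.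
by apply; apply/is_unitM.
Qed.

Lemma ideal_pow1 (C : comPzRingType) (J : set C) x N :
  is_ideal J -> J (1 - x) -> J (1 - x ^+ N).
Proof.
move=> iJ Jx; elim: N => [|N IH]; first by rewrite expr0 subrr; case: iJ.
rewrite exprS -(subrKA x) -{2}[x]mulr1 -mulrBr.
by case: iJ => _ JD JM; apply: JD => //; exact: JM.
Qed.

Lemma unit_ideal (C : comPzRingType) (J : set C) u x :
  is_ideal J -> is_unit u -> J (u * x) -> J x.
Proof.
by move=> [_ _ JM] [v uv] /(JM v); rewrite mulrA [v * u]mulrC uv mul1r.
Qed.

(** On the fibre g^N (1 - g h) = 0, so (g h)^N acts as an idempotent: where [g] is a unit, g h = 1;
    where it is not, 1 - g h is a unit and g^N = 0. *)
Lemma fibre_separate_unit y1 y2 (f1 : f y1 = z) (f2 : f y2 = z) (g : B) :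
  nonunits (gm f1 g) -> is_unit (gm f2 g) ->
  exists u : B, fibre_ideal f y1 (gm f1 u) /\ fibre_ideal f y2 (1 - gm f2 u).
Proof.
move=> n1 u2; have [N [m [c]]] := fibre_fitting g.
set h := \sum_(0 <= i < m) _ => Hg; exists ((g * h) ^+ N); split.
  rewrite exprMn rmorphM; apply: (idealMr (J_ideal y1)).
  apply: (@unit_ideal _ _ (gm f1 (1 - g * h)) _ (J_ideal y1)); last first.
    by rewrite -rmorphM mulrC; exact: fibre_secs_germ.
  rewrite rmorphB rmorph1; apply: unit_addl_nonunit; first exact: stalk_local.
    exact: is_unit1.
  have iN := @nonunits_ideal (stalk y1) (@stalk_local X y1).
  by apply: (idealN iN); rewrite rmorphM; exact: (idealMr iN).
rewrite rmorphXn; apply: (ideal_pow1 _ (J_ideal y2)).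
apply: (@unit_ideal _ _ (gm f2 g ^+ N) _ (J_ideal y2)); first exact: is_unitX.
have := fibre_secs_germ f2 Hg.
by rewrite rmorphM rmorphXn rmorphB rmorph1.
Qed.

Lemma fibre_separate y1 y2 (f1 : f y1 = z) (f2 : f y2 = z) : y1 <> y2 ->
  exists u : B, fibre_ideal f y1 (gm f1 u) /\ fibre_ideal f y2 (1 - gm f2 u).
Proof.
move=> /scheme_kolmogorov [U oU [[U1 U2]|[U2 U1]]].
  have [a [ua aU]] := affine_basis aV' (fibre_mem f1 : (f @^-1` V) y1) oU U1.
  have na : nonunits (gm f2 a) by move=> ua2; apply: U2; apply: aU; eexists; exact: ua2.
  have [u [u2 u1]] := fibre_separate_unit na ua.
  exists (1 - u); rewrite !rmorphB !rmorph1; split=> //.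
  by rewrite opprB addrC subrK.
have [a [ua aU]] := affine_basis aV' (fibre_mem f2 : (f @^-1` V) y2) oU U2.
apply: (@fibre_separate_unit _ _ f1 f2 a) => // ua1.
by apply: U1; apply: aU; eexists; exact: ua1.
Qed.

Lemma fibre_dual n (y : 'I_n -> X) (fy : forall i, f (y i) = z) : injective y ->
  exists s : 'I_n -> B, (forall i, fibre_ideal f (y i) (1 - gm (fy i) (s i))) /\
    forall i j, i != j -> fibre_ideal f (y i) (gm (fy i) (s j)).
Proof.
move=> yinj.
have /choice [u uP] : forall ij : 'I_n * 'I_n, exists u : B, ij.1 != ij.2 ->
    fibre_ideal f (y ij.1) (gm (fy ij.1) u) /\
    fibre_ideal f (y ij.2) (1 - gm (fy ij.2) u).
  move=> [i j] /=; have [->|ij] := eqVneq i j; first by exists 0.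
  have [|u Hu] := @fibre_separate _ _ (fy i) (fy j); last by exists u.
  by move=> /yinj /eqP; rewrite (negbTE ij).
exists (fun j => \prod_(i | i != j) u (i, j)); split=> [j|i j ij]; last first.
  rewrite (bigD1 i) //= rmorphM; apply: (idealMr (J_ideal (y i))).
  by case: (uP (i, j) ij).
have [J0 JD JM] := J_ideal (y j).
elim/big_rec: _ => [|i x ij Hx]; first by rewrite rmorph1 subrr.
rewrite rmorphM -(subrKA (gm (fy j) x)) -{2}[gm (fy j) x]mul1r -mulrBl.
by apply: JD => //; apply: (idealMr (J_ideal (y j))); case: (uP (i, j) ij).
Qed.

(** The sections of [fibre_dual] are independent modulo [fibre_secs], so a fibre has at most as many
    points as there are generators of [B] over [A]. *)
Lemma fibre_enum : exists n (y : 'I_n -> X), [/\ injective y,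
  forall i, f (y i) = z & forall y', f y' = z -> exists i, y i = y'].
Proof.
have [N [g gen]] := f_fin.
pose P n := `[< exists y : 'I_n -> X, injective y /\ forall i, f (y i) = z >].
have ubP n : P n -> (n <= N)%N.
  move=> /asboolP [y [yinj fy]]; have [s [s1 s0]] := fibre_dual fy yinj.
  have := @exchange _ _ iota _ mB_ideal _ _ g s; rewrite !card_ord; apply; last first.
    by move=> i; exact: fibre_spanned.
  move=> c /(fibre_secs_germ (fy _)) Hc i; have {Hc} := Hc i.
  have [J0 JD JM] := J_ideal (y i).
  rewrite rmorph_sum (bigD1 i) //= => Hc.
  have Jc : fibre_ideal f (y i) (kstalk (y i) (c i)).
    rewrite -gm_iota; apply: (ideal_trans (J_ideal (y i))
      (b := gm (fy i) (iota (c i)) * gm (fy i) (s i))).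
      by rewrite -{1}[gm _ _]mulr1 -mulrBr; exact: JM.
    rewrite -rmorphM; apply: ideal_trans Hc => //.
    rewrite opprD addrA subrr sub0r; apply: (idealN (J_ideal (y i))).
    apply: (ideal_sum (J_ideal (y i))) => j ji.
    by rewrite rmorphM; apply: JM; apply: s0; rewrite eq_sym.
  apply/eqP; apply: contrapT => /negP c0; apply: (fibre_ideal_nonunits Jc).
  by exists (kstalk (y i) (c i)^-1); rewrite -rmorphM mulfV ?rmorph1.
have P0 : exists n, P n.
  have y0 (i : 'I_0) : X by case: i.
  by exists 0%N; apply/asboolP; exists y0; split=> [[]|[]].
case: (ex_maxnP P0 ubP) => n /asboolP [y [yinj fy]] nmax.
exists n, y; split=> // y' fy'; apply: contrapT => ny.
suff /nmax : P n.+1 by rewrite ltnn.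
apply/asboolP; exists (fun i => oapp y y' (unlift ord0 i)); split; last first.
  by move=> i; case: (unliftP ord0 i) => [j _|_] /=.
move=> i j; case: (unliftP ord0 i) => [i' ->|->]; case: (unliftP ord0 j) => [j' ->|->] //=.
- by move=> /yinj ->.
- by move=> e; case: ny; exists i'.
- by move=> e; case: ny; exists j'.
Qed.

(** A denominator is a unit at [y], and its inverse modulo the fibre ideal is, by Fitting, a
    polynomial in it, hence the germ of a section. *)
Lemma fibre_surj y (fy : f y = z) (c : stalk y) :
  exists b, fibre_ideal f y (c - gm fy b).
Proof.
have [a [s [us cs]]] := affine_frac aV' (fibre_mem fy : (f @^-1` V) y) c.
have [N [m [d]]] := fibre_fitting s.
set h := \sum_(0 <= i < m) _ => Hs; exists (a * h).
have -> : c - gm fy (a * h) = c * gm fy (1 - s * h).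
  by rewrite rmorphB rmorph1 mulrBr mulr1 !rmorphM mulrA cs.
have [_ _ JM] := J_ideal y; apply: JM.
apply: (@unit_ideal _ _ (gm fy s ^+ N) _ (J_ideal y)); first exact: is_unitX.
by rewrite -rmorphXn -rmorphM; exact: fibre_secs_germ.
Qed.

Lemma fibre_basis y (fy : f y = z) : exists n (g : 'I_n -> B),
  basis_mod (kstalk y) (fibre_ideal f y) (fun i => gm fy (g i)).
Proof.
have [N [g gen]] := f_fin.
have span c : spanned (kstalk y) (fibre_ideal f y) (fun i => gm fy (g i)) c.
  have [b Jb] := fibre_surj fy c; have [d Hd] := fibre_spanned gen b.
  exists d; rewrite -(subrKA (gm fy b)); case: (J_ideal y) => _ JD _; apply: JD => //.
  have := fibre_secs_germ fy Hd; congr (fibre_ideal f y _).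
  rewrite rmorphB rmorph_sum; congr (_ - _); apply: eq_bigr => i _.
  by rewrite rmorphM gm_iota.
have [n [t [ind spt]]] := exists_basis (kstalk y) (J_ideal y) (fun i => gm fy (g i)).
exists n, (g \o t); split=> // c.
by apply: (spanned_trans (J_ideal y) spt); exact: span.
Qed.

Lemma multiplicity_basis y (fy : f y = z) (T : finType) (e : T -> stalk y) :
  basis_mod (kstalk y) (fibre_ideal f y) e -> multiplicity f y = #|T|.
Proof.
move=> be; have rfy : rational_point (f y) by rewrite fy.
have [rho res] := rational_residue rfy.
apply: (quotient_dim_basis res (J_ideal y) _ (e := e)).
  by move=> a Ha; exact: sub_ideal_gen.
by apply: basis_mod_ext be => c; rewrite -(fstalk_kstalk f).
Qed.

Lemma fibre_ideal_clear y (fy : f y = z) (c : stalk y) : fibre_ideal f y c ->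
  exists t b, [/\ is_unit (gm fy t), fibre_secs b & c * gm fy t = gm fy b].
Proof.
have [m0 mD mM] := mB_ideal.
pose J' := [set c : stalk y |
  exists t b, [/\ is_unit (gm fy t), fibre_secs b & c * gm fy t = gm fy b]].
suff : fibre_ideal f y `<=` J' by apply.
apply: ideal_gen_min.
  split.
  - by exists 1, 0; split; rewrite ?rmorph1 ?rmorph0 ?mul0r //; exact: is_unit1.
  - move=> a a' [t [b [ut mb e]]] [t' [b' [ut' mb' e']]].
    exists (t * t'), (t' * b + t * b'); split.
    + by rewrite rmorphM; apply/is_unitM.
    + by apply: mD; exact: mM.
    + by rewrite rmorphD !rmorphM -e -e'; ring.
  - move=> a a' [t [b [ut mb e]]].
    have [p [q [uq aq]]] := affine_frac aV' (fibre_mem fy : (f @^-1` V) y) a.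
    exists (q * t), (p * b); split.
    + by rewrite rmorphM; apply/is_unitM.
    + exact: mM.
    + by rewrite !rmorphM -e [gm fy p](esym aq) mulrACA.
move=> _ [a na <-]; have [p [q [uq aq]]] := affine_frac aV (fibre_mem fy) a.
exists (phi q), (phi p); split.
- by rewrite /gm fstalk_germ_preim; exact: is_unit_rmorph.
- apply: sub_ideal_gen; apply: imageP; apply/(vanishing_at_fibre fy).
  by rewrite -aq => /is_unitM [].
- by rewrite /gm !fstalk_germ_preim -rmorphM aq.
Qed.

(** The maximality of the prime of [z]: if [a] is a unit at [z] but not at [f y], then the nonzero
    scalar [rho a] is a nonunit at [f y]. *)
Lemma fibre_of_prime y (Vy : V (f y)) :
  (forall a, vanishing_at a -> nonunits (germ oV Vy a)) -> f y = z.
Proof.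
move=> vy; apply: contrapT => /scheme_kolmogorov [U oU [[Uy Uz]|[Uz Uy]]].
  have [a [ua aU]] := affine_basis aV Vy oU Uy.
  by apply: (vy a) => // ua'; apply: Uz; apply: aU; exists Vz.
have [a [ua aU]] := affine_basis aV Vz oU Uz.
have [rho [rhoV rhoK]] := exists_residue_sec.
have na : nonunits (germ oV Vy a) by move=> ua'; apply: Uy; apply: aU; exists Vy.
have nr : nonunits (germ oV Vy (a - ksec oV (rho a))).
  by apply: vy; apply/rhoV; rewrite rmorphB rhoK subrr.
have iN := @nonunits_ideal (stalk (f y)) (@stalk_local X (f y)).
have := idealB iN na nr; rewrite rmorphB opprB addrC subrK germ_ksec; apply.
exists (kstalk (f y) (rho a)^-1); rewrite -rmorphM mulfV ?rmorph1 //.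
by apply/eqP => /rhoV.
Qed.

(** The ideal of the [t] with [t * b] in [fibre_secs] lies in no prime: the prime would contain m_z
    B, hence be a point of the fibre, and there [fibre_ideal_clear] provides an element of the ideal
    outside the prime. *)
Lemma fibre_secs_local b :
  (forall y (fy : f y = z), fibre_ideal f y (gm fy b)) -> fibre_secs b.
Proof.
move=> Jb; have [m0 mD mM] := mB_ideal.
pose Q := [set t : B | fibre_secs (t * b)].
have iQ : is_ideal Q.
  split; rewrite /Q /=; first by rewrite mul0r.
    by move=> t t' /=; rewrite mulrDl; exact: mD.
  by move=> t t' /=; rewrite -mulrA; exact: mM.
apply: contrapT => nb.
have [|p [pp Qp _]] := prime_avoidance (b := 1) iQ.
  by move=> n; rewrite expr1n /Q /= mul1r.
have [y [Vy py]] := affine_prime aV' pp.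
have fy : f y = z.
  apply: (fibre_of_prime (y := y) (Vy := Vy)) => a va ua.
  have : p (phi a).
    apply: Qp; rewrite /Q /= mulrC; apply: mM; apply: sub_ideal_gen.
    exact: imageP.
  by move/py; apply; rewrite fstalk_germ_preim; exact: is_unit_rmorph.
have [t [b' [ut mb' e]]] := @fibre_ideal_clear y fy _ (Jb y fy).
have [|t' [ut' e']] := affine_ker aV' (Ux := fibre_mem fy : (f @^-1` V) y) (a := b * t - b').
  by rewrite rmorphB rmorphM; apply/eqP; rewrite subr_eq0; apply/eqP.
have : p (t' * t).
  apply: Qp; rewrite /Q /= -mulrA [t * b]mulrC.
  by move/eqP: e'; rewrite mulrBr subr_eq0 => /eqP ->; exact: mM.
move/py; apply; rewrite rmorphM (germ_irr oV' oV' Vy (fibre_mem fy)).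
by apply/is_unitM.
Qed.

(** The lifts attached to a point are multiplied by its dual section, which makes them vanish at the
    other points of the fibre: each stalk then sees only its own block. *)
Lemma fibre_free : exists n (y : 'I_n -> X) N (e : 'I_N -> B),
  [/\ injective y, forall i, f (y i) = z, forall y', f y' = z -> exists i, y i = y',
      N = (\sum_i multiplicity f (y i))%N &
      [/\ forall i, (0 < multiplicity f (y i))%N,
          exists s, is_unit (germ oV Vz s) /\
            forall b, exists c : 'I_N -> A, phi s * b = \sum_i phi (c i) * e i &
          forall c : 'I_N -> A, \sum_i phi (c i) * e i = 0 -> forall i, c i = 0]].
Proof.
have [n [y [yinj fy yex]]] := fibre_enum.
have [s [s1 s0]] := fibre_dual fy yinj.
pose mu i := projT1 (cid (fibre_basis (fy i))).
pose g i : 'I_(mu i) -> B := projT1 (cid (projT2 (cid (fibre_basis (fy i))))).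
have gb i : basis_mod (kstalk (y i)) (fibre_ideal f (y i)) (fun j => gm (fy i) (g i j)).
  exact: (projT2 (cid (projT2 (cid (fibre_basis (fy i)))))).
have mulE i : multiplicity f (y i) = mu i.
  by rewrite (multiplicity_basis (fy i) (gb i)) card_ord.
pose T := {i : 'I_n & 'I_(mu i)}.
have cardT : #|{: T}| = (\sum_i mu i)%N.
  rewrite card_tagged sumnE big_map big_enum /=.
  by apply: eq_bigr => i _; rewrite card_ord.
pose e (t : T) : B := s (tag t) * g (tag t) (tagged t).
have e_other l (t : T) : tag t != l -> fibre_ideal f (y l) (gm (fy l) (e t)).
  move=> tl; rewrite rmorphM; apply: (idealMr (J_ideal (y l))).
  by apply: s0; rewrite eq_sym.
pose el l j : B := e (Tagged (fun i => 'I_(mu i)) (j : 'I_(mu l))).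
have e_self l j : fibre_ideal f (y l) (gm (fy l) (g l j) - gm (fy l) (el l j)).
  rewrite rmorphM -{1}[gm _ (g l j)]mul1r -mulrBl.
  by apply: (idealMr (J_ideal (y l))); exact: s1.
have sumk l (c : 'I_(mu l) -> k) : fibre_ideal f (y l)
    (\sum_j kstalk (y l) (c j) * gm (fy l) (g l j)
     - \sum_j kstalk (y l) (c j) * gm (fy l) (el l j)).
  rewrite -sumrB; apply: (ideal_sum (J_ideal (y l))) => j _; rewrite -mulrBr.
  by have [_ _ JM] := J_ideal (y l); apply: JM; exact: e_self.
have span b : exists c : T -> k, fibre_secs (b - \sum_t iota (c t) * e t).
  have /= sp i := (gb i).2 (gm (fy i) b).
  pose c i := projT1 (cid (sp i)); have cP i := projT2 (cid (sp i)).
  exists (fun t => c (tag t) (tagged t)); apply: fibre_secs_local => y' fy'.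
  have [l e'] := yex _ fy'; case: y' / e' fy' => fy'.
  rewrite (Prop_irrelevance fy' (fy l)).
  have [_ JD JM] := J_ideal (y l).
  rewrite sum_tagged (bigD1 l) // rmorphB rmorphD opprD addrA.
  apply: JD; last first.
    apply: (idealN (J_ideal (y l))); rewrite rmorph_sum.
    apply: (ideal_sum (J_ideal (y l))) => i il; rewrite rmorph_sum.
    apply: (ideal_sum (J_ideal (y l))) => j _; rewrite rmorphM.
    by apply: JM; exact: e_other.
  apply: (ideal_trans (J_ideal (y l)) _ (cP l)).
  rewrite opprB [X in fibre_ideal _ _ X]addrC subrKA; have := sumk l (c l); congr (fibre_ideal f _ (_ - _)).
  rewrite rmorph_sum; apply: eq_bigr => j _; rewrite [RHS]rmorphM; congr (_ * _).
  exact: esym (gm_iota (fy l) (c l j)).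
have indT l : indep (fstalk f (y l) \o kstalk (f (y l)))
    (ideal_gen (fstalk f (y l) @` @nonunits (stalk (f (y l)))))
    (fun j => gm (fy l) (el l j)).
  move=> c Hc; apply: (gb l).1.
  apply: (ideal_trans (J_ideal (y l)) (sumk l c)).
  move: Hc; congr (ideal_gen _ _); apply: eq_bigr => j _.
  by rewrite -(fstalk_kstalk f).
have free (a : T -> A) : \sum_t phi (a t) * e t = 0 -> forall t, a t = 0.
  move=> ae.
  (* This is the ideal m_w (a_t). Used in [flat_independent], it absorbs the blocks of the other
     points, so each [a t] lies in m_z (a_t), and Nakayama gives a = 0. *)
  pose comb (w : X) (Vw : V w) (al : stalk w) := exists M : T -> stalk w,
    (forall t, nonunits (M t)) /\ al = \sum_t M t * germ oV Vw (a t).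
  have icomb w (Vw : V w) : is_ideal (comb w Vw).
    have [N0 ND NM] := @nonunits_ideal (stalk w) (@stalk_local X w).
    split.
    - by exists (fun=> 0); split=> //; rewrite big1 // => t _; rewrite mul0r.
    - move=> _ _ [M [nM ->]] [M' [nM' ->]]; exists (fun t => M t + M' t).
      split=> [t|]; first exact: ND.
      by rewrite -big_split; apply: eq_bigr => t _; rewrite mulrDl.
    - move=> c _ [M [nM ->]]; exists (fun t => c * M t).
      split=> [t|]; first exact: NM.
      by rewrite mulr_sumr; apply: eq_bigr => t _; rewrite mulrA.
  have acomb t : comb z Vz (germ oV Vz (a t)).
    case: t => l j; pose t0 : T := Tagged (fun i => 'I_(mu i)) j.
    have [rho res] : exists rho : {rmorphism stalk (f (y l)) -> k},
        residue (kstalk (f (y l))) rho.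
      by apply: rational_residue; rewrite fy.
    have := @flat_independent _ _ _ (fstalk f (y l)) _ rho res (@f_flat (y l)) _ _
      (fun j => germ oV (fibre_mem (fy l)) (a (Tagged (fun i => 'I_(mu i)) j))) _
      (indT l) (icomb _ (fibre_mem (fy l))).
    move=> /(_ _ j) H.
    suff : comb (f (y l)) (fibre_mem (fy l)) (germ oV (fibre_mem (fy l)) (a t0)).
      move: (fibre_mem (fy l)); rewrite (fy l) => Vz'.
      by rewrite (Prop_irrelevance Vz' Vz).
    apply: H.
    set G := ideal_gen _.
    have [_ GD GM] : is_ideal G by exact: ideal_genP.
    have iG : is_ideal G by exact: ideal_genP.
    have := congr1 (gm (fy l)) ae; rewrite rmorph0 sum_tagged (bigD1 l) //= rmorphD.
    move/eqP; rewrite addr_eq0 => /eqP e1.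
    rewrite (_ : \sum__ _ = gm (fy l) (\sum_(j < mu l)
        phi (a (Tagged (fun i => 'I_(mu i)) j)) * e (Tagged (fun i => 'I_(mu i)) j))); last first.
      rewrite rmorph_sum; apply: eq_bigr => j' _; rewrite rmorphM.
      by rewrite [X in _ = X * _]fstalk_germ_preim.
    rewrite e1; apply: (idealN iG); rewrite rmorph_sum; apply: (ideal_sum iG) => i il.
    rewrite rmorph_sum; apply: (ideal_sum iG) => j' _; rewrite rmorphM.
    rewrite [X in X * _]fstalk_germ_preim.
    set a' := a _.
    have [m [c [x [nx ->]]]] : fibre_ideal f (y l) (gm (fy l) (e (Tagged (fun i => 'I_(mu i)) j'))).
      exact: e_other.
    rewrite mulr_sumr; apply: (ideal_sum iG) => q _.
    have [x' nx' <-] := nx q.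
    rewrite mulrCA -rmorphM; apply: GM; apply: sub_ideal_gen; apply: imageP.
    exists (fun t => if t == Tagged (fun i => 'I_(mu i)) j' then x' else 0).
    split=> [t|].
      by case: ifP => // _; exact: not_is_unit0.
    rewrite (bigD1 (Tagged (fun i => 'I_(mu i)) j')) //= eqxx mulrC big1 ?addr0 //.
    by move=> t /negbTE ->; rewrite mul0r.
  have /choice [M MP] := acomb.
  have [rho res] := rational_residue rz.
  have nak := nakayama (n := #|{: T}|) (a := fun i => germ oV Vz (a (enum_val i)))
    (M := fun i j => M (enum_val i) (enum_val j)) res.
  move=> t; apply: (germ_inj irrX redX aV (Ux := Vz)); rewrite rmorph0.
  rewrite -(enum_rankK t); apply: nak => [i j|i].
    by apply/(residue_nonunits res); case: (MP (enum_val i)).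
  have [_ ->] := MP (enum_val i).
  by rewrite (reindex (fun i : 'I_#|{: T}| => enum_val i : T)) //=; exact: (onW_bij _ (enum_val_bij _)).
exists n, y, #|{: T}|, (fun i => e (enum_val i)); split=> //.
  by rewrite cardT; apply: eq_bigr => i _; rewrite mulE.
split.
- move=> i; rewrite mulE lt0n; apply/eqP => mu0.
  have [c] := (gb i).2 1; rewrite big1 => [|j _].
    by rewrite subr0 => /fibre_ideal_nonunits; apply; exact: is_unit1.
  by have : (j < 0)%N; [rewrite -[X in (_ < X)%N]mu0; exact: ltn_ord|].
- have [rho [rhoV rhoK]] := exists_residue_sec.
  have [||s' [rs' Hs']] := @nakayama_spanning k A B phi rho #|{: T}| (fun i => e (enum_val i)).
  + exact: f_fin.
  + move=> b; have [c Hc] := span b; exists (fun i => ksec oV (c (enum_val i))).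
    have -> : [set a | rho a = 0] = vanishing_at.
      by apply/seteqP; split=> a /rhoV.
    move: Hc; congr (ideal_gen _ (_ - _)).
    rewrite (reindex (fun i : 'I_#|{: T}| => enum_val i : T)) /=; last exact: (onW_bij _ (enum_val_bij _)).
    by apply: eq_bigr => i _; rewrite [X in _ = X * _]fsec_ksec.
  exists s'; split=> //; apply: contrapT => /rhoV; rewrite rs' => /eqP.
  by rewrite oner_eq0.
- move=> c Hc i; rewrite -(enum_valK i); apply: (free (fun t => c (enum_rank t))).
  rewrite (reindex (fun i : 'I_#|{: T}| => enum_val i : T)) /=; last exact: (onW_bij _ (enum_val_bij _)).
  by rewrite -[RHS]Hc; apply: eq_bigr => j _; rewrite enum_valK.
Qed.

End Fibre.

(** * Degree and openness *)

Lemma field_fitting (A : comNzRingType) (B : comPzRingType)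
    (phi : {rmorphism A -> B}) n (e : 'I_n -> B) (b : B) :
  (forall a : A, a <> 0 -> is_unit a) ->
  (forall j, exists c : 'I_n -> A, b ^+ j = \sum_i phi (c i) * e i) ->
  exists N m (c : nat -> A),
    b ^+ N * (1 - b * \sum_(0 <= i < m) phi (c i) * b ^+ i) = 0.
Proof.
move=> /units_field [K [i [j [iK jK]]]] span.
have [|N _ [m [c H]]] :=
  spanned_fitting (ideal0 B) (iota := phi \o i) (e := e) (b := b).
  move=> l; have [c ->] := span l; exists (j \o c).
  rewrite /= -sumrB big1 // => t _; rewrite /= jK; exact: subrr.
by exists N, m, (i \o c).
Qed.

Lemma affine_common_denominator (X : lrspace) (U : set X) (oU : open U) x
    (Ux : U x) n (c : 'I_n -> stalk x) : affine_sections oU ->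
  exists q (a : 'I_n -> sec U), is_unit (germ oU Ux q) /\
    forall i, c i * germ oU Ux q = germ oU Ux (a i).
Proof.
move=> aU; have /choice [a aP] := fun i => affine_frac aU Ux (c i).
have /choice [q qP] := aP.
exists (\prod_i q i), (fun i => a i * \prod_(j | j != i) q j); split.
  rewrite rmorph_prod; elim/big_ind: _ => [|s t us ut|i _]; first exact: is_unit1.
    exact/is_unitM.
  by case: (qP i).
by move=> i; rewrite (bigD1 i) //= !rmorphM -(proj2 (qP i)) mulrA.
Qed.

Section Variety.
Variables (k : closedFieldType) (X : kscheme k).
Hypotheses (irrX : irreducible_space X) (redX : reduced X).
Variable f : kmor X X.
Hypotheses (f_flat : forall x : X, equational_flat (fstalk f x)).
Hypothesis f_finite : finite_mor f.

Lemma finite_mor_affine (y : X) : exists (V : set X) (oV : open V)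
    (oV' : open (f @^-1` V)),
  [/\ V y, affine_sections oV, affine_sections oV' & module_finite (fsec f oV)].
Proof.
have [V [oV [oV' [Vy aV aV' fin]]]] := f_finite y.
by exists V, oV, oV'; split=> //; exact: affine_openP.
Qed.

Lemma image_generic (eta : X) : generic_point eta -> generic_point (f eta).
Proof.
move=> geta; have [V [oV [oV' [Vf aV aV' _]]]] := finite_mor_affine (f eta).
exact: (flat_generic (oV := oV) (oW := oV') redX irrX redX aV Vf aV').
Qed.

(** The basis [e] found over [z] stays a basis at the generic point: [s] is nonzero, hence
    invertible there, and both stalks arise by inverting sections. *)
Lemma fibre_degree (eta z : X) : generic_point eta -> rational_point z ->
  exists n (y : 'I_n -> X), [/\ injective y, forall i, f (y i) = z,
    forall y', f y' = z -> exists i, y i = y',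
    forall i, (0 < multiplicity f (y i))%N &
    (\sum_i multiplicity f (y i))%N = top_degree eta f /\ (0 < top_degree eta f)%N].
Proof.
move=> geta rz; have gf := image_generic geta.
have [V [oV [oV' [Vz aV aV' fin]]]] := finite_mor_affine z.
have [n [y [N [e [yinj fy yex NE [mu0 [s [us gen]] free]]]]]] :=
  @fibre_free k X f irrX redX f_flat z rz V oV oV' Vz aV aV' fin.
exists n, y.
have Vf : V (f eta) by apply: (generic_point_open gf) => //; exists z.
pose gm : {rmorphism sec (f @^-1` V) -> stalk eta} :=
  germ oV' (Vf : (f @^-1` V) eta).
have gm_fsec a : gm (fsec f oV a) = fstalk f eta (germ oV Vf a).
  exact: fstalk_germ_preim.
have field (a : stalk (f eta)) : a <> 0 -> is_unit a.
  exact: (generic_stalk_field redX aV gf Vf).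
have [v uv] : is_unit (germ oV Vf s).
  apply: field => s0; apply: (unit_germ_neq0 us).
  by apply: (germ_inj irrX redX aV (Ux := Vf)); rewrite s0 rmorph0.
pose D := [set c : stalk eta | exists d : 'I_N -> stalk (f eta),
  c = \sum_i fstalk f eta (d i) * gm (e i)].
have Dgm b : D (gm b).
  have [c cE] := gen b; exists (fun i => v * germ oV Vf (c i)).
  have -> : gm b = fstalk f eta v * gm (fsec f oV s * b).
    by rewrite rmorphM gm_fsec mulrA -rmorphM [v * _]mulrC uv rmorph1 mul1r.
  rewrite cE rmorph_sum mulr_sumr.
  by apply: eq_bigr => i _; rewrite rmorphM gm_fsec rmorphM mulrA.
have DZ (a : stalk (f eta)) c : D c -> D (fstalk f eta a * c).
  move=> [d ->]; exists (fun i => a * d i); rewrite mulr_sumr.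
  by apply: eq_bigr => i _; rewrite rmorphM mulrA.
have DD c c' : D c -> D c' -> D (c + c').
  move=> [d ->] [d' ->]; exists (fun i => d i + d' i); rewrite -big_split.
  by apply: eq_bigr => i _; rewrite rmorphD mulrDl.
have D0 : D 0.
  by exists (fun=> 0); rewrite big1 // => i _; rewrite rmorph0 mul0r.
have span c : D c.
  have [b [t [ut ct]]] := affine_frac aV' (Vf : (f @^-1` V) eta) c.
  (* Division by [gm t] stays in the span [D]: over the field [stalk (f eta)], its inverse is a
     polynomial in [gm t]. *)
  have [|M [m [d]]] := @field_fitting _ _ (fstalk f eta) _ (fun i => gm (e i)) (gm t) field.
    by move=> j; rewrite -rmorphXn; exact: Dgm.
  set g := \sum_(0 <= i < m) _ => tg.
  have tg1 : gm t * g = 1.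
    apply/esym/eqP; rewrite -subr_eq0; apply/eqP.
    by apply: (unit_mulr_eq0 (is_unitX M ut)); rewrite mulrC.
  have -> : c = gm b * g by rewrite -[gm b]ct -mulrA tg1 mulr1.
  rewrite mulr_sumr; elim/big_ind: _ => // i _.
  by rewrite mulrCA; apply: DZ; rewrite -rmorphXn -rmorphM; exact: Dgm.
have topE : top_degree eta f = N.
  apply: (quotient_dim_field (e := fun i => gm (e i)) field span).
  move=> c c0; have [q [a [uq ca]]] := affine_common_denominator Vf c aV.
  have a0 : forall i, a i = 0.
    apply: free; apply: (germ_inj irrX redX aV' (Ux := Vf : (f @^-1` V) eta)).
    rewrite rmorph0 -[RHS](mul0r (fstalk f eta (germ oV Vf q))) -c0 rmorph_sum mulr_suml.
    apply: eq_bigr => i _; rewrite rmorphM [X in X * _]gm_fsec -ca rmorphM.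
    by rewrite mulrAC.
  by move=> i; apply: (unit_mulr_eq0 uq); rewrite ca a0 rmorph0.
split=> //; rewrite topE NE; split=> //; rewrite lt0n; apply/eqP => N0.
have [d] := span 1; rewrite big1; first by move/eqP; rewrite oner_eq0.
move=> i _; have : (i < 0)%N; last by [].
by rewrite -[X in (_ < X)%N]N0 -[X in (_ < X)%N]NE.
Qed.

Lemma preimage_rational (y : X) : rational_point (f y) -> rational_point y.
Proof.
move=> ry; have [V [oV [oV' [Vy aV aV' fin]]]] := finite_mor_affine (f y).
exact: (fibre_rational ry Vy aV' fin).
Qed.

Lemma rational_open_map (U : set X) (z : X) : open U -> rational_point z ->
  (exists y, U y /\ f y = z) -> exists W, [/\ open W, W z &
    forall z', rational_point z' -> W z' -> exists y, U y /\ f y = z'].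
Proof.
move=> oU rz [y [Uy fy]].
have [V [oV [oV' [Vz aV aV' fin]]]] := finite_mor_affine z.
have [_ [_ [N [e [_ _ _ _ [_ [s [us gen]] free]]]]]] :=
  @fibre_free k X f irrX redX f_flat z rz V oV oV' Vz aV aV' fin.
have [b [ub bU]] := affine_basis aV' (fibre_mem Vz fy : (f @^-1` V) y) oU Uy.
(* The exponent is the rank: by the bound in [spanned_fitting], if [b] is nilpotent on a fibre where
   [e] generates, then b^N vanishes there, and with it all coordinates [a i]. *)
have [a aE] := gen (b ^+ N).
have [j uj] : exists j, is_unit (germ oV Vz (a j)).
  apply: contrapT => na.
  have iM := ideal_genP (fsec f oV @` vanishing_at oV Vz).
  have : @fibre_secs k X f z V oV Vz (fsec f oV s * b ^+ N).
    rewrite aE; apply: (ideal_sum iM) => i _; apply: (idealMr iM).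
    apply: sub_ideal_gen; apply: imageP => ui; apply: na.
    by exists i.
  move=> /(fibre_secs_germ oV' fy) /fibre_ideal_nonunits; apply.
  rewrite rmorphM rmorphXn; apply/is_unitM; split; last exact: is_unitX.
  rewrite fstalk_germ_preim; apply: is_unit_rmorph.
  move: us; move: (fibre_mem Vz fy); rewrite fy => Vz'.
  by rewrite (Prop_irrelevance Vz' Vz).
exists (nonvanishing oV (s * a j)); split; first exact: nonvanishing_open.
  by exists Vz; rewrite rmorphM; apply/is_unitM.
move=> z' rz' [Vz']; rewrite rmorphM => /is_unitM [us' uj'].
pose J := @fibre_secs k X f z' V oV Vz'.
have iJ : is_ideal J by exact: ideal_genP.
have [J0 JD JM] := iJ.
have [rho [rhoV rhoK]] := exists_residue_sec rz' oV Vz'.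
have Jphi c x : rho c = 0 -> J (fsec f oV c * x).
  move=> /rhoV vc; apply: (idealMr iJ); apply: sub_ideal_gen; exact: imageP.
(* If [b] is not nilpotent on the fibre of [z'], a prime that avoids it is a point of this fibre in
   [U]; if it is, [uj'] is contradicted. *)
have [[L JL]|nL] := pselect (exists L, J (b ^+ L)); last first.
  have [|p [pp Jp pb]] := prime_avoidance (b := b) iJ.
    by move=> L JL; apply: nL; exists L.
  have [y' [Vy' py']] := affine_prime aV' pp.
  exists y'; split.
    by apply: bU; exists Vy'; apply: contrapT => /py'.
  apply: (fibre_of_prime rz' aV (Vz := Vz') (Vy := Vy')) => c vc uc.
  have /py' : p (fsec f oV c).
    by apply: Jp; apply: sub_ideal_gen; exact: imageP.
  by apply; rewrite fstalk_germ_preim; exact: is_unit_rmorph.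
exfalso.
have rs : rho s != 0 by apply/eqP => /rhoV.
have span x : spanned (ksec oV') J e x.
  have [c cE] := gen x; exists (fun i => (rho s)^-1 * rho (c i)).
  suff : J (ksec oV' (rho s) * (x - \sum_i ksec oV' ((rho s)^-1 * rho (c i)) * e i)).
    apply: unit_ideal => //; exists (ksec oV' (rho s)^-1).
    by rewrite -rmorphM mulfV // rmorph1.
  rewrite mulrBr mulr_sumr.
  under eq_bigr do rewrite mulrA -rmorphM mulrA mulfV // mul1r.
  apply: (ideal_trans iJ (b := fsec f oV s * x - \sum_i fsec f oV (c i) * e i)); last first.
    by rewrite cE subrr.
  rewrite [X in J X](_ : _ = (ksec oV' (rho s) * x - fsec f oV s * x) +
    (\sum_i fsec f oV (c i) * e i - \sum_i ksec oV' (rho (c i)) * e i)); last first.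
    by ring.
  rewrite -sumrB -mulrBl.
  apply: JD; first by rewrite -(fsec_ksec oV) -rmorphB; apply: Jphi; rewrite rmorphB rhoK subrr.
  apply: (ideal_sum iJ) => i _; rewrite -mulrBl -(fsec_ksec oV) -rmorphB; apply: Jphi.
  by rewrite rmorphB rhoK subrr.
have [|N' N'N [m [c]]] := spanned_fitting iJ (e := e) (b := b) (iota := ksec oV').
  by move=> i; exact: span.
set h := \sum_(0 <= i < m) _; rewrite card_ord in N'N => Jbh.
have JN' : J (b ^+ N').
  pose J' := [set c | J (b ^+ N' * c)].
  have iJ' : is_ideal J'.
    split; rewrite /J' /= ?mulr0 //.
      by move=> x x' /=; rewrite mulrDr; exact: JD.
    by move=> x x' /=; rewrite mulrCA; exact: JM.
  have /= := ideal_pow1 L iJ' (Jbh : J' (1 - b * h)).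
  rewrite /J' /= mulrBr mulr1 => JJ; apply: (ideal_trans iJ JJ).
  by apply: JM; rewrite exprMn; exact: (idealMr iJ).
have JN : J (b ^+ N) by rewrite -(subnK N'N) exprD; exact: JM.
have [n [d [x [Jx bE]]]] := JN.
have /choice [mu muP] : forall l, exists mu, rho mu = 0 /\ fsec f oV mu = x l.
  by move=> l; have [mu /rhoV rmu <-] := Jx l; exists mu.
have /choice [al alP] := fun l => gen (d l).
have : a j - \sum_l al l j * mu l = 0.
  apply: (free (fun j => a j - \sum_l al l j * mu l)).
  under eq_bigr do rewrite rmorphB mulrBl.
  rewrite sumrB -aE bE; apply/eqP; rewrite subr_eq0; apply/eqP.
  rewrite mulr_sumr; under [RHS]eq_bigr do rewrite rmorph_sum mulr_suml.
  rewrite exchange_big; apply: eq_bigr => l _.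
  rewrite mulrA alP mulr_suml; apply: eq_bigr => i _.
  by rewrite -(proj2 (muP l)) rmorphM mulrAC.
move=> /eqP; rewrite subr_eq0 => /eqP /(congr1 rho).
rewrite rmorph_sum big1 => [/rhoV //|l _].
by rewrite rmorphM (proj1 (muP l)) mulr0.
Qed.

End Variety.

(** * Multiplicities of iterates *)

Section Iterates.
Variables (k : closedFieldType) (X : kscheme k).
Variable f : kmor X X.
Hypotheses (f_flat : forall x : X, equational_flat (fstalk f x)).
Hypothesis f_finite : finite_mor f.

Lemma iter_kmorE n : iter_kmor f n =1 iter n f.
Proof. by elim: n => [//|n IH] y /=; rewrite -IH. Qed.

Lemma equational_flat_iter n (y : X) : equational_flat (fstalk (iter_kmor f n) y).
Proof.
elim: n => [|n IH]; last first.
  have := equational_flat_comp (phi := fstalk f (iter_kmor f n y))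
    (psi := fstalk (iter_kmor f n) y).
  by apply.
move=> n a b ab; exists 1%N, (fun i _ => b i), (fun=> 1); split=> [i|_].
  by rewrite big_ord1 mulr1.
exact: ab.
Qed.

Lemma iter_basis0 (y : X) : rational_point y ->
  basis_mod (kstalk y) (fibre_ideal (iter_kmor f 0) y) (fun _ : unit => 1 : stalk y).
Proof.
move=> ry; have iN := @nonunits_ideal (stalk y) (@stalk_local X y).
have JE : fibre_ideal (iter_kmor f 0) y = @nonunits (stalk y).
  apply/seteqP; split; first exact: fibre_ideal_nonunits.
  by move=> a na; apply: sub_ideal_gen; exists a.
have sum1 (c : unit -> k) : \sum_t kstalk y (c t) * 1 = kstalk y (c tt).
  by rewrite (bigD1 tt) //= big1 ?addr0 ?mulr1 // => -[].
rewrite JE; split=> [c|b]; last first.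
  by have [c nc] := ry b; exists (fun=> c); rewrite sum1.
rewrite sum1 => nc [] ; apply/eqP; apply: contrapT => /negP c0; apply: nc.
by exists (kstalk y (c tt)^-1); rewrite -rmorphM mulfV // rmorph1.
Qed.

Lemma iter_basisS n (y : X) (w := iter_kmor f n y) m (g : 'I_m -> stalk w)
    (T : finType) (e : T -> stalk y) : rational_point (f w) ->
  basis_mod (kstalk w) (fibre_ideal f w) g ->
  basis_mod (kstalk y) (fibre_ideal (iter_kmor f n) y) e ->
  basis_mod (kstalk y) (fibre_ideal (iter_kmor f n.+1) y)
    (fun ts : 'I_m * T => fstalk (iter_kmor f n) y (g ts.1) * e ts.2).
Proof.
move=> rn bg be; have rw : rational_point w by exact: (preimage_rational f_finite rn).
have [rhoB resB] := rational_residue rw.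
have fk : kstalk w =1 fstalk f w \o kstalk (f w) by move=> c; rewrite -(fstalk_kstalk f).
have resB' : residue (fstalk f w \o kstalk (f w)) rhoB.
  by have [r1 r2] := resB; split=> // c; rewrite -fk r2.
have sk : kstalk y =1 fstalk (iter_kmor f n) y \o (fstalk f w \o kstalk (f w)).
  by move=> c; rewrite -(fstalk_kstalk (iter_kmor f n)) fk.
have := basis_mod_comp resB' (@equational_flat_iter n y)
  (basis_mod_ext fk bg) (basis_mod_ext sk be).
by apply: basis_mod_ext => c; rewrite sk.
Qed.

Lemma exists_fibre_basis (w : X) : rational_point (f w) ->
  exists m (g : 'I_m -> stalk w), basis_mod (kstalk w) (fibre_ideal f w) g.
Proof.
move=> rn; have [V [oV [oV' [Vz aV aV' fin]]]] := finite_mor_affine f_finite (f w).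
have [m [g bg]] := @fibre_basis k X f (f w) rn V oV oV' Vz aV' fin w erefl.
by eexists; eexists; exact: bg.
Qed.

(** [fibre_basis] is applied to the finite morphism [f] only; for its iterates, bases are built as
    products by induction. *)
Lemma exists_iter_basis n (y : X) : rational_point (iter_kmor f n y) ->
  exists (T : finType) (e : T -> stalk y),
    basis_mod (kstalk y) (fibre_ideal (iter_kmor f n) y) e.
Proof.
elim: n y => [|n IH] y rn; first by eexists; eexists; exact: iter_basis0.
have [T [e be]] := IH y (preimage_rational f_finite rn).
have [m [g bg]] := exists_fibre_basis rn.
by eexists; eexists; exact: (iter_basisS rn bg be).
Qed.

Lemma multiplicity_iter0 (y : X) : rational_point y ->
  multiplicity (iter_kmor f 0) y = 1%N.
Proof.
move=> ry; rewrite (multiplicity_basis (f := iter_kmor f 0) ry erefl (iter_basis0 ry)).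
by rewrite card_unit.
Qed.

Lemma multiplicity_iterS n (y : X) : rational_point (iter_kmor f n.+1 y) ->
  multiplicity (iter_kmor f n.+1) y =
    (multiplicity f (iter_kmor f n y) * multiplicity (iter_kmor f n) y)%N.
Proof.
move=> rn; have rw : rational_point (iter_kmor f n y) := preimage_rational f_finite rn.
have [T [e be]] := exists_iter_basis rw.
have [m [g bg]] := @exists_fibre_basis (iter_kmor f n y) rn.
rewrite (multiplicity_basis (f := iter_kmor f n.+1) rn erefl (iter_basisS rn bg be)).
rewrite (multiplicity_basis rw erefl be) (multiplicity_basis (y := iter_kmor f n y) rn erefl bg).
by rewrite card_prod.
Qed.

End Iterates.

(** * Equidistribution of backward orbits *)

Lemma cvg0_lin (R : realType) (c : R) (u v w : nat -> R) :
  u n @[n --> \oo] --> (0 : R) -> v n @[n --> \oo] --> (0 : R) ->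
  (forall n, w n = c * u n + v n) -> w n @[n --> \oo] --> (0 : R).
Proof.
move=> u0 v0 /funext ->; have := cvgD (cvgMl_tmp (a := c) u0) v0.
by rewrite mulr0 addr0 => H; exact: H.
Qed.

Lemma cvg0_cst (R : realType) : (fun=> 0 : R) n @[n --> \oo] --> (0 : R).
Proof. exact: cvg_cst. Qed.

Section BackwardOrbits.
Variables (R : realType) (X : topologicalType) (F : X -> X) (Q : set X).
Variables (m : X -> nat) (d : nat).
Hypothesis d_gt0 : (0 < d)%N.
Hypothesis QF : forall y, Q y <-> Q (F y).
Hypothesis fibreF : forall z, Q z -> exists n (y : 'I_n -> X),
  [/\ injective y, forall i, F (y i) = z,
      forall y', F y' = z -> exists i, y i = y', forall i, (0 < m (y i))%N &
      (\sum_i m (y i))%N = d].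

(* [d^-1 F_* phi]; its iterates at [x] are the integrals of [phi] against
   [d^-i (F^i)^* delta_x]. *)
Definition transfer (phi : X -> R) (z : X) : R :=
  d%:R^-1 * \sum_(y \in F @^-1` [set z]) (m y)%:R * phi y.

Lemma fibre_sum (z : X) n (y : 'I_n -> X) (h : X -> R) : injective y ->
  (forall i, F (y i) = z) -> (forall y', F y' = z -> exists i, y i = y') ->
  \sum_(w \in F @^-1` [set z]) h w = \sum_i h (y i).
Proof.
move=> yinj fy yex.
have -> : F @^-1` [set z] = [set` [seq y i | i <- enum 'I_n]].
  apply/seteqP; split=> [w /= /yex [i <-]|w /= /mapP [i _ ->]]; last exact: fy.
  by apply: map_f; rewrite mem_enum.
rewrite -fsbig_seq; last by rewrite map_inj_uniq ?enum_uniq.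
by rewrite big_map big_enum.
Qed.

(** A transfer is a mean over the fibre with weights at least 1/d; this lower bound is what lets
    [negligible_image] push negligible sets forward. *)
Lemma transferE z : Q z -> exists n (y : 'I_n -> X) (p : 'I_n -> R),
  [/\ forall i, F (y i) = z, forall y', F y' = z -> exists i, y i = y',
      forall i, d%:R^-1 <= p i, \sum_i p i = 1 &
      forall phi, transfer phi z = \sum_i p i * phi (y i)].
Proof.
move=> /fibreF [n [y [yinj fy yex m0 md]]].
have d0 : (0 : R) < d%:R by rewrite ltr0n.
exists n, y, (fun i => (m (y i))%:R / d%:R); split=> //.
- move=> i; rewrite -[leLHS]mul1r ler_wpM2r ?invr_ge0 ?ler0n //.
  by rewrite (ler_nat R 1); exact: m0.
- by rewrite -mulr_suml -natr_sum md mulfV // gt_eqF.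
- move=> phi; rewrite /transfer (fibre_sum _ yinj fy yex) mulr_sumr.
  by apply: eq_bigr => i _; rewrite mulrCA mulrA.
Qed.

Lemma transfer_le phi psi : (forall y, Q y -> phi y <= psi y) ->
  forall z, Q z -> transfer phi z <= transfer psi z.
Proof.
move=> le z Qz; have [n [y [p [fy _ p0 _ tE]]]] := transferE Qz.
rewrite !tE; apply: ler_sum => i _; apply: ler_wpM2l.
  by apply: le_trans (p0 i); rewrite invr_ge0.
by apply: le; apply/QF; rewrite fy.
Qed.

Lemma transfer_lin c phi psi z : Q z ->
  transfer (fun y => c * phi y + psi y) z = c * transfer phi z + transfer psi z.
Proof.
move=> Qz; have [n [y [p [fy _ p0 _ tE]]]] := transferE Qz.
rewrite !tE mulr_sumr -big_split; apply: eq_bigr => i _ /=.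
by rewrite mulrDr mulrCA.
Qed.

Lemma transfer_comp phi z : Q z -> transfer (phi \o F) z = phi z.
Proof.
move=> Qz; have [n [y [p [fy _ p0 p1 tE]]]] := transferE Qz.
rewrite tE -[RHS]mul1r -p1 mulr_suml; apply: eq_bigr => i _.
by rewrite /= fy.
Qed.

Lemma iter_transfer_le i phi psi : (forall y, Q y -> phi y <= psi y) ->
  forall z, Q z -> iter i transfer phi z <= iter i transfer psi z.
Proof. by move=> le; elim: i => [|i IH] //=; exact: transfer_le. Qed.

Lemma iter_transfer_eq i phi psi z : (forall y, Q y -> phi y = psi y) -> Q z ->
  iter i transfer phi z = iter i transfer psi z.
Proof.
move=> e Qz; apply/eqP; rewrite eq_le !iter_transfer_le // => y Qy;
  by rewrite e.
Qed.

Lemma transfer_eq phi psi z : (forall y, Q y -> phi y = psi y) -> Q z ->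
  transfer phi z = transfer psi z.
Proof. exact: (@iter_transfer_eq 1). Qed.

Lemma iter_transfer_lin i c phi psi z : Q z ->
  iter i transfer (fun y => c * phi y + psi y) z =
  c * iter i transfer phi z + iter i transfer psi z.
Proof.
elim: i z => [//|i IH] z Qz /=; rewrite -transfer_lin //.
exact: transfer_eq.
Qed.

Lemma iter_transfer_cst i c z : Q z -> iter i transfer (fun=> c) z = c.
Proof.
elim: i z => [//|i IH] z Qz /=.
transitivity (transfer ((fun=> c) \o F) z); last exact: (transfer_comp (fun=> c)).
by apply: transfer_eq => // y /IH.
Qed.

Lemma iter_transfer_orbit i phi psi z : Q z ->
  (forall y, iter i F y = z -> phi y = psi y) ->
  iter i transfer phi z = iter i transfer psi z.
Proof.
elim: i z => [|i IH] z Qz e; first exact: e.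
rewrite /=; have [n [y [p [fy _ _ _ tE]]]] := transferE Qz.
rewrite !tE; apply: eq_bigr => j _; congr (_ * _); apply: IH.
  by apply/QF; rewrite fy.
by move=> w wy; apply: e; rewrite /= wy.
Qed.

Variables (x : X) (Qx : Q x) (a b : nat -> nat).
Hypothesis ab : forall n, (a n < b n)%N.
Hypothesis abV : ((b n - a n)%:R : R)^-1 @[n --> \oo] --> (0 : R).

(* The integral of [phi] against the [n]-th averaged pullback of [delta_x]. *)
Definition average (phi : X -> R) (n : nat) : R :=
  (b n - a n)%:R^-1 * \sum_(a n <= i < b n) iter i transfer phi x.

Let N_gt0 n : (0 : R) < (b n - a n)%:R.
Proof. by rewrite ltr0n subn_gt0. Qed.

Lemma average_le phi psi n : (forall y, Q y -> phi y <= psi y) ->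
  average phi n <= average psi n.
Proof.
move=> le; rewrite ler_pM2l ?invr_gt0 //; apply: ler_sum => i _.
exact: iter_transfer_le.
Qed.

Lemma average_eq phi psi n : (forall y, Q y -> phi y = psi y) ->
  average phi n = average psi n.
Proof.
by move=> e; apply/eqP; rewrite eq_le !average_le // => y /e ->.
Qed.

Lemma average_lin c phi psi n :
  average (fun y => c * phi y + psi y) n = c * average phi n + average psi n.
Proof.
rewrite /average; under eq_bigr do rewrite iter_transfer_lin //.
by rewrite big_split /= mulrDr -mulr_sumr mulrCA.
Qed.

Lemma averageD phi psi n :
  average (fun y => phi y + psi y) n = average phi n + average psi n.
Proof.
rewrite -[average phi n]mul1r -average_lin; congr average.
by apply/funext => y; rewrite mul1r.
Qed.

Lemma averageB phi psi n :
  average (fun y => phi y - psi y) n = average phi n - average psi n.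
Proof.
rewrite addrC -mulN1r -average_lin; congr average.
by apply/funext => y; rewrite mulN1r addrC.
Qed.

Lemma average_cst c n : average (fun=> c) n = c.
Proof.
rewrite /average; under eq_bigr do rewrite iter_transfer_cst //.
by rewrite sumr_const_nat -[c *+ _]mulr_natl mulKf // gt_eqF.
Qed.

Lemma average_sum (I : Type) (r : seq I) (phi : I -> X -> R) n :
  average (fun y => \sum_(i <- r) phi i y) n = \sum_(i <- r) average (phi i) n.
Proof.
elim: r => [|i r IH].
  by rewrite big_nil -[RHS](average_cst 0 n); congr average; apply/funext => y; rewrite big_nil.
rewrite big_cons -IH -averageD; congr average.
by apply/funext => y; rewrite big_cons.
Qed.

(** The index sets being intervals, a shift by one changes only two terms: the sum telescopes, with
    an error of at most 1 / #I_n. *)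
Lemma average_transfer phi : (forall y, Q y -> 0 <= phi y <= 1) ->
  average (transfer phi) n - average phi n @[n --> \oo] --> (0 : R).
Proof.
move=> phi01.
have L01 i : 0 <= iter i transfer phi x <= 1.
  apply/andP; split.
    rewrite -[leLHS](iter_transfer_cst i 0 Qx); apply: iter_transfer_le => // y Qy.
    by case/andP: (phi01 y Qy).
  rewrite -[leRHS](iter_transfer_cst i 1 Qx); apply: iter_transfer_le => // y Qy.
  by case/andP: (phi01 y Qy).
have E n : average (transfer phi) n - average phi n =
    (b n - a n)%:R^-1 * (iter (b n) transfer phi x - iter (a n) transfer phi x).
  rewrite -mulrBr -sumrB; congr (_ * _).
  under eq_bigr do rewrite -iterSr.
  by rewrite telescope_sumr // ltnW.
apply: norm_cvg0.
apply: (@squeeze_cvgr _ _ _ _ (fun=> 0) (fun n => (b n - a n)%:R^-1)) => //; last exact: cvg_cst.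
apply: nearW => n; rewrite normr_ge0 /= E normrM ger0_norm ?invr_ge0 //.
rewrite -[leRHS]mulr1 ler_wpM2l ?invr_ge0 // ler_norml.
by have /andP [? ?] := L01 (a n); have /andP [? ?] := L01 (b n); apply/andP; split; lra.
Qed.

Definition negligible (S : set X) := average \1_S n @[n --> \oo] --> (0 : R).

Lemma average_indic_ge0 S n : 0 <= average \1_S n.
Proof. by rewrite -(average_cst 0 n); apply: average_le => y _; rewrite indicE. Qed.

Lemma negligible_le (phi : X -> R) S : average phi n @[n --> \oo] --> (0 : R) ->
  (forall y, Q y -> \1_S y <= phi y) -> negligible S.
Proof.
move=> phi0 le.
apply: (@squeeze_cvgr _ _ _ _ (fun=> 0) (average phi)) => //; last exact: cvg_cst.
by apply: nearW => n; rewrite average_indic_ge0 average_le.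
Qed.

Lemma indic_le (S T : set X) y : (S y -> T y) -> \1_S y <= \1_T y :> R.
Proof.
move=> ST; rewrite !indicE ler_nat; have [Sy|Sy] := boolP (y \in S) => //.
by rewrite (mem_set (ST (set_mem Sy))).
Qed.

Lemma negligible_sub (S T : set X) : (forall y, Q y -> S y -> T y) -> negligible T ->
  negligible S.
Proof.
by move=> ST /negligible_le; apply => y Qy; apply: indic_le; exact: ST.
Qed.

Lemma negligibleU S T : negligible S -> negligible T -> negligible (S `|` T).
Proof.
move=> nS nT; apply: (@negligible_le (fun y => \1_S y + \1_T y)).
  by apply: (cvg0_lin (c := 1) nS nT) => n; rewrite averageD mul1r.
move=> y _; rewrite !indicE in_setU -natrD ler_nat.
by case: (y \in S); case: (y \in T).
Qed.

Lemma indic01 (S : set X) y : 0 <= (\1_S y : R) <= 1.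
Proof. by rewrite indicE; case: (y \in S); rewrite ?lexx ler01. Qed.

(** On [Q], [transfer] undoes composition with [F], so replacing [S] by its preimage amounts to a
    shift of the interval. *)
Lemma average_preimage S :
  average \1_S n - average \1_(F @^-1` S) n @[n --> \oo] --> (0 : R).
Proof.
have H : average (transfer \1_(F @^-1` S)) n - average \1_(F @^-1` S) n
    @[n --> \oo] --> (0 : R).
  by apply: average_transfer => y _; exact: indic01.
apply: (cvg0_lin (c := 1) H (@cvg0_cst R)) => n; rewrite mul1r addr0.
congr (_ - _); apply: average_eq => y Qy.
by rewrite -(transfer_comp \1_S).
Qed.

Lemma average_preimage_iter p S :
  average \1_S n - average \1_(iter p F @^-1` S) n @[n --> \oo] --> (0 : R).
Proof.
elim: p => [|p IH].
  by apply: (cvg0_lin (c := 1) (@cvg0_cst R) (@cvg0_cst R)) => n; rewrite subrr mulr0 addr0.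
apply: (cvg0_lin (c := 1) IH (average_preimage (iter p F @^-1` S))) => n.
rewrite mul1r subrKA; congr (_ - average _ _); congr (\1_ _).
by apply/funext => y; rewrite /preimage /= -iterS iterSr.
Qed.

Lemma negligible_diff_preimage p S : S `<=` iter p F @^-1` S ->
  negligible (iter p F @^-1` S `\` S).
Proof.
move=> SS.
apply: (cvg0_lin (c := -1) (average_preimage_iter p S) (@cvg0_cst R)) => n.
rewrite addr0 mulN1r opprB -averageB; congr average.
apply/funext => y; rewrite !indicE in_setD.
have [Sy|Sy] := boolP (y \in S); last by rewrite subr0 andbT.
by rewrite (mem_set (SS y (set_mem Sy))) subrr.
Qed.

Lemma negligible_image p (S T : set X) :
  (forall z, Q z -> S z -> exists y, T y /\ iter p F y = z) ->
  negligible T -> negligible S.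
Proof.
elim: p S T => [|p IH] S T ST nT.
  by apply: negligible_sub nT => y Qy Sy; have [w [Tw <-]] := ST y Qy Sy.
pose T1 := [set z | exists y, T y /\ iter p F y = z].
have nT1 : negligible T1 by apply: IH nT.
(* A point of [S] has a preimage in [T1], of weight at least 1/d: hence the factor d. *)
apply: (@negligible_le (fun y => d%:R * transfer \1_T1 y)).
  have H : average (transfer \1_T1) n @[n --> \oo] --> (0 : R).
    have H1 := average_transfer (fun y _ => indic01 T1 y).
    by apply: (cvg0_lin (c := 1) H1 nT1) => n; rewrite mul1r subrK.
  apply: (cvg0_lin (c := d%:R) H (@cvg0_cst R)) => n.
  rewrite -(average_cst 0 n) -average_lin.
  by congr average; apply/funext => y; rewrite addr0.
move=> z Qz; have d0 : (0 : R) < d%:R by rewrite ltr0n.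
have [n [y [pr [fy yex p0 _ tE]]]] := transferE Qz.
have pr0 i : 0 <= pr i by apply: le_trans (p0 i); rewrite invr_ge0.
rewrite indicE tE; have [Sz|_] := boolP (z \in S); last first.
  by apply: mulr_ge0 => //; apply: sumr_ge0 => i _; rewrite mulr_ge0 // indicE.
have [w [Tw wz]] := ST z Qz (set_mem Sz).
have [i yi] := yex (iter p F w) wz.
rewrite (bigD1 i) //= indicE mem_set; last by rewrite yi; exists w.
rewrite mulrDr -[leLHS]addr0 lerD //.
  by rewrite mulr1 -ler_pdivrMl // mulr1.
by apply: mulr_ge0 => //; apply: sumr_ge0 => j _; rewrite mulr_ge0 // indicE.
Qed.

Lemma cvg0_sum (I : Type) (r : seq I) (u : I -> nat -> R) :
  (forall i, u i n @[n --> \oo] --> (0 : R)) ->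
  \sum_(i <- r) u i n @[n --> \oo] --> (0 : R).
Proof.
move=> u0; elim: r => [|i r IH].
  by apply: (cvg0_lin (c := 1) (@cvg0_cst R) (@cvg0_cst R)) => n; rewrite big_nil mulr0 addr0.
by apply: (cvg0_lin (c := 1) (u0 i) IH) => n; rewrite big_cons mul1r.
Qed.

(* Otherwise the sets [F^-i S] would be almost disjoint, of the same mass. *)
Lemma not_negligible_return S : ~ negligible S ->
  exists i j, (i < j)%N /\
    ~ negligible (iter i F @^-1` S `&` iter j F @^-1` S).
Proof.
move=> nS; apply: contrapT => nij; apply: nS.
have {}nij i j : (i < j)%N -> negligible (iter i F @^-1` S `&` iter j F @^-1` S).
  by move=> ij; apply: contrapT => H; apply: nij; exists i, j.
pose P i := iter i F @^-1` S.
(* Average of a pointwise bound: the number of [P j], j < K, that contain a point is at most 1 plus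
   the number of pairs i < j for which both do. *)
have key K n : K%:R * average \1_S n <=
    1 + (\sum_(0 <= j < K) (average \1_S n - average \1_(P j) n) +
         \sum_(0 <= j < K) \sum_(0 <= i < j) average \1_(P i `&` P j) n).
  rewrite sumrB sumr_const_nat subn0 -(mulr_natl (average \1_S n)).
  suff : \sum_(0 <= j < K) average \1_(P j) n <=
      1 + \sum_(0 <= j < K) \sum_(0 <= i < j) average \1_(P i `&` P j) n.
    set s1 := \sum_(0 <= j < K) _; set s2 := \sum_(0 <= j < K) _;
      set s3 := _ * average _ _; lra.
  rewrite -(average_cst 1 n).
  under [X in _ <= _ + X]eq_bigr do rewrite -average_sum.
  rewrite -!average_sum -averageD; apply: average_le => y _.
  elim: K => [|K IH]; first by rewrite !big_geq // addr0.
  rewrite !big_nat_recr //=.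
  have [PK|PK] := boolP (y \in P K).
    have -> : \sum_(0 <= i < K) \1_(P i `&` P K) y = \sum_(0 <= i < K) \1_(P i) y :> R.
      by apply: eq_bigr => i _; rewrite !indicE in_setI PK andbT.
    rewrite indicE PK addrC lerD2l // lerDr sumr_ge0 // => i _.
    by rewrite sumr_ge0 // => j _; rewrite indicE.
  rewrite {1}[\1_(P K) y]indicE (negbTE PK) addr0 (le_trans IH) // lerD2l lerDl.
  by rewrite sumr_ge0 // => j _; rewrite indicE.
apply/cvgr0Pnorm_lt => e e0.
(* K times the average is at most 1 plus an error tending to 0, hence eventually less than 2. *)
have [K Ke] : exists K : nat, 2 / e < K%:R by exists (Num.bound (2 / e)); apply: archi_boundP; rewrite divr_ge0 // ltW.
have K0 : (0 : R) < K%:R by apply: lt_trans Ke; rewrite divr_gt0.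
have u0 : \sum_(0 <= j < K) (average \1_S n - average \1_(P j) n) +
         \sum_(0 <= j < K) \sum_(0 <= i < j) average \1_(P i `&` P j) n @[n --> \oo] --> (0 : R).
  have H1 : \sum_(0 <= j < K) (average \1_S n - average \1_(P j) n) @[n --> \oo] --> (0 : R).
    by apply: cvg0_sum => j; exact: average_preimage_iter.
  have H2 : \sum_(0 <= j < K) \sum_(i < j) average \1_(P i `&` P j) n @[n --> \oo] --> (0 : R).
    by apply: cvg0_sum => j; apply: cvg0_sum => i; apply: nij.
  apply: (cvg0_lin (c := 1) H1 H2) => n; rewrite mul1r; congr (_ + _).
  by apply: eq_bigr => j _; rewrite big_mkord.
near=> n.
rewrite ger0_norm ?average_indic_ge0 // -(ltr_pM2l K0).
apply: (le_lt_trans (key K n)).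
apply: (@lt_trans _ _ 2).
  rewrite -[2]/(1 + 1) ltrD2l.
  apply: le_lt_trans (ler_norm _) _; near: n.
  by move/cvgr0Pnorm_lt: u0; apply.
by rewrite -ltr_pdivrMr.
Unshelve. all: by end_near.
Qed.

Lemma negligible_off_orbit S : (forall i y, iter i F y = x -> ~ S y) ->
  negligible S.
Proof.
move=> nS; apply: (cvg0_lin (c := 1) (@cvg0_cst R) (@cvg0_cst R)) => n.
rewrite mulr0 addr0 /average big1 ?mulr0 // => i _.
rewrite -(iter_transfer_cst i 0 Qx); apply: iter_transfer_orbit => // y yx.
by rewrite indicE memNset //; exact: (nS i y).
Qed.

Lemma orbit_mem i y : Q (iter i F y) -> Q y.
Proof. by elim: i => [//|i IH] /= Qi; apply: IH; exact: (QF _).2. Qed.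

Lemma iter_mem i y : Q y -> Q (iter i F y).
Proof. by move=> Qy; elim: i => [//|i IH] /=; exact: (QF _).1. Qed.

(** * Negligibility of proper closed sets *)

Hypotheses (noethX : noetherian_space X) (irrX : irreducible_space X).
Hypothesis F_cont : continuous F.
Hypothesis F_dom : forall Z, closed Z -> F @^-1` Z = setT -> Z = setT.
Hypothesis F_open : forall U z, open U -> Q z -> (exists y, U y /\ F y = z) ->
  exists W, [/\ open W, W z &
    forall z', Q z' -> W z' -> exists y, U y /\ F y = z'].
Hypothesis orbit_dense : dense (\bigcup_i (iter i F @^-1` [set x])).

Lemma iter_continuous i : continuous (iter i F).
Proof.
elim: i => [|i IH] y /=; first exact: cvg_id.
by apply: (@continuous_comp _ _ _ (iter i F) F); [exact: IH|exact: F_cont].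
Qed.

Lemma preimage_closed i Z : closed Z -> closed (iter i F @^-1` Z).
Proof. by move=> cZ; apply: closed_comp => // y _; exact: iter_continuous. Qed.

Lemma preimage_proper i Z : closed Z -> Z <> setT -> iter i F @^-1` Z <> setT.
Proof.
move=> cZ nZ; elim: i => [//|i IH] e; apply: IH; apply: F_dom.
  exact: preimage_closed.
by rewrite -e; apply/funext => y; rewrite /preimage /= -iterS iterSr.
Qed.

Lemma iter_open i U z : open U -> Q z -> (exists y, U y /\ iter i F y = z) ->
  exists W, [/\ open W, W z &
    forall z', Q z' -> W z' -> exists y, U y /\ iter i F y = z'].
Proof.
elim: i U z => [|i IH] U z oU Qz [y [Uy yz]].
  by exists U; split=> // [|z' _ Uz']; [rewrite -yz|exists z'].
have Qi : Q (iter i F y) by apply/QF; rewrite -iterS yz.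
have [W [oW Wi HW]] := IH U (iter i F y) oU Qi (ex_intro _ y (conj Uy erefl)).
have [|W' [oW' W'z HW']] := F_open oW Qz; first by exists (iter i F y).
exists W'; split=> // z' Qz' /(HW' z' Qz') [v [Wv vz']].
have [|w [Uw wv]] := HW v _ Wv; first by apply/QF; rewrite vz'.
by exists w; split=> //=; rewrite wv.
Qed.

(* [Z] is chosen minimal; it then returns into itself, and since [F] is open
   the part of [F^-p Z] outside [Z] is empty: a proper closed set containing
   [Z] is totally invariant and contains the whole backward orbit. *)
Lemma negligible_closed Z : closed Z -> Z <> setT -> negligible Z.
Proof.
move=> cZ nZ; apply: contrapT => negZ.
have [] := noethX (P := [set Z | [/\ closed Z, Z <> setT & ~ negligible Z]]).
- by move=> W [].
- by exists Z.
move=> {cZ nZ negZ} {}Z [[cZ nZ negZ] Zmin].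
have {Zmin} small W : closed W -> W `<=` Z -> W <> Z -> negligible W.
  move=> cW WZ WneZ; apply: contrapT => nW; apply: WneZ; apply: Zmin => //.
  split=> // WT; apply: nZ; apply/seteqP; split=> // y _; apply: WZ.
  by rewrite WT.
have [i [j [ij nij]]] := not_negligible_return negZ.
pose p := (j - i)%N; have p0 : (0 < p)%N by rewrite subn_gt0.
(* Otherwise the intersection of [Z] and F^-p Z is a smaller closed set, hence negligible, and so is
   its preimage under F^i, which is the set in [nij]. *)
have Zp : Z `<=` iter p F @^-1` Z.
  suff ZpZ : Z `&` iter p F @^-1` Z = Z by move=> y; rewrite -{1}ZpZ => -[].
  apply: contrapT => ZpZ; apply: nij.
  have : negligible (Z `&` iter p F @^-1` Z).
    have cZp : closed (Z `&` iter p F @^-1` Z).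
      by apply: closedI => //; exact: preimage_closed.
    by apply: (small _ cZp) => // y [].
  move=> nZp.
  have := average_preimage_iter i (Z `&` iter p F @^-1` Z).
  move=> H; apply: (cvg0_lin (c := -1) H nZp) => n.
  rewrite mulN1r opprB subrK; congr average; congr (\1_ _).
  by rewrite preimage_setI; congr (_ `&` _); apply/funext => y;
    rewrite /preimage /= -iterD subnK // ltnW.
have negE := negligible_diff_preimage Zp.
have oZ : open (~` Z) by exact: closed_openC.
(* Let [O] be the union of the open sets whose points in [Q] are images under F^p of points off [Z].
   If [y] is off [Z], then [Z] minus [O] misses F^p y, so it is smaller and negligible; in [Q], the
   rest of [Z] is in the image of the negligible F^-p Z minus [Z]. Thus [Z] would be negligible. *)
have Einv y : Q y -> Z (iter p F y) -> Z y.
  move=> Qy Zpy; apply: contrapT => nZy; apply: negZ.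
  pose good W := open W /\ forall z', Q z' -> W z' -> exists y, ~ Z y /\ iter p F y = z'.
  pose O := \bigcup_(W in good) W.
  have oO : open O by apply: bigcup_open => W [].
  have negW : negligible (Z `\` O).
    apply: small; [|exact: subDsetl|].
      by rewrite setDE; apply: closedI => //; exact: (open_closedC oO).
    move=> e; have : (Z `\` O) (iter p F y) by rewrite e.
    move=> [_]; apply.
    have [|W [oW Wy HW]] := iter_open (z := iter p F y) (i := p) oZ (iter_mem p Qy).
      by exists y.
    by exists W.
  have negI : negligible [set z | [/\ Q z, Z z & O z]].
    apply: (negligible_image _ negE (p := p)) => z Qz [_ Zz [W [oW HW] Wz]].
    have [w [nZw wz]] := HW z Qz Wz.
    by exists w; split=> //; split=> //=; rewrite /preimage /= wz.
  apply: negligible_sub (negligibleU negW negI) => z Qz Zz.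
  by have [Oz|Oz] := pselect (O z); [right|left].
have Einv2 y : Z y -> Z (iter p F y) by exact: Zp.
(* On [Q], [Z] is invariant under F^p; the union of p successive preimages is invariant under
   [F]. *)
pose T := \bigcup_(l in [set l | (l < p)%N]) (iter l F @^-1` Z).
have cT n : closed (\bigcup_(l in [set l | (l < n)%N]) (iter l F @^-1` Z)) /\
    \bigcup_(l in [set l | (l < n)%N]) (iter l F @^-1` Z) <> setT.
  elim: n => [|n [cn nn]].
    have -> : \bigcup_(l in [set l | (l < 0)%N]) (iter l F @^-1` Z) = set0.
      by apply/seteqP; split=> // y [].
    split; first exact: closed0.
    by have [[y _] _] := irrX; move=> /seteqP [_ /(_ y I)].
  have -> : \bigcup_(l in [set l | (l < n.+1)%N]) (iter l F @^-1` Z) =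
     \bigcup_(l in [set l | (l < n)%N]) (iter l F @^-1` Z) `|` iter n F @^-1` Z.
    apply/seteqP; split=> y.
      move=> [l /=]; rewrite ltnS leq_eqVlt => /predU1P [->|ln] Zl; first by right.
      by left; exists l.
    by move=> [[l /= ln Zl]|Zn]; [exists l => //=; exact: ltnW|exists n => /=].
  split; first by apply: closedU => //; exact: preimage_closed.
  move=> e; have [_ irr] := irrX; have [//|] := irr _ _ cn (preimage_closed (i := n) cZ) e.
  exact: preimage_proper.
have [cTp nT] := cT p.
have Tinv y : Q y -> T y <-> T (F y).
  move=> Qy; split=> -[l /= lp Zl].
    case: l lp Zl => [|l] lp Zl; last by exists l => /=; [exact: ltnW|rewrite /preimage /= -iterSr].
    by exists p.-1; rewrite /= ?prednK // /preimage /= -iterSr prednK //; exact: Einv2.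
  move: lp; rewrite leq_eqVlt => /predU1P [lp|lp].
    exists 0%N => //=; apply: Einv => //; rewrite -lp iterSr; exact: Zl.
  by exists l.+1 => //; rewrite /preimage /= -iterS iterSr.
have Tinv_iter l y : Q y -> T y <-> T (iter l F y).
  elim: l y => [//|l IH] y Qy; rewrite iterSr -IH; last exact: (QF _).1.
  exact: Tinv.
(* Otherwise the backward orbit misses [Z], and the averages of its indicator vanish. *)
have Tx : T x.
  apply: contrapT => nTx; apply: negZ; apply: negligible_off_orbit => l y yx Zy.
  have Qy : Q y by apply: (@orbit_mem l); rewrite yx.
  by apply: nTx; rewrite -yx; apply: (Tinv_iter l y Qy).1; exists 0%N.
apply: nT; apply/seteqP; split=> // y _; apply: contrapT => nTy.
have [|w [nTw [l _ wx]]] := orbit_dense (O := ~` T) _ (closed_openC cTp).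
  by exists y.
have Qw : Q w by apply: (@orbit_mem l); rewrite wx.
by apply: nTw; apply: (Tinv_iter l w Qw).2; rewrite wx.
Qed.

End BackwardOrbits.

(** * Radon measures *)

Lemma radon_cvg (T : ptopologicalType) (R : realType) (u : nat -> radon T R)
    (mu : radon T R) :
  (forall phi : T -> R, continuous phi ->
    radon_int (u n) phi @[n --> \oo] --> radon_int mu phi) ->
  u n @[n --> \oo] --> mu.
Proof.
move=> H.
have : {ptws, (fun n => radon_eval (u n)) @ \oo --> radon_eval mu}.
  (* [pointwise_cvgP] asks for a topology on the index type: any will do. *)
  pose U : topologicalType := initial_topology (fun _ : continuousType T R => 0 : R).
  have [_] := @pointwise_cvgP U R
    ((fun n => radon_eval (u n)) @ \oo) (radon_eval mu) _.
  by apply=> phi; apply: H; exact: cts_fun.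
move=> cv A /= [_ [[B oB <-] Bmu] BA].
have /cv /= : nbhs (radon_eval mu) B by rewrite nbhsE; exists B.
by rewrite /fmap /=; apply: filterS => n Bn; apply: BA.
Qed.

Section RadonIntegral.
Variables (T : ptopologicalType) (R : realType).
Implicit Types (mu nu : radon T R) (phi : T -> R).

(** Boundedness gives integrability against a finite measure; on |X| it is obtained by noetherian
    induction in [cspace_continuous_bounded]. *)
Definition bounded_continuous phi :=
  continuous phi /\ exists M : R, forall y, `|phi y| <= M.

Lemma continuous_borel phi : continuous phi ->
  measurable_fun (setT : set (borel T)) (phi : borel T -> R).
Proof.
move=> /continuousP cphi; apply: (measurability _ (RGenOpens.measurableE R)).
move=> _ [_ [c [d ->]] <-]; rewrite setTI; apply: sub_sigma_algebra.
exact/cphi/interval_open.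
Qed.

Lemma radon_integrable mu phi : bounded_continuous phi ->
  mu.-integrable (setT : set (borel T)) (EFin \o (phi : borel T -> R)).
Proof.
move=> [cphi [M phiM]]; apply: measurable_bounded_integrable => //.
- by rewrite ltey_eq fin_num_measure.
- exact: continuous_borel.
- exists M; split; first exact: num_real.
  by move=> N MN y _; apply: (le_trans (phiM y)); exact: ltW.
Qed.

Lemma radon_intD mu nu phi : bounded_continuous phi ->
  radon_int (radonD mu nu) phi = radon_int mu phi + radon_int nu phi.
Proof.
move=> bphi; have [cphi _] := bphi.
have imu := radon_integrable mu bphi; have inu := radon_integrable nu bphi.
rewrite /radon_int /Rintegral /=.
rewrite (integral_measure_add measurableT imu inu).
by rewrite fineD //; exact: integrable_fin_num.
Qed.

Lemma radon_int0 phi : radon_int (radon0 : radon T R) phi = 0.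
Proof. by rewrite /radon_int /Rintegral /= integral_measure_zero. Qed.

Lemma radon_intZ (r : {nonneg R}) mu phi : bounded_continuous phi ->
  radon_int (radonZ r mu) phi = r%:num * radon_int mu phi.
Proof.
move=> bphi; have [cphi _] := bphi; have imu := radon_integrable mu bphi.
have mphi : measurable_fun (setT : set (borel T)) (EFin \o (phi : borel T -> R)).
  by apply/measurable_EFinP; exact: (continuous_borel cphi).
rewrite /radon_int /Rintegral /= integralE.
rewrite ge0_integral_mscale //; last exact: measurable_funepos.
rewrite ge0_integral_mscale //; last exact: measurable_funeneg.
rewrite [in RHS]integralE.
have fp : (\int[mu]_(y in setT) ((EFin \o (phi : borel T -> R))^\+ y) \is a fin_num)%E.
  exact: integrable_pos_fin_num.
have fn : (\int[mu]_(y in setT) ((EFin \o (phi : borel T -> R))^\- y) \is a fin_num)%E.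
  exact: integrable_neg_fin_num.
move: fp fn; rewrite /comp => fp fn.
by rewrite -(fineK fp) -(fineK fn) -!EFinM -!EFinB /= mulrBr.
Qed.

Import HBNNSimple.

(* The integrand need not be measurable: [[set x]] is. *)
Lemma radon_int_dirac (hT : hausdorff_space T) (x : T) phi :
  radon_int (radon_dirac R hT x) phi = phi x.
Proof.
have mx : measurable ([set x] : set (borel T)).
  rewrite -[X in measurable X]setCK; apply: measurableC; apply: sub_sigma_algebra.
  by apply: closed_openC; apply: (compact_closed hT); exact: compact_set1.
(* The integral is a supremum over simple functions below [g]: each integrates to its value at [x],
   and the one equal to [g x] at [x] and 0 elsewhere attains the bound. *)
have nn (g : borel T -> \bar R) (r : R) : (forall y, 0 <= g y)%E -> g x = r%:E ->
    (\int[@dirac _ (borel T) x R]_(y in setT) g y = r%:E)%E.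
  move=> g0 gx; have r0 : 0 <= r by rewrite -lee_fin -gx.
  rewrite ge0_integralTE //.
  have sint (h : {nnsfun (borel T) >-> R}) : sintegral (@dirac _ (borel T) x R) h = (h x)%:E.
    rewrite -integralT_nnsfun integral_dirac //; last exact/measurable_EFinP.
    by rewrite diracE in_setT mul1e.
  apply/eqP; rewrite eq_le; apply/andP; split.
    apply: ge_ereal_sup => _ [h /= hg <-]; rewrite sint -gx; exact: hg.
  apply: ereal_sup_ubound; exists (scale_nnsfun (indic_nnsfun R mx) r0).
    move=> y; rewrite /= /mindic indicE; have [|_] := boolP (y \in [set x]).
      by move=> /set_mem ->; rewrite mulr1 gx.
    by rewrite mulr0.
  by rewrite sint /= /mindic indicE mem_set // mulr1.
rewrite /radon_int /Rintegral /= integralE.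
rewrite (nn _ (Num.max (phi x) 0)); [|by []|by rewrite funeposE /= EFin_max].
rewrite (nn _ (Num.max (- phi x) 0)); [|by []|by rewrite funenegE /= EFin_max].
rewrite -EFinB /=; case: (leP (phi x) 0) => h; case: (leP (- phi x) 0) => h'; lra.
Qed.

Lemma radon_int_sum (I : Type) (r : seq I) (mu : I -> radon T R) phi :
  bounded_continuous phi ->
  radon_int (\big[radonD/radon0]_(i <- r) mu i) phi = \sum_(i <- r) radon_int (mu i) phi.
Proof.
move=> bphi; elim: r => [|i r IH]; first by rewrite !big_nil radon_int0.
by rewrite !big_cons radon_intD // IH.
Qed.

End RadonIntegral.

(** * Convergence of measures *)

Section ConstructibleTopology.
Variables (k : fieldType) (X : kscheme k) (x0 : X).

(* On the closure of [z], constructible neighbourhoods of [z] contain Zariski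
   ones. *)
Lemma cspace_nbhs (Z : set X) (z : X) (O : set (cspace x0)) :
  Z `<=` closure [set z] -> open O -> O z -> nbhs z [set y | Z y -> O y].
Proof.
move=> Zz [D Dsub <-] [C DC Cz].
suff : nbhs z [set y | Z y -> C y].
  by apply: filterS => y ZC Zy; exists C => //; exact: ZC.
have [E EC CE] := Dsub C DC; move: Cz; rewrite -CE => Cz.
have := @filter_bigI _ _ E (fun i : set X => [set y | Z y -> i y]) (nbhs z) _.
have step (i : set X) : i z -> constructible i -> nbhs z [set y | Z y -> i y].
  move=> + [n [U [F [oU cF iUF]]]]; rewrite iUF => -[j _ [Uz Fz]].
  have : nbhs z (U j) by exact: open_nbhs_nbhs.
  apply: filterS => y Uy Zy; exists j => //; split=> //.
  by rewrite (closure_id (F j)).1 //; apply: (closure_subset (A := [set z])) (Zz y Zy) => _ ->.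
move=> H; apply: (filterS _ (H _ _)).
  by move=> y Hy Zy i iE; exact: Hy.
move=> i iE; apply: step; first exact: Cz.
by have := EC i iE; rewrite inE.
Qed.

(** A minimal closed [Z] on which [phi] is unbounded is irreducible. On a Zariski open part of [Z]
    around its generic point [phi] varies by less than 1, and the rest of [Z] is a smaller closed
    set. *)
Lemma cspace_continuous_bounded (R : realType) (phi : cspace x0 -> R) :
  noetherian_space X -> continuous phi -> exists M, forall y, `|phi y| <= M.
Proof.
move=> nX cphi; pose bd (Z : set X) := exists M, forall y, Z y -> `|phi y| <= M.
suff [M HM] : bd setT by exists M => y; exact: HM.
apply: contrapT => nbd.
have [|| Z [[cZ nbZ] Zmin]] := nX [set Z | closed Z /\ ~ bd Z].
- by move=> Z [].
- by exists setT; split=> //; exact: closedT.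
have small W : closed W -> W `<=` Z -> ~ (Z `<=` W) -> bd W.
  move=> cW WZ ZW; apply: contrapT => nb; apply: ZW.
  by rewrite (Zmin W).
have bdU A B : bd A -> bd B -> bd (A `|` B).
  move=> [M HM] [N HN]; exists (Num.max M N) => y [/HM|/HN] H; rewrite le_max H //.
  by rewrite orbT.
have bdS A B : A `<=` B -> bd B -> bd A.
  by move=> AB [M HM]; exists M => y /AB; exact: HM.
have [z Zz zgen] : exists2 z, Z z & forall W, open W -> (exists x, Z x /\ W x) -> W z.
  apply: scheme_sober => //; first exact: kscheme_is_scheme.
    apply: contrapT => Z0; apply: nbZ; exists 0 => y Zy; case: Z0.
    by exists y.
  move=> F G cF cG ZFG; apply: contrapT => /not_orP [ZF ZG]; apply: nbZ.
  apply: (bdS _ ((Z `&` F) `|` (Z `&` G))).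
    by move=> y Zy; have [Fy|Gy] := ZFG y Zy; [left|right].
  apply: bdU; apply: small; try exact: closedI; try exact: subIsetl.
    by move=> ZZF; apply: ZF => y /ZZF [].
  by move=> ZZG; apply: ZG => y /ZZG [].
have Zcl : Z `<=` closure [set z].
  move=> y Zy B; rewrite nbhsE => -[W [oW Wy] WB].
  by exists z; split=> //; apply: WB; apply: zgen => //; exists y.
pose O : set (cspace x0) := phi @^-1` ball (phi z) 1.
have oO : open O by move/continuousP: cphi; apply; exact: ball_open.
have := cspace_nbhs Zcl oO (ballxx (phi z) ltr01).
rewrite nbhsE => -[W [oW Wz] WO]; apply: nbZ.
apply: (bdS _ ((Z `\` W) `|` (Z `&` W))).
  by move=> y Zy; have [Wy|Wy] := pselect (W y); [right|left].
apply: bdU.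
  apply: small; [by rewrite setDE; apply: closedI => //; exact: open_closedC|exact: subDsetl|].
  by move=> /(_ z Zz) [].
exists (`|phi z| + 1) => y [Zy /WO /(_ Zy)] /=.
rewrite /O /= /ball /= => zy.
have -> : phi y = phi z - (phi z - phi y) by rewrite opprB addrC subrK.
by rewrite (le_trans (ler_normB _ _)) // lerD2l ltW.
Qed.

Lemma cspace_continuous_generic (R : realType) (phi : cspace x0 -> R) (eta : X) (e : R) :
  generic_point eta -> continuous phi -> 0 < e ->
  exists Z : set X, [/\ closed Z, Z <> setT &
    forall y, ~ Z y -> `|phi y - phi eta| <= e].
Proof.
move=> geta cphi e0; pose O : set (cspace x0) := phi @^-1` ball (phi eta) e.
have oO : open O by move/continuousP: cphi; apply; exact: ball_open.
have Zcl : [set: X] `<=` closure [set eta] by rewrite geta.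
have := cspace_nbhs Zcl oO (ballxx (phi eta) e0).
rewrite nbhsE => -[W [oW Weta] WO]; exists (~` W); split.
- exact: open_closedC.
- by move=> /seteqP [_ /(_ eta I)].
- move=> y /contrapT /WO /(_ I); rewrite /O /= /ball /= distrC; exact: ltW.
Qed.

End ConstructibleTopology.

(** * Pullbacks of Dirac masses by iterates *)

Section PullbackIterates.
Variables (k : closedFieldType) (X : kscheme k) (f : kmor X X) (d : nat).
Variables (R : realType).
Hypothesis d_gt0 : (0 < d)%N.
Hypothesis Qf : forall y : X, rational_point y <-> rational_point (f y).
Hypothesis f_flat : forall x : X, equational_flat (fstalk f x).
Hypothesis f_finite : finite_mor f.
Hypothesis fibref : forall z : X, rational_point z -> exists n (y : 'I_n -> X),
  [/\ injective y, forall i, f (y i) = z,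
      forall y', f y' = z -> exists i, y i = y',
      forall i, (0 < multiplicity f (y i))%N &
      (\sum_i multiplicity f (y i))%N = d].

(** The fibre of f^(i+1) is the disjoint union of the fibres of f^i over the points of the fibre of
    f; the power of [d] undoes the normalisation in [transfer]. *)
Lemma iter_fibre i (z : X) : rational_point z -> exists s : seq X,
  [/\ uniq s, forall y, y \in s <-> iter_kmor f i y = z &
    forall phi : X -> R, \sum_(y <- s) (multiplicity (iter_kmor f i) y)%:R * phi y =
      d%:R ^+ i * iter i (transfer f (multiplicity f) d) phi z].
Proof.
elim: i z => [|i IH] z rz.
  exists [:: z]; split=> // [y|phi]; first by rewrite inE; split=> /eqP.
  by rewrite big_seq1 (multiplicity_iter0 f rz) expr0.
have [n [y [yinj fy yex m0 md]]] := fibref rz.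
have ry j : rational_point (y j) by apply/Qf; rewrite fy.
have /choice [S SP] := fun j => IH (y j) (ry j).
exists (flatten [seq S j | j <- enum 'I_n]); split.
- have : uniq (enum 'I_n) by exact: enum_uniq.
  elim: (enum 'I_n) => [//|j l IHl] /= /andP [jl ul].
  rewrite cat_uniq IHl // andbT; have [-> SE _] := SP j; rewrite /=.
  apply/hasPn => w /flattenP [_ /mapP [j' j'l ->] wj'].
  apply/negP => /SE wj; have [_ SE' _] := SP j'; move/SE': wj'; rewrite wj => /yinj jj'.
  by rewrite jj' j'l in jl.
- move=> w; split=> [/flattenP [_ /mapP [j _ ->] wj]|/= /yex [j yj]].
    by have [_ SE _] := SP j; move/SE: wj => /= ->.
  apply/flattenP; exists (S j); first by rewrite map_f // mem_enum.
  by have [_ SE _] := SP j; apply/SE.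
- move=> phi; rewrite big_flatten big_map big_enum /=.
  rewrite /transfer (fibre_sum _ yinj fy yex) -/(transfer f (multiplicity f) d).
  have d0 : (d%:R : R) != 0 by rewrite pnatr_eq0 -lt0n.
  rewrite exprSr -mulrA mulVKf // mulr_sumr; apply: eq_bigr => j _.
  have [_ SE Ssum] := SP j; rewrite mulrCA -Ssum mulr_sumr.
  apply: eq_big_seq => w /SE wj.
  rewrite (multiplicity_iterS f_flat f_finite) /= ?wj ?fy //.
  by rewrite natrM mulrA.
Qed.

Lemma pullback_int (x0 x : X) (hx0 : hausdorff_space (cspace x0)) i
    (phi : cspace x0 -> R) : noetherian_space X -> rational_point x -> continuous phi ->
  radon_int (pullback (iter_kmor f i) (radon_dirac R hx0 x)) phi =
  d%:R ^+ i * iter i (transfer f (multiplicity f) d) phi x.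
Proof.
move=> nX rx cphi; have [s [us sE ssum]] := iter_fibre i rx.
have pushE (psi : cspace x0 -> R) : pushforward_fun (iter_kmor f i) psi x =
    d%:R ^+ i * iter i (transfer f (multiplicity f) d) psi x.
  rewrite /pushforward_fun -ssum [RHS]fsbig_seq //.
  congr (\big[_/_]_(y \in _) _); apply/seteqP; split=> y /=; first by move/sE.
  by move=> ys; apply/sE.
rewrite /pullback; set P := [set nu | _].
(* Whatever measure [xget] selects, its defining property fixes the integral of [phi]; it remains to
   exhibit one, a sum of Dirac masses. *)
suff : P (xget radon0 P).
  by move=> /(_ phi cphi) ->; rewrite radon_int_dirac pushE.
apply: xgetPex.
exists (\big[@radonD _ R/radon0]_(y <- s)
  radonZ ((multiplicity (iter_kmor f i) y)%:R)%:nng (radon_dirac R hx0 y)).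
move=> psi cpsi; have bpsi : bounded_continuous psi.
  by split=> //; exact: cspace_continuous_bounded.
rewrite radon_int_dirac pushE -ssum radon_int_sum //.
by apply: eq_bigr => y _; rewrite radon_intZ // radon_int_dirac.
Qed.

End PullbackIterates.

Theorem theorem1p18 (R : realType) (k : closedFieldType) (X : kscheme k)
  (hX : variety X) (eta : X) (heta : generic_point eta)
  (f : kmor X X) (f_flat : flat_mor f) (f_finite : finite_mor f)
  (x : X) (hx : rational_point x)
  (x_dense : dense (\bigcup_i (iter_kmor f i @^-1` [set x])))
  (a b : nat -> nat) (hab : forall n, (a n < b n)%N)
  (hI : (b n - a n)%N @[n --> \oo] --> \oo) :
  radonZ ((b n - a n)%:R^-1)%:nng
    (\big[radonD/radon0]_(a n <= i < b n)
       radonZ ((top_degree eta f)%:R ^- i)%:nng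
         (pullback (iter_kmor f i)
            (radon_dirac R (cspace_hausdorff eta) x)))
    @[n --> \oo] --> radon_dirac R (cspace_hausdorff eta) eta.
Proof.
have [irrX redX _ ftX] := hX.
have nX := finite_type_noetherian ftX.
have fe : forall y : X, equational_flat (fstalk f y) by move=> y; exact/flat_equational.
set d := top_degree eta f.
have fibref z : rational_point z -> exists n (y : 'I_n -> X),
    [/\ injective y, forall i, f (y i) = z,
      forall y', f y' = z -> exists i, y i = y',
      forall i, (0 < multiplicity f (y i))%N &
      (\sum_i multiplicity f (y i))%N = d].
  move=> rz; have [n [y [yinj fy yex m0 [md _]]]] :=
    fibre_degree irrX redX fe f_finite heta rz.
  by exists n, y.
have d_gt0 : (0 < d)%N.
  by have [n [y [_ _ _ _ []]]] := fibre_degree irrX redX fe f_finite heta hx.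
have Qf y : rational_point y <-> rational_point (f y).
  split=> [ry c|]; last exact: (preimage_rational f_finite).
  have [l nl] := ry (fstalk f y c); exists l => uc; apply: nl.
  have := is_unit_rmorph (fstalk f y) uc; rewrite rmorphB.
  by rewrite -/(kstalk (f y) l) fstalk_kstalk.
apply: radon_cvg => phi cphi.
have bphi : bounded_continuous phi.
  by split=> //; exact: cspace_continuous_bounded.
pose avg := average (R := R) f (multiplicity f) d x a b.
have d0 : (d%:R : R) != 0 by rewrite pnatr_eq0 -lt0n.
have -> : (fun n => radon_int (radonZ ((b n - a n)%:R^-1)%:nng
    (\big[@radonD _ R/radon0]_(a n <= i < b n) radonZ (d%:R ^- i)%:nng
       (pullback (iter_kmor f i) (radon_dirac R (cspace_hausdorff eta) x)))) phi) =
    avg phi.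
  apply/funext => n; rewrite radon_intZ // radon_int_sum //= /avg /average.
  congr (_ * _); apply: eq_bigr => i _; rewrite radon_intZ //=.
  rewrite (pullback_int d_gt0 Qf fe f_finite fibref) // mulKf //.
  by rewrite expf_neq0.
rewrite radon_int_dirac.
have abV : ((b n - a n)%:R : R)^-1 @[n --> \oo] --> (0 : R).
  apply/gtr0_cvgV0; last exact/cvgrnyP.
  by apply: nearW => n; rewrite ltr0n subn_gt0.
have neg Z : closed Z -> Z <> setT -> avg \1_Z n @[n --> \oo] --> (0 : R).
  apply: (negligible_closed (Q := @rational_point k X)) => //.
  - exact: fcts.
  (* Dominance: [W] contains f(eta), which is again generic. *)
  - move=> W cW fW; have geta := image_generic irrX redX fe f_finite heta.
    apply/seteqP; split=> // y _; have : closure [set f eta] y by rewrite geta.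
    rewrite [in X in _ -> X]((closure_id W).1 cW).
    apply: (closure_subset (A := [set f eta])) => _ ->.
    have : (f @^-1` W) eta by rewrite fW.
    by [].
  - exact: (rational_open_map irrX redX fe f_finite).
  - move: x_dense; congr dense; apply: eq_bigcup => // i _.
    by apply/funext => y; rewrite /preimage /= iter_kmorE.
apply/cvgrPdist_lt => e e0.
have e20 : 0 < e / 2 by rewrite divr_gt0.
have [Z [cZ nZ phiZ]] := cspace_continuous_generic heta cphi e20.
have [_ [M phiM]] := bphi.
have M0 : 0 <= M by apply: le_trans (phiM eta).
have [avg_le avg_lin avg_cst] : [/\ forall p q n, (forall y, p y <= q y) -> avg p n <= avg q n,
   forall c p q n, avg (fun y => c * p y + q y) n = c * avg p n + avg q n &
   forall c n, avg (fun=> c) n = c].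
  split=> [p q n pq|c p q n|c n].
  - by apply: (average_le d_gt0 Qf fibref hx hab) => y _.
  - exact: (average_lin d_gt0 Qf fibref hx).
  - exact: (average_cst d_gt0 Qf fibref hx hab).
(* [phi] differs from its value at [eta] by at most e/2 off [Z], and by at most 2M on [Z]. *)
have bnd n : `|phi eta - avg phi n| <= 2 * M * avg \1_Z n + e / 2.
  have ptw y : `|phi y - phi eta| <= 2 * M * \1_Z y + e / 2.
    rewrite indicE; have [Zy|Zy] := boolP (y \in Z).
      rewrite mulr1 (le_trans (ler_normB _ _)) // -[leLHS]addr0 lerD ?(ltW e20) //.
      by rewrite mulr_natl mulr2n lerD.
    rewrite mulr0 add0r; apply: phiZ => Zy'; move: Zy.
    by rewrite (mem_set Zy').
  rewrite distrC ler_norml; apply/andP; split.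
    rewrite lerNl opprB lerBlDr -[phi eta in leLHS](avg_cst _ n).
    have <- : avg (fun y => 1 * phi y + (2 * M * \1_Z y + e / 2)) n =
       2 * M * avg \1_Z n + e / 2 + avg phi n.
      by rewrite avg_lin mul1r avg_lin avg_cst addrC.
    apply: avg_le => y; rewrite mul1r -lerBlDl.
    by rewrite (le_trans _ (ptw y)) // distrC ler_norm.
  have <- : avg (fun y => 2 * M * \1_Z y + (e / 2 + phi eta)) n - phi eta =
     2 * M * avg \1_Z n + e / 2.
    by rewrite avg_lin avg_cst addrA addrK.
  rewrite lerD2r; apply: avg_le => y; rewrite addrA -lerBlDr.
  by rewrite (le_trans _ (ptw y)) // ler_norm.
(* The added 1 keeps the divisor positive when M = 0. *)
have M21 : 0 < 2 * M + 1 by rewrite ltr_wpDl // mulr_ge0.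
have /cvgrPdist_lt /(_ _ (divr_gt0 e20 M21)) negZ := neg Z cZ nZ.
near=> n; apply: (le_lt_trans (bnd n)).
have : `|0 - avg \1_Z n| < e / 2 / (2 * M + 1) by near: n.
have avg0 : 0 <= avg \1_Z n.
  by rewrite -(avg_cst 0 n); apply: avg_le => y; rewrite indicE.
rewrite sub0r normrN ger0_norm // ltr_pdivlMr // => avgZ.
rewrite [X in _ < X](splitr e) ltrD2r; apply: le_lt_trans avgZ.
by rewrite mulrC ler_wpM2l // lerDl.
Unshelve. all: by end_near.
Qed.
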